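(* Let $V$ be a level zero irreducible (not necessarily integrable) highest weight module for the twisted full toroidal Lie algebra $\widetilde\tau$, having finite-dimensional weight spaces with respect to $\widetilde{\mathfrak h}$, and assume that $\mathfrak h_{\overline0}$ does not act trivially on the highest weight space $V_+=\{v\in V:\widetilde\tau_+.v=(0)\}$. Then $\mathcal Z(\underline m)$ acts trivially on $V$.
   Context: Everything is over $\mathbb{C}$; $U(L)$ is the universal enveloping algebra. Let $\mathfrak g$ be a finite-dimensional simple Lie algebra with Cartan subalgebra $\mathfrak h$ and a symmetric non-degenerate bilinear form $(\cdot|\cdot)$ that is invariant and preserved by every automorphism of $\mathfrak g$. Let $n\in\mathbb{N}$ and let $\sigma_1,\dots,\sigma_n$ be commuting automorphisms of $\mathfrak g$ of finite orders $m_1,\dots,m_n$. Put $\Gamma=m_1\mathbb{Z}\oplus\dots\oplus m_n\mathbb{Z}$, $G=\mathbb{Z}^n/\Gamma$, write $\underline k\mapsto\overline k$ for $\mathbb{Z}^n\to G$, fix primitive $m_i$-th roots of unity $\xi_i$, and set $\mathfrak g_{\overline k}=\{x\in\mathfrak g: \sigma_i x=\xi_i^{k_i}x,\ 1\le i\le n\}$. Write $t^{\underline k}=t_1^{k_1}\cdots t_n^{k_n}$ and $LT=\bigoplus_{\underline k\in\mathbb{Z}^n}\mathfrak g_{\overline k}\otimes\mathbb{C}t^{\underline k}$. Standing assumption ($LT$ is a Lie torus): (1) $\mathfrak g_{\overline 0}$ is a finite-dimensional simple Lie algebra; choose a Cartan subalgebra $\mathfrak h_{\overline0}\subseteq\mathfrak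 h$ of it; (2) for $\overline k\ne\overline0$ with $\mathfrak g_{\overline k}\neq 0$, $\mathfrak g_{\overline k}\cong U_{\overline k}\oplus W_{\overline k}$ as $\mathfrak g_{\overline0}$-module, where $U_{\overline k}$ is trivial and $W_{\overline k}$ is either zero or irreducible of dimension $>1$ with all $\mathfrak h_{\overline0}$-weights in $\Delta_{0,\mathrm{en}}$; (3) the group generated by the $\sigma_i$ has order $\prod_i m_i$. Here $\Delta_0^\times$ is the set of non-zero roots of $(\mathfrak g_{\overline0},\mathfrak h_{\overline0})$, $\Delta_{0,\mathrm{en}}^\times=\Delta_0^\times\cup2\Delta_{0,\mathrm{sh}}^\times$ if $\Delta_0^\times$ is of type $B_l$ ($\Delta_{0,\mathrm{sh}}^\times$ = short roots), $\Delta_{0,\mathrm{en}}^\times=\Delta_0^\times$ otherwise, and $\Delta_{0,\mathrm{en}}=\Delta_{0,\mathrm{en}}^\times\cup\{0\}$. Fix simple roots of $\mathfrak g_{\overline0}$; $\Delta_{0,\mathrm{en}}^{\times,\pm}$ are the corresponding positive/negative elements of $\Delta_{0,\mathrm{en}}^\times$. For $\alpha\in\mathfrak h_{\overline0}^*$ put $\mathfrak g_{\overline k}(\alpha)=\{x\in\mathfrak g_{\overline k}:[h,x]=\alpha(h)x\ \forall h\in\mathfrak h_{\overline0}\}$. Twisted full toroidal Lie algebra: $\widetilde\tau=LT\oplus\mathcal Z(\underline m)\oplus\mathcal D(\underline m)$, where $\mathcal Z(\underline m)$ is spanned by symbols $t^{\underline r}K_i$ ($\underline r\in\Gamma$, $1\le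 i\le n$) modulo the relations $\sum_i r_it^{\underline r}K_i=0$, and $\mathcal D(\underline m)=\mathrm{span}\{t^{\underline r}d_i:\underline r\in\Gamma,1\le i\le n\}$. Brackets: $[x\otimes t^{\underline k},y\otimes t^{\underline l}]=[x,y]\otimes t^{\underline k+\underline l}+(x|y)\sum_ik_it^{\underline k+\underline l}K_i$; $\mathcal Z(\underline m)$ commutes with $LT\oplus\mathcal Z(\underline m)$; $[t^{\underline r}d_i,t^{\underline s}K_j]=s_it^{\underline r+\underline s}K_j+\delta_{ij}\sum_pr_pt^{\underline r+\underline s}K_p$; $[t^{\underline r}d_i,t^{\underline s}d_j]=s_it^{\underline r+\underline s}d_j-r_jt^{\underline r+\underline s}d_i+\phi(t^{\underline r}d_i,t^{\underline s}d_j)$; $[t^{\underline r}d_i,x\otimes t^{\underline k}]=k_i\,x\otimes t^{\underline k+\underline r}$. Here $\phi$ is a fixed linear combination of the cocycles $\phi_1(t^{\underline r}d_i,t^{\underline s}d_j)=-s_ir_j\sum_pr_pt^{\underline r+\underline s}K_p$ and $\phi_2(t^{\underline r}d_i,t^{\underline s}d_j)=r_is_j\sum_pr_pt^{\underline r+\underline s}K_p$. Put $\widetilde{\mathfrak h}=\mathfrak h_{\overline0}\oplus\sum_i\mathbb{C}K_i\oplus\sum_i\mathbb{C}d_i$. Triangular decomposition $\widetilde\tau=\widetilde\tau_-\oplus\widetilde\tau_0\oplus\widetilde\tau_+$: $\widetilde\tau_\pm=\bigoplus_{\alpha\in\Delta_{0,\mathrm{en}}^{\times,\pm},\,\underline k\in\mathbb{Z}^n}\mathfrak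 g_{\overline k}(\alpha)\otimes\mathbb{C}t^{\underline k}$, $\widetilde\tau_0=\big(\bigoplus_{\underline k}\mathfrak g_{\overline k}(0)\otimes\mathbb{C}t^{\underline k}\big)\oplus\mathcal Z(\underline m)\oplus\mathcal D(\underline m)$. A level zero highest weight module is a $\widetilde\tau$-module $V$ with a non-zero $\widetilde{\mathfrak h}$-weight vector $v$ such that $V=U(\widetilde\tau)v$, $\widetilde\tau_+.v=0$, $U(\widetilde\tau_0)v$ is an irreducible $\widetilde\tau_0$-module, and $K_1,\dots,K_n$ act trivially on $V$. *)

(* Defs.v *)
From HB Require Import structures.
From mathcomp Require Import all_boot all_order all_algebra.
From mathcomp Require Import complex finmap.
From mathcomp Require Import mathcomp_extra boolp classical_sets functions.
From mathcomp Require Import cardinality fsbigop reals.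

Set Implicit Arguments.
Unset Strict Implicit.
Unset Printing Implicit Defensive.

Import Order.TTheory GRing.Theory Num.Theory.
Local Open Scope classical_set_scope.
Local Open Scope card_scope.
Local Open Scope ring_scope.

Section Span.
Variables (F : fieldType) (V : lmodType F).

Definition is_subspace (W : set V) : Prop :=
  W 0 /\ forall a u v, W u -> W v -> W (a *: u + v).

Definition lspan (S : set V) : set V := smallest is_subspace S.

Definition fin_dim (W : set V) : Prop :=
  exists s : seq V, W `<=` lspan [set` s].

Lemma lspan_subspace S : is_subspace (lspan S).
Proof.
split=> [M [[]]//|a u v Su Sv M MS]; case: (MS) => -[_ MD] _.
by apply: MD; [apply: Su|apply: Sv].
Qed.

Lemma sub_lspan S : S `<=` lspan S.
Proof. exact: sub_gen_smallest. Qed.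

Lemma lspan_min S W : is_subspace W -> S `<=` W -> lspan S `<=` W.
Proof. exact: smallest_sub. Qed.

End Span.

Section SpanQuotient.
Variables (F : fieldType) (V : lmodType F) (S : set V).

Definition lspan_pred : {pred V} := fun v => `[< lspan S v >].

Lemma lspan_zmod_closed : zmod_closed lspan_pred.
Proof.
have [S0 SD] := lspan_subspace S; split=> [|u v]; first exact/asboolP.
rewrite -!topredE /= => /asboolP Su /asboolP Sv; apply/asboolP.
by rewrite -[u - v]addrC -scaleN1r; apply: SD.
Qed.
HB.instance Definition _ :=
  GRing.isZmodClosed.Build V lspan_pred lspan_zmod_closed.

Definition lquot := (Quotient.quot lspan_pred).
HB.instance Definition _ := GRing.Zmodule.on lquot.

Definition lpi (v : V) : lquot := \pi_((Quotient.quot lspan_pred))%qT v.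
Definition lrepr (z : lquot) : V := repr (z : (Quotient.quot lspan_pred)).

Lemma lreprK z : lpi (lrepr z) = z.
Proof. exact: reprK. Qed.

Lemma lpi_eq u v : lpi u = lpi v <-> lspan S (u - v).
Proof.
rewrite (rwP eqP) /lpi -Quotient.idealrBE -topredE /= /lspan_pred.
by split=> [/asboolP|?] //; apply/asboolP.
Qed.

Lemma lpiB u v : lpi (u - v) = lpi u - lpi v.
Proof. by rewrite /lpi !piE. Qed.

Lemma lpiD u v : lpi (u + v) = lpi u + lpi v.
Proof. by rewrite /lpi !piE. Qed.

Definition lquot_scale (a : F) (z : lquot) : lquot := lpi (a *: lrepr z).

Lemma lpiZ a v : lpi (a *: v) = lquot_scale a (lpi v).
Proof.
apply/lpi_eq; rewrite -scalerBr.
have /lpi_eq Sv : lpi v = lpi (lrepr (lpi v)) by rewrite lreprK.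
have [S0 SD] := lspan_subspace S.
by rewrite -[_ *: _]addr0; apply: SD.
Qed.

Lemma lquot_scaleA a b z :
  lquot_scale a (lquot_scale b z) = lquot_scale (a * b) z.
Proof. by rewrite -[z]lreprK -!lpiZ scalerA. Qed.
Lemma lquot_scale1 : left_id 1 lquot_scale.
Proof. by move=> z; rewrite -[z]lreprK -lpiZ scale1r. Qed.
Lemma lquot_scaleDr : right_distributive lquot_scale +%R.
Proof.
by move=> a z z'; rewrite -[z]lreprK -[z']lreprK -lpiD -!lpiZ scalerDr lpiD.
Qed.
Lemma lquot_scaleDl z : {morph lquot_scale^~ z : a b / a + b}.
Proof. by move=> a b; rewrite -[z]lreprK -!lpiZ scalerDl lpiD. Qed.
HB.instance Definition _ := GRing.Zmodule_isLmodule.Build F lquot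
  lquot_scaleA lquot_scale1 lquot_scaleDr lquot_scaleDl.

Lemma lpi_is_linear : linear lpi.
Proof. by move=> a u v; rewrite lpiD lpiZ. Qed.
HB.instance Definition _ :=
  GRing.isLinear.Build F V lquot _ lpi lpi_is_linear.

End SpanQuotient.

Section Laurent.
Variables (F : fieldType) (n : nat) (V : lmodType F).

Definition fin_supp : {pred ('rV[int]_n -> V)} :=
  fun f => `[< finite_set [set k | f k != 0] >].

Record laurent := Laurent {
  coef :> 'rV[int]_n -> V;
  _ : coef \in fin_supp
}.
HB.instance Definition _ := [isSub for coef].
HB.instance Definition _ := [Choice of laurent by <:].

Lemma fin_supp_submod_closed : submod_closed fin_supp.
Proof.
split=> [|a f g]; rewrite -!topredE /=.
  apply/asboolP; rewrite (_ : mkset _ = set0) // -subset0 => k /=.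
  by case/eqP.
move=> /asboolP fF /asboolP gF; apply/asboolP.
apply: (@sub_finite_set _ _ ([set k | f k != 0] `|` [set k | g k != 0])).
  move=> k /= ; case: (eqVneq (f k) 0) => [fk0|]; last by left.
  case: (eqVneq (g k) 0) => [gk0|]; last by right.
  by rewrite [X in X != 0](_ : _ = a *: f k + g k) // fk0 gk0 scaler0 addr0 eqxx.
by rewrite finite_setU.
Qed.
HB.instance Definition _ := GRing.isSubmodClosed.Build F ('rV[int]_n -> V)
  fin_supp fin_supp_submod_closed.
HB.instance Definition _ := [SubChoice_isSubLmodule of laurent by <:].

Definition mono_fun (k : 'rV[int]_n) (v : V) : 'rV[int]_n -> V :=
  fun l => if l == k then v else 0.

Lemma mono_subproof k v : mono_fun k v \in fin_supp.
Proof.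
apply/asboolP; apply: (@sub_finite_set _ _ [set k]) => [l|]; last exact: finite_set1.
by rewrite /= /mono_fun; case: ifP => [/eqP|_ /eqP].
Qed.

(* v (x) t^k *)
Definition mono k v : laurent := Laurent (mono_subproof k v).

End Laurent.

(* Bilinear extension of a rule B given on pairs of monomials u (x) t^k and
   v (x) t^l. *)
Definition bext (F : fieldType) (n : nat) (U V : lmodType F) (W : zmodType)
    (B : 'rV[int]_n -> 'rV[int]_n -> U -> V -> W)
    (f : laurent n U) (g : laurent n V) : W :=
  \sum_(k \in [set: 'rV[int]_n]) \sum_(l \in [set: 'rV[int]_n]) B k l (f k) (g l).

Section BextTheory.
Variables (F : fieldType) (n : nat).
Local Notation ZZ := 'rV[int]_n.

Lemma coef_mono (V : lmodType F) (k l : ZZ) (v : V) :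
  mono k v l = if l == k then v else 0.
Proof. by []. Qed.

Lemma coefD (V : lmodType F) (f g : laurent n V) k : (f + g) k = f k + g k.
Proof. by []. Qed.

Lemma coefZ (V : lmodType F) a (f : laurent n V) k : (a *: f) k = a *: f k.
Proof. by []. Qed.

Lemma fsum_mono (V : lmodType F) (W : zmodType) (B : ZZ -> V -> W) k v :
  (forall l, B l 0 = 0) ->
  \sum_(l \in [set: ZZ]) B l (mono k v l) = B k v.
Proof.
move=> B0; rewrite -(fsbig_widen [set k]) //.
  by rewrite fsbig_set1 coef_mono eqxx.
by move=> l [_ /= lk]; rewrite /mono_fun; case: ifP => [/eqP|_]; rewrite ?B0.
Qed.

Lemma fsum_linear (V W : lmodType F) (B : ZZ -> V -> W) :
  (forall l, linear (B l)) ->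
  linear (fun f : laurent n V => \sum_(l \in [set: ZZ]) B l (f l)).
Proof.
move=> Blin a f g.
have B0 l : B l 0 = 0 by have := Blin l (-1) 0 0; rewrite !scaleN1r !addNr.
pose A := [set k | f k != 0] `|` [set k | g k != 0].
have Afin : finite_set A.
  by rewrite finite_setU; split; [case: f {A}|case: g {A}] => h /= /asboolP.
have E (h : laurent n V) : (forall k, ~ A k -> h k = 0) ->
    \sum_(l \in [set: ZZ]) B l (h l) = \sum_(l <- fset_set A) B l (h l).
  move=> hA; rewrite -(fsbig_widen A) ?fsbig_finite //.
  by move=> l [_ /= lA]; rewrite hA //; apply: B0.
have fA k : ~ A k -> f k = 0.
  by move=> Ak; apply/eqP/negPn/negP => fk; apply: Ak; left.
have gA k : ~ A k -> g k = 0.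
  by move=> Ak; apply/eqP/negPn/negP => gk; apply: Ak; right.
rewrite !E // => [|k Ak]; last by rewrite coefD coefZ fA ?gA // scaler0 addr0.
rewrite scaler_sumr -big_split /=; apply: eq_bigr => l _.
by rewrite -Blin.
Qed.

Lemma bext_mono (U V : lmodType F) (W : zmodType)
    (B : ZZ -> ZZ -> U -> V -> W) k l u v :
  (forall k l v, B k l 0 v = 0) -> (forall k l u, B k l u 0 = 0) ->
  bext B (mono k u) (mono l v) = B k l u v.
Proof.
move=> B0l B0r; rewrite /bext.
rewrite (fsum_mono (B := fun k' x => \sum_(l' \in setT) B k' l' x (mono l v l'))).
  by rewrite (fsum_mono (B := fun l' => B k l' u)).
by move=> k'; apply: fsbig1 => l' _.
Qed.

Lemma bext0l (U V : lmodType F) (W : zmodType)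
    (B : ZZ -> ZZ -> U -> V -> W) g :
  (forall k l v, B k l 0 v = 0) -> bext B 0 g = 0.
Proof. by move=> B0; apply: fsbig1 => k _; apply: fsbig1 => l _; apply: B0. Qed.

Lemma bext0r (U V : lmodType F) (W : zmodType)
    (B : ZZ -> ZZ -> U -> V -> W) f :
  (forall k l u, B k l u 0 = 0) -> bext B f 0 = 0.
Proof. by move=> B0; apply: fsbig1 => k _; apply: fsbig1 => l _; apply: B0. Qed.

End BextTheory.

Section Lie.
Variables (F : fieldType) (L : lmodType F).

Record lie_bracket (br : L -> L -> L) : Prop := {
  lie_linl : forall y, linear (br^~ y);
  lie_linr : forall x, linear (br x);
  lie_alt : forall x, br x x = 0;
  lie_jacobi : forall x y z,
    br x (br y z) + br y (br z x) + br z (br x y) = 0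
}.

(* V is a module over the subalgebra S; the values of rho outside of S are
   irrelevant. *)
Record lie_module (br : L -> L -> L) (S : set L) (V : lmodType F)
    (rho : L -> V -> V) : Prop := {
  mod_linr : forall x, S x -> linear (rho x);
  mod_linl : forall a x y v, S x -> S y ->
    rho (a *: x + y) v = a *: rho x v + rho y v;
  mod_br : forall x y v, S x -> S y ->
    rho (br x y) v = rho x (rho y v) - rho y (rho x v)
}.

Definition stable (S : set L) (V : lmodType F) (rho : L -> V -> V)
    (W : set V) : Prop := forall x v, S x -> W v -> W (rho x v).

Definition irreducible (S : set L) (V : lmodType F) (rho : L -> V -> V)
    (W : set V) : Prop :=
  [/\ is_subspace W, stable S rho W, W != [set 0] &
   forall W' : set V, W' `<=` W -> is_subspace W' -> stable S rho W' ->
     W' = [set 0] \/ W' = W].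

(* U(S)v, spanned by the x_1 ... x_p v with x_1, ..., x_p in S. *)
Definition U_orbit (S : set L) (V : lmodType F) (rho : L -> V -> V) (v : V) :
    set V :=
  lspan [set foldr rho v s | s in [set s : seq L | [set` s] `<=` S]].

End Lie.

Section FinDimLie.
Variables (F : fieldType) (g : vectType F) (br : g -> g -> g).
Implicit Types L H I : {vspace g}.

Definition lie_subalg H : Prop := {in H &, forall x y, br x y \in H}.

Definition lie_simple L : Prop :=
  [/\ lie_subalg L,
      exists x y, [/\ x \in L, y \in L & br x y != 0] &
      forall I, (I <= L)%VS -> {in L & I, forall x y, br x y \in I} ->
        I = 0%VS \/ I = L].

Definition lie_nilpotent H : Prop :=
  exists N, forall (s : seq g) (y : g),
    size s = N -> {subset s <= H} -> y \in H -> foldr br y s = 0.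

Definition cartan L H : Prop :=
  [/\ (H <= L)%VS, lie_subalg H, lie_nilpotent H &
      {in L, forall x, {in H, forall h, br x h \in H} -> x \in H}].

Definition lie_aut (f : 'End(g)) : Prop :=
  bijective f /\ forall x y, f (br x y) = br (f x) (f y).

Record invariant_form (form : g -> g -> F) : Prop := {
  form_linr : forall x, scalar (form x);
  form_sym : forall x y, form x y = form y x;
  form_nondeg : forall x, (forall y, form x y = 0) -> x = 0;
  form_inv : forall x y z, form (br x y) z = form x (br y z);
  form_aut : forall f : 'End(g), lie_aut f ->
    forall x y, form (f x) (f y) = form x y
}.

End FinDimLie.

Definition end_order (F : fieldType) (g : vectType F) (f : 'End(g)) (m : nat) :
    Prop :=
  [/\ (0 < m)%N, iter m f =1 id &
      forall j, (0 < j < m)%N -> ~ (iter j f =1 id)].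

Inductive gen_group (F : fieldType) (g : vectType F) (n : nat)
    (sigma : 'I_n -> 'End(g)) : set 'End(g) :=
| gen_one : gen_group sigma \1%VF
| gen_mul i f : gen_group sigma f -> gen_group sigma (sigma i \o f)%VF
| gen_inv i f : gen_group sigma f -> gen_group sigma ((sigma i)^-1 \o f)%VF.

Section Roots.
Variables (F : fieldType) (E : vectType F).

(* B_l in the usual coordinates: the roots are +-e_i and +-e_i +- e_j (i <> j),
   the +-e_i being the short ones.  B_1 = A_1 is included, all of its roots
   being short. *)
Definition B_short l (e : l.-tuple E) : set E :=
  [set a | exists (i : 'I_l) (s : bool), a = (-1) ^+ s *: e`_i].

Definition B_roots l (e : l.-tuple E) : set E :=
  B_short e `|`
  [set a | exists (i j : 'I_l) (s t : bool),
     i != j /\ a = (-1) ^+ s *: e`_i + (-1) ^+ t *: e`_j].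

Definition enlarged (Phi : set E) : set E :=
  Phi `|` [set a | exists l (e : l.-tuple E),
    [/\ free e, Phi = B_roots e & exists2 b, B_short e b & a = b *+ 2]].

Definition nneg_comb (Pi : seq E) : set E :=
  [set a | exists c : 'I_(size Pi) -> nat, a = \sum_(i < size Pi) Pi`_i *+ c i].

Definition root_base (Phi : set E) (Pi : seq E) : Prop :=
  [/\ free Pi, [set` Pi] `<=` Phi &
      forall a, Phi a -> nneg_comb Pi a \/ nneg_comb Pi (- a)].

End Roots.

Section LieTorus.
Variables (F : fieldType) (g : vectType F) (br : g -> g -> g).
Variables (n : nat) (sigma : 'I_n -> 'End(g)) (m : 'I_n -> nat) (xi : 'I_n -> F).

Definition Gam : set 'rV[int]_n :=
  [set k | forall i, ((m i)%:Z %| k ord0 i)%Z].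

Definition gr (k : 'rV[int]_n) : {vspace g} :=
  (\bigcap_(i < n) passmx.leigenspace (sigma i) (xi i ^ k ord0 i))%VS.

Lemma grP (k : 'rV[int]_n) x :
  reflect (forall i, sigma i x = xi i ^ k ord0 i *: x) (x \in gr k).
Proof.
have E i : (x \in passmx.leigenspace (sigma i) (xi i ^ k ord0 i)) =
    (sigma i x == xi i ^ k ord0 i *: x).
  by rewrite memv_ker add_lfunE opp_lfunE scale_lfunE id_lfunE subr_eq0.
rewrite memvE; apply: (iffP subv_bigcapP) => [H i|H i _].
  by apply/eqP; rewrite -E memvE; apply: H.
by rewrite -memvE E H eqxx.
Qed.

Variable h0 : {vspace g}.

Definition dual := 'Hom(subvs_of h0, F^o).

Definition has_weight (a : dual) (x : g) : Prop :=
  forall h : subvs_of h0, br (vsval h) x = a h *: x.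

(* g_k(a) *)
Definition gr_wt (k : 'rV[int]_n) (a : dual) : set g :=
  [set x | x \in gr k /\ has_weight a x].

Definition Delta0 : set dual :=
  [set a | a != 0 /\ exists2 x, x != 0 & gr_wt 0 a x].

Definition Delta_en : set dual := enlarged Delta0.

Definition Delta_en_pos (Pi : seq dual) : set dual :=
  Delta_en `&` nneg_comb Pi.

Record lie_torus : Prop := {
  torus_simple : lie_simple br (gr 0);
  torus_cartan : cartan br (gr 0) h0;
  torus_comp : forall k, ~ Gam k -> gr k != 0%VS ->
    exists U W : {vspace g},
      [/\ gr k = (U + W)%VS, directv (U + W),
          {in gr 0 & U, forall x u, br x u = 0},
          stable [set` gr 0] br [set` W] &
          W = 0%VS \/
          [/\ (1 < \dim W)%N, irreducible [set` gr 0] br [set` W] &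
           forall (a : dual) x, x \in W -> x != 0 -> has_weight a x ->
             (Delta_en `|` [set 0]) a]];
  torus_order : gen_group sigma #= `I_(\prod_i m i)
}.

End LieTorus.

Section FullToroidal.
Variables (F : fieldType) (n : nat) (g : vectType F).
Local Notation ZZ := 'rV[int]_n.

(* In laurent n 'rV[F]_n the vector e_i (x) t^r stands for t^r K_i, resp.
   t^r d_i. *)
Definition K_rel : set (laurent n 'rV[F]_n) :=
  range (fun r : ZZ =>
    \sum_i (r ord0 i)%:~R *: mono r (delta_mx ord0 i : 'rV[F]_n)).

Definition Zspace := lquot K_rel.
HB.instance Definition _ := GRing.Lmodule.on Zspace.

Definition toroidal : Type := laurent n g * Zspace * laurent n 'rV[F]_n.
HB.instance Definition _ := GRing.Lmodule.on toroidal.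

Definition tX (k : ZZ) (x : g) : toroidal := (mono k x, 0, 0).
Definition tK (r : ZZ) (i : 'I_n) : toroidal :=
  (0, lpi K_rel (mono r (delta_mx ord0 i)), 0).
Definition td (r : ZZ) (i : 'I_n) : toroidal := (0, 0, mono r (delta_mx ord0 i)).

Definition sumK (k r : ZZ) : toroidal :=
  \sum_p (k ord0 p)%:~R *: tK r p.

Variables (br : g -> g -> g) (form : g -> g -> F) (c1 c2 : F).

Definition phi1 (r : ZZ) i (s : ZZ) j : toroidal :=
  - ((s ord0 i)%:~R * (r ord0 j)%:~R) *: sumK r (r + s).
Definition phi2 (r : ZZ) i (s : ZZ) j : toroidal :=
  ((r ord0 i)%:~R * (s ord0 j)%:~R) *: sumK r (r + s).

Definition brXX (k l : ZZ) (x y : g) : toroidal :=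
  tX (k + l) (br x y) + form x y *: sumK k (k + l).
Definition brdX (r : ZZ) i (k : ZZ) (x : g) : toroidal :=
  (k ord0 i)%:~R *: tX (k + r) x.
Definition brdK (r : ZZ) i (s : ZZ) j : toroidal :=
  (s ord0 i)%:~R *: tK (r + s) j + (i == j)%:R *: sumK r (r + s).
Definition brdd (r : ZZ) i (s : ZZ) j : toroidal :=
  (s ord0 i)%:~R *: td (r + s) j - (r ord0 j)%:~R *: td (r + s) i
  + (c1 *: phi1 r i s j + c2 *: phi2 r i s j).

Definition brdX_ext (r k : ZZ) (b : 'rV[F]_n) (x : g) : toroidal :=
  \sum_i b ord0 i *: brdX r i k x.
Definition brdK_ext (r s : ZZ) (b a : 'rV[F]_n) : toroidal :=
  \sum_i \sum_j (b ord0 i * a ord0 j) *: brdK r i s j.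
Definition brdd_ext (r s : ZZ) (b c : 'rV[F]_n) : toroidal :=
  \sum_i \sum_j (b ord0 i * c ord0 j) *: brdd r i s j.

(* The choice of representatives in the quotient Zspace is immaterial: see
   bext_brdK_lpi below. *)
Definition tbr (u v : toroidal) : toroidal :=
  let: (x, z, d) := u in let: (x', z', d') := v in
  bext brXX x x' + bext brdX_ext d x' - bext brdX_ext d' x
  + bext brdK_ext d (lrepr z') - bext brdK_ext d' (lrepr z)
  + bext brdd_ext d d'.

Lemma sumK_eq0 r : sumK r r = 0.
Proof.
have : lpi K_rel (\sum_i (r ord0 i)%:~R *: mono r (delta_mx ord0 i)) = 0.
  rewrite -[RHS](linear0 (lpi K_rel)); apply/lpi_eq; rewrite subr0.
  by apply: (@sub_lspan _ _ K_rel); exists r.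
rewrite linear_sum /= => rel.
have E (s : seq 'I_n) :
    \sum_(i <- s) (r ord0 i)%:~R *: tK r i = ((0 : laurent n g),
      \sum_(i <- s) lpi K_rel ((r ord0 i)%:~R *: mono r (delta_mx ord0 i)),
      (0 : laurent n 'rV[F]_n)).
  elim: s => [|i s IH]; first by rewrite !big_nil.
  rewrite !big_cons IH linearZ /=.
  by congr (_, _, _); rewrite /= scaler0 addr0.
by rewrite /sumK E rel.
Qed.

Lemma sumKD k l r : sumK (k + l) r = sumK k r + sumK l r.
Proof.
rewrite /sumK -big_split; apply: eq_bigr => p _ /=.
by rewrite !mxE intrD scalerDl.
Qed.

Lemma brdK_ext_linear r s b : linear (brdK_ext r s b).
Proof.
move=> a u v; rewrite /brdK_ext scaler_sumr -big_split; apply: eq_bigr => i _ /=.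
rewrite scaler_sumr -big_split; apply: eq_bigr => j _ /=.
by rewrite !mxE scalerA -scalerDl mulrDr mulrCA.
Qed.

Lemma brdK_ext_rel r s b :
  brdK_ext r s b (map_mx intr s) = 0.
Proof.
rewrite /brdK_ext big1 // => i _.
transitivity ((b ord0 i * (s ord0 i)%:~R) *: sumK (r + s) (r + s)); last first.
  by rewrite sumK_eq0 scaler0.
rewrite addrC [in sumK (s + r) _]sumKD scalerDr.
under eq_bigr => j _ do rewrite mxE /brdK scalerDr.
rewrite big_split /=; congr (_ + _).
  rewrite /sumK scaler_sumr; apply: eq_bigr => j _.
  by rewrite !scalerA [s + r]addrC -!mulrA [_%:~R * _]mulrC.
rewrite (bigD1 i) //= eqxx scale1r big1 ?addr0 1?[s + r]addrC // => j ji.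
by rewrite eq_sym (negbTE ji) scale0r scaler0.
Qed.

Lemma bext_brdK_lpi d f f' :
  lpi K_rel f = lpi K_rel f' -> bext brdK_ext d f = bext brdK_ext d f'.
Proof.
move=> /lpi_eq ff'; apply: eq_fsbigr => k _.
pose Phi (h : laurent n 'rV[F]_n) := \sum_(l \in setT) brdK_ext k l (d k) (h l).
have Plin : linear Phi by apply: (fsum_linear (B := fun l => brdK_ext k l (d k))) => l; apply: brdK_ext_linear.
have P0 : Phi 0 = 0 by have := Plin (-1) 0 0; rewrite !scaleN1r !addNr.
suff : Phi (f - f') = 0.
  rewrite addrC -scaleN1r Plin scaleN1r addrC => /eqP.
  by rewrite subr_eq0 => /eqP.
apply: (lspan_min _ _ ff' (W := [set h | Phi h = 0])).
  by split=> // a u v /= Pu Pv; rewrite Plin Pu Pv scaler0 addr0.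
move=> _ [r _ <-] /=.
rewrite (_ : \sum_i _ = mono r (map_mx intr r)); last first.
  apply: val_inj; apply/funext => l; rewrite [RHS]coef_mono.
  have E (s : seq 'I_n) :
    (\sum_(i <- s) (r ord0 i)%:~R *: mono r (delta_mx ord0 i) : laurent n 'rV[F]_n) l =
    \sum_(i <- s) (r ord0 i)%:~R *: (if l == r then delta_mx ord0 i else 0).
    by elim: s => [|i s IH]; rewrite ?big_nil // !big_cons coefD IH.
  rewrite [LHS]E; case: eqP => _; last by rewrite big1 // => i; rewrite scaler0.
  by rewrite [RHS]row_sum_delta; apply: eq_bigr => i _; rewrite mxE.
rewrite /Phi (fsum_mono (B := fun l => brdK_ext k l (d k))) ?brdK_ext_rel //.
move=> l; have := brdK_ext_linear k l (d k) (-1) 0 0.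
by rewrite !scaleN1r !addNr.
Qed.

Section Brackets.
Hypotheses (br_lie : lie_bracket br)
           (form_lin : forall x, scalar (form x))
           (form_symm : forall x y, form x y = form y x).

Let br0l x : br 0 x = 0.
Proof. by have := lie_linl br_lie x (-1) 0 0; rewrite !scaleN1r !addNr. Qed.
Let br0r x : br x 0 = 0.
Proof. by have := lie_linr br_lie x (-1) 0 0; rewrite !scaleN1r !addNr. Qed.
Let form0r x : form x 0 = 0.
Proof. by have := form_lin x (-1) 0 0; rewrite scaleN1r addNr mulN1r addNr. Qed.
Let form0l x : form 0 x = 0. Proof. by rewrite form_symm. Qed.
Let tX0 k : tX k 0 = 0.
Proof.
congr (_, _, _); apply: val_inj; apply/funext => l.
by rewrite /= /mono_fun; case: ifP.
Qed.

Let brXX0l k l y : brXX k l 0 y = 0.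
Proof. by rewrite /brXX br0l form0l tX0 scale0r addr0. Qed.
Let brXX0r k l x : brXX k l x 0 = 0.
Proof. by rewrite /brXX br0r form0r tX0 scale0r addr0. Qed.
Let brdX0l k l y : brdX_ext k l 0 y = 0.
Proof. by rewrite /brdX_ext big1 // => i _; rewrite mxE scale0r. Qed.
Let brdX0r k l b : brdX_ext k l b 0 = 0.
Proof. by rewrite /brdX_ext big1 // => i _; rewrite /brdX tX0 !scaler0. Qed.
Let brdK0l k l y : brdK_ext k l 0 y = 0.
Proof.
by rewrite /brdK_ext big1 // => i _; rewrite big1 // => j _; rewrite mxE mul0r scale0r.
Qed.
Let brdK0r k l b : brdK_ext k l b 0 = 0.
Proof.
by rewrite /brdK_ext big1 // => i _; rewrite big1 // => j _; rewrite mxE mulr0 scale0r.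
Qed.
Let brdd0l k l y : brdd_ext k l 0 y = 0.
Proof.
by rewrite /brdd_ext big1 // => i _; rewrite big1 // => j _; rewrite mxE mul0r scale0r.
Qed.
Let brdd0r k l b : brdd_ext k l b 0 = 0.
Proof.
by rewrite /brdd_ext big1 // => i _; rewrite big1 // => j _; rewrite mxE mulr0 scale0r.
Qed.
Let bext_repr0 d : bext brdK_ext d (lrepr (0 : Zspace)) = 0.
Proof.
rewrite (@bext_brdK_lpi _ _ 0) ?bext0r //.
by rewrite lreprK linear0.
Qed.

Let sum_delta2 (W : lmodType F) (B : 'I_n -> 'I_n -> W) i j :
  \sum_i' \sum_j' ((delta_mx ord0 i : 'rV[F]_n) ord0 i' *
     (delta_mx ord0 j : 'rV[F]_n) ord0 j') *: B i' j' = B i j.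
Proof.
rewrite (bigD1 i) //= (bigD1 j) //= !mxE !eqxx mulr1 scale1r.
rewrite !big1 ?addr0 // => [i' i'i|j' j'j].
  by rewrite big1 // => j' _; rewrite !mxE (negbTE i'i) andbF mul0r scale0r.
by rewrite !mxE (negbTE j'j) andbF mulr0 scale0r.
Qed.

Let zeroE := (bext_repr0, (fun h => bext0l h brXX0l), (fun h => bext0r h brXX0r), (fun h => bext0l h brdX0l),
  (fun h => bext0r h brdX0r), (fun h => bext0l h brdK0l), (fun h => bext0r h brdK0r), (fun h => bext0l h brdd0l),
  (fun h => bext0r h brdd0r), addr0, subr0, add0r, sub0r).

Lemma tbr_XX k l x y : tbr (tX k x) (tX l y) = brXX k l x y.
Proof. by rewrite /tbr /= !zeroE bext_mono. Qed.

Lemma tbr_XK k x s j : tbr (tX k x) (tK s j) = 0.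
Proof. by rewrite /tbr /= !zeroE oppr0. Qed.

Lemma tbr_KK r i s j : tbr (tK r i) (tK s j) = 0.
Proof. by rewrite /tbr /= !zeroE oppr0. Qed.

Lemma tbr_dX r i k x : tbr (td r i) (tX k x) = brdX r i k x.
Proof.
rewrite /tbr /= !zeroE bext_mono // /brdX_ext (bigD1 i) //= mxE !eqxx scale1r.
by rewrite big1 ?addr0 // => j ji; rewrite mxE (negbTE ji) andbF scale0r.
Qed.

Lemma tbr_dK r i s j : tbr (td r i) (tK s j) = brdK r i s j.
Proof.
rewrite /tbr /= !zeroE (bext_brdK_lpi _ (lreprK _)) bext_mono //.
exact: sum_delta2.
Qed.

Lemma tbr_dd r i s j : tbr (td r i) (td s j) = brdd r i s j.
Proof. by rewrite /tbr /= !zeroE bext_mono //; apply: sum_delta2. Qed.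

Lemma tbr_Xd k x r i : tbr (tX k x) (td r i) = - brdX r i k x.
Proof.
rewrite /tbr /= !zeroE bext_mono // /brdX_ext (bigD1 i) //= mxE !eqxx scale1r.
by rewrite big1 ?addr0 // => j ji; rewrite mxE (negbTE ji) andbF scale0r.
Qed.

Lemma tbr_Kd s j r i : tbr (tK s j) (td r i) = - brdK r i s j.
Proof.
rewrite /tbr /= !zeroE (bext_brdK_lpi _ (lreprK _)) bext_mono //.
by congr (- _); apply: sum_delta2.
Qed.

End Brackets.

End FullToroidal.

Arguments tK F {n} g r i.
Arguments td F {n} g r i.

Section TwistedToroidal.
Variables (F : fieldType) (g : vectType F) (br : g -> g -> g).
Variables (n : nat) (sigma : 'I_n -> 'End(g)) (m : 'I_n -> nat) (xi : 'I_n -> F).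
Local Notation T := (toroidal n g).

(* The twisted algebra sits inside the full toroidal algebra of g.  The
   relations in K_rel being homogeneous, Zm is also the span of the t^r K_i,
   r in Gam, modulo those relations with r in Gam. *)
Definition Zm : set T :=
  lspan [set z | exists2 r, Gam m r & exists i, z = tK F g r i].

Definition twisted : set T :=
  lspan ([set x | exists k, exists2 y, y \in gr sigma xi k & x = tX k y]
    `|` Zm
    `|` [set x | exists2 r, Gam m r & exists i, x = td F g r i]).

Variables (h0 : {vspace g}) (Pi : seq (dual h0)).

Definition twisted_plus : set T :=
  lspan [set x | exists (a : dual h0) k, exists2 y,
    Delta_en_pos br sigma xi Pi a /\ gr_wt br sigma xi k a y & x = tX k y].

Definition twisted_zero : set T :=
  lspan ([set x | exists k, exists2 y,
            gr_wt br sigma xi k (0 : dual h0) y & x = tX k y]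
    `|` Zm
    `|` [set x | exists2 r, Gam m r & exists i, x = td F g r i]).

Definition htilde := (subvs_of h0 * 'rV[F]_n * 'rV[F]_n)%type.

Definition htilde_emb (h : htilde) : T :=
  tX 0 (vsval h.1.1) + \sum_i h.1.2 ord0 i *: tK F g 0 i
  + \sum_i h.2 ord0 i *: td F g 0 i.

Variables (V : lmodType F) (rho : T -> V -> V).

Definition weight_space (lam : 'Hom(htilde, F^o)) : set V :=
  [set v | forall h, rho (htilde_emb h) v = lam h *: v].

Definition highest_space : set V :=
  [set v | forall x, twisted_plus x -> rho x v = 0].

Definition level_zero_highest_weight : Prop :=
  (exists v : V,
    [/\ v != 0, exists lam, weight_space lam v,
        U_orbit twisted rho v = setT,
        highest_space v &
        irreducible twisted_zero rho (U_orbit twisted_zero rho v)])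
  /\ forall i v, rho (tK F g 0 i) v = 0.

End TwistedToroidal.

(* Main.v *)
(** Structure of [L = g_0bar], simple with Cartan subalgebra [h0].  If the
    Killing form of [L] vanished then, for every [x], the derivation whose
    eigenvalues are the complex conjugates of those of [ad x] would show that
    [ad x] is nilpotent, and Engel's theorem for [h0] would make [L] nilpotent.
    So the form is non-degenerate, derivations are inner, the Jordan components
    of elements of [h0] lie in [h0], and the nilpotent ones vanish.  Hence [h0]
    is abelian and diagonalizable, and it is spanned by the brackets of opposite
    root vectors.

    A root pair.  Since [h0] does not kill [V_+], there are a weight vector
    [w0] of [V_+] and opposite root vectors [e], [f] of [L] such that [[e, f]]
    acts on [w0] by a scalar [lam <> 0].  On vectors of [V_+] obtained from [w0]
    by toroidal degree shifts, [e t^k f t^-k] acts as [lam], because the level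
    is zero; so the dimensions of these weight spaces of [V_+] are bounded by
    that of a single weight space of [V].

    Triviality of the centre.  Each [z = t^p K_j] is either injective or locally
    nilpotent on [V].  Injectivity contradicts the bound, by a trace argument
    with [t^-p d_i] and [t^2p K_j].  If all are locally nilpotent, linear
    dependency in a weight space of [V] shows that all long products of such
    [z] kill [w0].  So some non-zero vector is killed by all of them, and such
    vectors form a submodule. *)

From HB Require Import structures.
From mathcomp Require Import all_boot all_order all_algebra.
From mathcomp Require Import spectral ring complex.
From mathcomp Require Import boolp classical_sets reals.
Require Import Defs.

Set Implicit Arguments.
Unset Strict Implicit.
Unset Printing Implicit Defensive.

Import Order.TTheory GRing.Theory Num.Theory.
Import VectorInternalTheory.
Local Open Scope classical_set_scope.
Local Open Scope ring_scope.

(** * Polynomials in an endomorphism *)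

Section HornerMx.
Variable F : fieldType.

(* [horner_mx] is only defined for matrices of positive dimension. *)
Definition hmx n : 'M[F]_n -> {poly F} -> 'M[F]_n :=
  if n is n'.+1 return 'M[F]_n -> {poly F} -> 'M[F]_n
  then fun A p => horner_mx A p else fun _ _ => 0.

Lemma hmxD n (A : 'M[F]_n) p q : hmx A (p + q) = hmx A p + hmx A q.
Proof. by case: n A => [|n] A /=; rewrite ?addr0 ?rmorphD. Qed.

Lemma hmxM n (A : 'M[F]_n) p q : hmx A (p * q) = hmx A p *m hmx A q.
Proof. by case: n A => [|n] A /=; rewrite ?mul0mx ?rmorphM. Qed.

Lemma hmxC n (A : 'M[F]_n) a : hmx A a%:P = a%:M.
Proof. by case: n A => [|n] A /=; rewrite ?[RHS]thinmx0 ?horner_mx_C. Qed.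

Lemma hmxX n (A : 'M[F]_n) : hmx A 'X = A.
Proof. by case: n A => [|n] A /=; rewrite ?[RHS]thinmx0 ?horner_mx_X. Qed.

Lemma hmx_char_poly n (A : 'M[F]_n) : hmx A (char_poly A) = 0.
Proof. by case: n A => [|n] A //=; apply: Cayley_Hamilton. Qed.

Lemma hmx_intertwine n (P A B : 'M[F]_n) p :
  P *m A = B *m P -> P *m hmx A p = hmx B p *m P.
Proof.
move=> PAB; elim/poly_ind: p => [|p c IH].
  by rewrite -[0]polyC0 !hmxC -scalemx1 -scalemxAl -scalemxAr mulmx1 mul1mx.
rewrite !hmxD !hmxM !hmxX !hmxC mulmxDr mulmxDl; congr (_ + _).
  by rewrite mulmxA IH -mulmxA PAB mulmxA.
by rewrite mul_mx_scalar mul_scalar_mx.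
Qed.

Lemma trig_mulmx n (A B : 'M[F]_n) : is_trig_mx A -> is_trig_mx B ->
  is_trig_mx (A *m B) /\ forall i, (A *m B) i i = A i i * B i i.
Proof.
move=> /is_trig_mxP At /is_trig_mxP Bt; split=> [|i].
  apply/is_trig_mxP => i j ij; rewrite mxE big1 // => k _.
  have [ik|ki] := ltnP i k; first by rewrite At ?mul0r.
  by rewrite Bt ?mulr0 // (leq_ltn_trans ki).
rewrite mxE (bigD1 i) //= big1 ?addr0 // => k ki.
have := ki; rewrite neq_ltn => /orP[lt|lt]; first by rewrite Bt ?mulr0.
by rewrite At ?mul0r.
Qed.

Lemma hmx_trig n (A : 'M[F]_n) p : is_trig_mx A ->
  is_trig_mx (hmx A p) /\ forall i, (hmx A p) i i = p.[A i i].
Proof.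
move=> At; elim/poly_ind: p => [|p c [IHt IHd]].
  rewrite -[0]polyC0 hmxC; split=> [|i]; first exact: scalar_mx_is_trig.
  by rewrite !mxE eqxx hornerC.
have [Mt Md] := trig_mulmx IHt At.
rewrite hmxD hmxM hmxX hmxC; split=> [|i].
  apply/is_trig_mxP => i j ij; rewrite mxE (is_trig_mxP Mt _ _ ij) add0r.
  exact: (is_trig_mxP (scalar_mx_is_trig _ _)).
by rewrite mxE Md IHd !mxE eqxx !hornerE.
Qed.

End HornerMx.

(** * The functional calculus p(f) of an endomorphism f *)

Section PolyAct.
Variables (F : fieldType) (L : vectType F).
Implicit Types (f g : 'End(L)) (p q : {poly F}) (x y : L).

Lemma lfun_f2mx f x : f x = r2v (v2r x *m f2mx f).
Proof. by rewrite unlock. Qed.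

Lemma f2mx_inj : injective (@f2mx F L L).
Proof. by move=> [A] [B] /= ->. Qed.

Lemma f2mxP f (A : 'M_(dim L)) :
  (forall x, f x = r2v (v2r x *m A)) -> f2mx f = A.
Proof.
move=> fA; suff -> : f = Hom A by [].
by apply/lfunP => x; rewrite fA lfun_f2mx.
Qed.

Lemma f2mx_comp f g : f2mx (f \o g)%VF = f2mx g *m f2mx f.
Proof.
by apply: f2mxP => x; rewrite comp_lfunE lfun_f2mx (lfun_f2mx g) r2vK mulmxA.
Qed.

Lemma f2mxD f g : f2mx (f + g) = f2mx f + f2mx g.
Proof.
by apply: f2mxP => x; rewrite add_lfunE !lfun_f2mx mulmxDr linearD.
Qed.

Lemma f2mxZ a f : f2mx (a *: f) = a *: f2mx f.
Proof.
by apply: f2mxP => x; rewrite scale_lfunE !lfun_f2mx -scalemxAr linearZ.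
Qed.

Lemma f2mx_scalar a : f2mx (a *: \1 : 'End(L))%VF = a%:M.
Proof.
apply: f2mxP => x; rewrite scale_lfunE id_lfunE mul_mx_scalar.
by rewrite linearZ /= v2rK.
Qed.

(** This is p(f). It passes through the matrix of [f], so that triangularization and the
    Cayley-Hamilton theorem apply to it. *)
Definition pact f p : 'End(L) := Hom (hmx (f2mx f) p).

Lemma pactD f p q x : pact f (p + q) x = pact f p x + pact f q x.
Proof.
rewrite -add_lfunE; congr (fun_of_lfun _ x).
by apply: f2mx_inj; rewrite f2mxD /= hmxD.
Qed.

Lemma pactM f p q x : pact f (p * q) x = pact f p (pact f q x).
Proof.
rewrite -comp_lfunE; congr (fun_of_lfun _ x).
by apply: f2mx_inj; rewrite f2mx_comp /= mulrC hmxM.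
Qed.

Lemma pactC f a x : pact f a%:P x = a *: x.
Proof.
rewrite -[X in a *: X]id_lfunE -scale_lfunE; congr (fun_of_lfun _ x).
by apply: f2mx_inj; rewrite f2mx_scalar /= hmxC.
Qed.

Lemma pactX f x : pact f 'X x = f x.
Proof. by congr (fun_of_lfun _ x); apply: f2mx_inj; rewrite /= hmxX. Qed.

Lemma pactB f p q x : pact f (p - q) x = pact f p x - pact f q x.
Proof. by rewrite -mulN1r pactD -polyCN pactM pactC scaleN1r. Qed.

Lemma pactXsubC f a x : pact f ('X - a%:P) x = f x - a *: x.
Proof. by rewrite pactB pactX pactC. Qed.

Lemma pact1 f x : pact f 1 x = x.
Proof. by rewrite pactC scale1r. Qed.

Lemma pact0 f x : pact f 0 x = 0.
Proof. by rewrite pactC scale0r. Qed.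

Lemma pact_swap f p q x : pact f p (pact f q x) = pact f q (pact f p x).
Proof. by rewrite -!pactM mulrC. Qed.

Lemma pact_dvd f p q x : p %| q -> pact f p x = 0 -> pact f q x = 0.
Proof. by move=> /dvdpP[r ->]; rewrite pactM => ->; rewrite linear0. Qed.

Lemma pact_comm f g p x : (forall y, g (f y) = f (g y)) ->
  g (pact f p x) = pact f p (g x).
Proof.
move=> gf; elim/poly_ind: p x => [|p c IH] x; first by rewrite !pact0 linear0.
by rewrite !pactD !pactM !pactX !pactC linearD linearZ /= IH gf.
Qed.

Lemma pact_stable f p (P : set L) x : is_subspace P ->
  (forall y, P y -> P (f y)) -> P x -> P (pact f p x).
Proof.
move=> [P0 PD] Pf; elim/poly_ind: p x => [|p c IH] x Px; first by rewrite pact0.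
rewrite pactD pactM pactX pactC addrC; apply: PD => //; exact/IH/Pf.
Qed.

Lemma pact_coprime f p q x : coprimep p q ->
  pact f p x = 0 -> pact f q x = 0 -> x = 0.
Proof.
move=> /Bezout_eq1_coprimepP[[u v] /= uv] px qx.
by rewrite -[x](pact1 f) -uv pactD !pactM px qx !linear0 addr0.
Qed.

Lemma coprimep_prod_XsubC (s : seq F) M N a : a \notin s ->
  coprimep (('X - a%:P) ^+ M) (\prod_(b <- s) ('X - b%:P) ^+ N).
Proof.
elim: s => [|b s IH]; first by rewrite big_nil coprimep1.
rewrite inE negb_or big_cons coprimepMr => /andP[ab as_].
rewrite IH // andbT coprimep_expl // coprimep_expr //.
by rewrite coprimep_XsubC root_XsubC eq_sym.
Qed.

(** A Bezout relation between the first factor and the product of the others splits [x] into a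
    vector killed by the one and a vector killed by the other. Both are polynomials in [f] applied
    to [x], hence stay in the invariant subspace [P]. *)
Lemma primary_decomposition f (s : seq F) N (P : set L) x :
  uniq s -> is_subspace P -> (forall y, P y -> P (f y)) -> P x ->
  pact f (\prod_(a <- s) ('X - a%:P) ^+ N) x = 0 ->
  lspan [set y | P y /\ exists2 a, a \in s & pact f (('X - a%:P) ^+ N) y = 0] x.
Proof.
move=> su Psub Pf; elim: s x su => [|a s IH] x /= su Px.
  by rewrite big_nil pact1 => ->; case: (lspan_subspace [set y | P y /\
    exists2 a, a \in [::] & pact f (('X - a%:P) ^+ N) y = 0]).
have /andP[as_ su'] := su; rewrite big_cons => fx.
set p := ('X - a%:P) ^+ N in fx; set q := \prod_(b <- s) _ in fx.
have /Bezout_eq1_coprimepP[[u v] /= uv] : coprimep p q.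
  exact: coprimep_prod_XsubC.
have [S0 SD] := lspan_subspace [set y | P y /\
    exists2 a0, a0 \in a :: s & pact f (('X - a0%:P) ^+ N) y = 0].
rewrite -[x](pact1 f) -uv pactD -[pact f (u * p) x]scale1r; apply: SD.
  have : lspan [set y | P y /\ exists2 a, a \in s & pact f (('X - a%:P) ^+ N) y = 0]
      (pact f (u * p) x).
    apply: IH => //; first exact: pact_stable.
    by rewrite -pactM mulrCA -/q [q * p]mulrC pactM fx linear0.
  apply: smallest_sub; first exact: lspan_subspace.
  move=> y [Py [b bs fy]]; apply: sub_lspan; split=> //; exists b => //.
  by rewrite inE bs orbT.
apply: sub_lspan; split; first exact: pact_stable.
by exists a; rewrite ?mem_head // -pactM mulrCA pactM fx linear0.
Qed.

(** Chinese remainder theorem for the pairwise coprime (X - a)^N. *)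
Lemma crt_XsubC (s : seq F) N (phi : F -> F) : uniq s ->
  exists p, forall a, a \in s -> ('X - a%:P) ^+ N %| p - (phi a)%:P.
Proof.
elim: s => [|a s IH] /=; first by exists 0.
move=> /andP[as_ su]; have [p pP] := IH su.
set r := ('X - a%:P) ^+ N; set q := \prod_(b <- s) ('X - b%:P) ^+ N.
have /Bezout_eq1_coprimepP[[u v] /= uv] : coprimep r q.
  exact: coprimep_prod_XsubC.
(* By the Bezout relation [v * q] is 1 modulo [r] and 0 modulo the other factors, so the correction
   changes only the residue at [a]. *)
exists (p + ((phi a)%:P - p) * (v * q)) => b; rewrite inE => /predU1P[->|bs].
  rewrite (_ : p + _ - _ = (p - (phi a)%:P) * (1 - v * q)); last by ring.
  by rewrite -uv addrK mulrA dvdp_mull.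
rewrite addrAC dvdp_add ?pP // mulrA dvdp_mull // /q (big_rem b bs) /=.
exact: dvdp_mulr.
Qed.

Definition gen_eigen f a : set L :=
  [set x | exists M, pact f (('X - a%:P) ^+ M) x = 0].

(** Two cases matter: complex conjugation, which makes tr(p(f) f) a sum of squared moduli, and the
    identity, for which p(f) is the semisimple part of f. *)
Definition eigen_op f (phi : F -> F) p : Prop :=
  forall a x, gen_eigen f a x -> pact f p x = phi a *: x.

End PolyAct.

Section Trace.
Variables (F : fieldType) (L : vectType F).

Definition lftr (f : 'End(L)) : F := \tr (f2mx f).

Lemma lftr_comp f g : lftr (f \o g)%VF = lftr (g \o f)%VF.
Proof. by rewrite /lftr !f2mx_comp mxtrace_mulC. Qed.

Lemma lftrD f g : lftr (f + g) = lftr f + lftr g.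
Proof. by rewrite /lftr f2mxD linearD. Qed.

Lemma lftrZ a f : lftr (a *: f) = a * lftr f.
Proof. by rewrite /lftr f2mxZ linearZ. Qed.

Lemma lftrN f : lftr (- f) = - lftr f.
Proof. by rewrite -scaleN1r lftrZ mulN1r. Qed.

Lemma lftr0 : lftr 0 = 0.
Proof. by rewrite -[0](scale0r 0) lftrZ mul0r. Qed.

End Trace.

(** * Eigenvalues with multiplicity, and interpolation on generalized eigenspaces *)

Section Spectrum.
Variables (F : numClosedFieldType) (L : vectType F).
Implicit Types (f : 'End(L)) (p : {poly F}) (x : L).

(** [ts] is the diagonal of a triangular matrix similar to that of [f]; the second claim is then the
    Cayley-Hamilton theorem. *)
Lemma spectrum f : exists ts : seq F,
  [/\ forall p, lftr (pact f p) = \sum_(t <- ts) p.[t],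
      forall x, pact f (\prod_(t <- ts) ('X - t%:P)) x = 0 &
      forall t, t \in ts -> exists2 x, x != 0 & f x = t *: x].
Proof.
set A := f2mx f.
have [|P Pu] := @cotrigonalization _ _ [:: A].
  by move=> B C; rewrite !inE => /eqP -> /eqP ->.
have {}Pu := unitarymx_unit Pu.
rewrite /= andbT /similar_to /= conjumx // => Tt.
set T := P *m A *m invmx P in Tt.
have PA : P *m A = T *m P by rewrite mulmxKV.
have hA p : hmx A p = invmx P *m hmx T p *m P.
  by rewrite -mulmxA -(hmx_intertwine p PA) mulKmx.
exists [seq T i i | i <- enum 'I_(dim L)]; split=> [p|x|t].
- rewrite /lftr /= -/A hA -mulmxA mxtrace_mulC mulmxK // /mxtrace.
  rewrite big_map big_enum /=; apply: eq_bigr => i _.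
  by case: (hmx_trig p Tt).
- rewrite (_ : \prod_(t <- _) _ = char_poly T); last first.
    by rewrite big_map big_enum /= char_poly_trig.
  rewrite lfun_f2mx /= -/A hA hmx_char_poly mulmx0 mul0mx mulmx0.
  by rewrite linear0.
move=> /mapP[i _ ->]; have : root (char_poly T) (T i i).
  rewrite char_poly_trig // rootE horner_prod (bigD1 i) //=.
  by rewrite !hornerE subrr mul0r.
rewrite -eigenvalue_root_char => /eigenvalueP[v vT v0].
exists (r2v (v *m P)).
  apply: contra_neq v0 => vP0; rewrite -[v](mulmxK Pu) -[v *m P]r2vK vP0.
  by rewrite linear0 mul0mx.
rewrite lfun_f2mx r2vK -/A -mulmxA PA mulmxA vT -scalemxAl.
by rewrite linearZ.
Qed.

Lemma dvdp_prod_XsubC (ts s : seq F) : {subset ts <= s} ->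
  \prod_(t <- ts) ('X - t%:P) %| \prod_(a <- s) ('X - a%:P) ^+ size ts.
Proof.
rewrite prodrXl; elim: ts => [|t ts IH] tss; first by rewrite big_nil dvd1p.
rewrite big_cons exprS dvdp_mul ?IH // => [|a ats].
  by rewrite (big_rem t) ?tss ?mem_head //= dvdp_mulr.
by rewrite tss // inE ats orbT.
Qed.

Lemma gen_eigen_span f (P : set L) x : is_subspace P ->
  (forall y, P y -> P (f y)) -> P x ->
  lspan [set y | P y /\ exists a, gen_eigen f a y] x.
Proof.
move=> Psub Pf Px; have [ts [_ tsf _]] := spectrum f.
have : pact f (\prod_(a <- undup ts) ('X - a%:P) ^+ size ts) x = 0.
  by apply: pact_dvd (tsf x); apply: dvdp_prod_XsubC => t; rewrite mem_undup.
move=> /(primary_decomposition (undup_uniq ts) Psub Pf Px).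
apply: smallest_sub; first exact: lspan_subspace.
move=> y [Py [a _ fy]]; apply: sub_lspan; split=> //; exists a.
by exists (size ts).
Qed.

(** The polynomial is chosen congruent to phi(a) modulo (X - a)^N for every eigenvalue a, with N the
    number of eigenvalues counted with multiplicity. *)
Lemma eigen_op_exists f phi : exists p, eigen_op f phi p.
Proof.
have [ts [_ tsf _]] := spectrum f.
set s := undup ts; set N := size ts.
have sf x : pact f (\prod_(a <- s) ('X - a%:P) ^+ N) x = 0.
  by apply: pact_dvd (tsf x); apply: dvdp_prod_XsubC => t; rewrite mem_undup.
have [p pP] := crt_XsubC N phi (undup_uniq ts).
exists p => a x [M fx].
have [sa|sa] := boolP (a \in s); last first.
  (* Off the spectrum the generalized eigenspace is zero: a power of X - a is coprime to a
     polynomial that annihilates [f]. *)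
  suff -> : x = 0 by rewrite linear0 scaler0.
  exact: pact_coprime (coprimep_prod_XsubC M N sa) fx (sf x).
(* The exponent [M] is arbitrary, but the factors at the other eigenvalues are coprime to X - a, so
   the exponent [N] suffices. *)
suff fNx : pact f (('X - a%:P) ^+ N) x = 0.
  by rewrite -[p](subrK (phi a)%:P) pactD pactC (pact_dvd (pP a sa) fNx) add0r.
have sa' : a \notin rem a s by rewrite mem_rem_uniq ?undup_uniq // !inE eqxx.
apply: (@pact_coprime _ _ f _ _ _ (coprimep_prod_XsubC M N sa')).
  by rewrite pact_swap fx linear0.
by rewrite -pactM mulrC; have := sf x; rewrite (big_rem a) //= .
Qed.

(** When [phi] is complex conjugation the sum is that of the |t|^2. A vanishing trace then makes all
    eigenvalues 0, and the second claim makes [f] nilpotent. *)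
Lemma eigen_op_trace f : exists ts : seq F,
  (forall phi p, eigen_op f phi p ->
     lftr (pact f (p * 'X)) = \sum_(t <- ts) phi t * t) /\
  ((forall t, t \in ts -> t = 0) -> exists M, forall x, pact f ('X^M) x = 0).
Proof.
have [ts [trf tsf tse]] := spectrum f.
exists ts; split=> [phi p pP|ts0].
  rewrite trf; apply: eq_big_seq => t /tse[x x0 fx].
  rewrite hornerMX; congr (_ * _).
  have fxt : pact f ('X - t%:P) x = 0 by rewrite pactXsubC fx subrr.
  have /pP : gen_eigen f t x by exists 1%N.
  have /factor_theorem[q pq] : root (p - p.[t]%:P) t.
    by rewrite rootE !hornerE subrr.
  have -> : pact f p x = p.[t] *: x.
    by rewrite -[in LHS](subrK p.[t]%:P p) pactD pactC pq pactM fxt linear0 add0r.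
  move=> /eqP; rewrite -subr_eq0 -scalerBl scaler_eq0 (negPf x0) orbF.
  by rewrite subr_eq0 => /eqP ->.
exists (size ts) => x; rewrite -(tsf x); congr (pact f _ x).
rewrite (eq_big_seq (fun=> 'X)) ?big_const_seq ?count_predT ?iter_mulr_1 //.
by move=> t /ts0 ->; rewrite subr0.
Qed.

End Spectrum.

(** * Lie algebras *)

Section Span.
Variables (F : fieldType) (V : lmodType F).
Implicit Types (S W : set V).

Lemma subspaceD W u v : is_subspace W -> W u -> W v -> W (u + v).
Proof. by move=> [_ WD] Wu Wv; rewrite -[u]scale1r; apply: WD. Qed.

Lemma subspaceZ W a v : is_subspace W -> W v -> W (a *: v).
Proof. by move=> [W0 WD] Wv; rewrite -[_ *: _]addr0; apply: WD. Qed.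

Lemma subspaceB W u v : is_subspace W -> W u -> W v -> W (u - v).
Proof.
by move=> Ws Wu Wv; apply: subspaceD => //; rewrite -scaleN1r; apply: subspaceZ.
Qed.

Lemma lspan_ind S W v : is_subspace W -> S `<=` W -> lspan S v -> W v.
Proof. by move=> Ws SW; apply: lspan_min. Qed.

Lemma subspaceT : is_subspace (@setT V). Proof. by []. Qed.

Lemma subspace_ker (W : lmodType F) (f : V -> W) : linear f ->
  is_subspace [set v | f v = 0].
Proof.
move=> fl; have f0 : f 0 = 0 by have := fl (-1) 0 0; rewrite !scaleN1r !addNr.
by split=> //= a u v fu fv; rewrite fl fu fv scaler0 addr0.
Qed.

Lemma lspanU S1 S2 v : lspan (S1 `|` S2) v ->
  exists u w, [/\ v = u + w, lspan S1 u & lspan S2 w].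
Proof.
have [S10 S1D] := lspan_subspace S1; have [S20 S2D] := lspan_subspace S2.
apply: (@lspan_ind _ [set x | exists u w,
    [/\ x = u + w, lspan S1 u & lspan S2 w]]); first split.
- by exists 0, 0; rewrite addr0.
- move=> a _ _ [u1 [w1 [-> Su1 Sw1]]] [u2 [w2 [-> Su2 Sw2]]].
  exists (a *: u1 + u2), (a *: w1 + w2).
  by split; [rewrite scalerDr addrACA|apply: S1D|apply: S2D].
- move=> x [Sx|Sx].
    by exists x, 0; rewrite addr0; split=> //; apply: sub_lspan.
  by exists 0, x; rewrite add0r; split=> //; apply: sub_lspan.
Qed.

End Span.

Section VectSpan.
Variables (F : fieldType) (L : vectType F).

Lemma linfun_linear (M : vectType F) (f : L -> M) : linear f -> linfun f =1 f.
Proof.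
move=> fl; pose fL := GRing.isLinear.Build F L M _ f fl.
by pose f' : {linear L -> M} := HB.pack f fL; move=> x; rewrite (lfunE f').
Qed.

Lemma dimv_add_line (U : {vspace L}) x : x \notin U ->
  \dim (U + <[x]>) = (\dim U).+1.
Proof.
move=> xU; rewrite dimv_disjoint_sum; last first.
  apply/eqP; rewrite -subv0; apply/subvP => y /memv_capP[yU /vlineP[a ya]].
  rewrite memv0; apply: contraNT xU => y0.
  have a0 : a != 0 by apply: contraNneq y0 => a0; rewrite ya a0 scale0r.
  by rewrite -[x](scalerK a0) -ya memvZ.
by rewrite dim_vline (_ : x != 0) ?addn1 //; apply: contraNneq xU => ->; rewrite mem0v.
Qed.

(** Among the vector spaces inside [W], one of maximal dimension exhausts [W], since otherwise a
    line could be added. *)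
Lemma subspace_vspace (W : set L) : is_subspace W ->
  exists U : {vspace L}, forall x, (x \in U) <-> W x.
Proof.
move=> Ws; pose ok n := `[< exists U : {vspace L},
  (forall x, x \in U -> W x) /\ \dim U = n >].
have ok0 : exists n, ok n.
  exists 0%N; apply/asboolP; exists 0%VS; rewrite dimv0; split=> // x.
  by rewrite memv0 => /eqP ->; case: Ws.
have okle n : ok n -> (n <= dim L)%N.
  by move=> /asboolP[U [_ <-]]; rewrite -dimvf dimvS ?subvf.
have [n /asboolP[U [UW Un]] nmax] := ex_maxnP ok0 okle.
exists U => x; split=> [|Wx]; first exact: UW.
apply: contrapT => /negP xU; suff /nmax : ok n.+1 by rewrite ltnn.
apply/asboolP; exists (U + <[x]>)%VS; split.
  move=> _ /memv_addP[u Uu [_ /vlineP[a ->] ->]].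
  by apply: subspaceD => //; [exact: UW|exact: subspaceZ].
by rewrite -Un dimv_add_line //; apply/negP.
Qed.

End VectSpan.

Section Lie.
Variables (F : fieldType) (L : vectType F) (br : L -> L -> L).
Hypothesis br_lie : lie_bracket br.
Implicit Types (x y z : L) (f D : 'End(L)).

Lemma lie0l x : br 0 x = 0.
Proof. by have := lie_linl br_lie x (-1) 0 0; rewrite !scaleN1r !addNr. Qed.

Lemma lie0r x : br x 0 = 0.
Proof. by have := lie_linr br_lie x (-1) 0 0; rewrite !scaleN1r !addNr. Qed.

Lemma lieDl x y z : br (x + y) z = br x z + br y z.
Proof. by have := lie_linl br_lie z 1 x y; rewrite !scale1r. Qed.

Lemma lieDr x y z : br x (y + z) = br x y + br x z.
Proof. by have := lie_linr br_lie x 1 y z; rewrite !scale1r. Qed.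

Lemma lieZl a x y : br (a *: x) y = a *: br x y.
Proof. by have := lie_linl br_lie y a x 0; rewrite lie0l !addr0. Qed.

Lemma lieZr a x y : br x (a *: y) = a *: br x y.
Proof. by have := lie_linr br_lie x a y 0; rewrite lie0r !addr0. Qed.

Lemma lieNl x y : br (- x) y = - br x y.
Proof. by rewrite -scaleN1r lieZl scaleN1r. Qed.

Lemma lieNr x y : br x (- y) = - br x y.
Proof. by rewrite -scaleN1r lieZr scaleN1r. Qed.

Lemma lieC x y : br x y = - br y x.
Proof.
have := lie_alt br_lie (x + y); rewrite lieDl !lieDr !(lie_alt br_lie).
by rewrite add0r addr0 => /eqP; rewrite addr_eq0 => /eqP.
Qed.

Lemma lie_leibniz x y z : br x (br y z) = br (br x y) z + br y (br x z).
Proof.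
have := lie_jacobi br_lie x y z; rewrite [br z (br x y)]lieC [br z x]lieC lieNr.
by move/eqP; rewrite -addrA -opprD subr_eq0 addrC => /eqP.
Qed.

Definition ad x : 'End(L) := linfun (br x).

Lemma adE x y : ad x y = br x y.
Proof. exact/linfun_linear/(lie_linr br_lie). Qed.

Definition derivation D := forall x y, D (br x y) = br (D x) y + br x (D y).

Lemma ad_derivation x : derivation (ad x).
Proof. by move=> y z; rewrite !adE lie_leibniz. Qed.

(** By the Leibniz rule D - a - b maps [x,y] to [(D - a)x,y] + [x,(D - b)y]. So exponents i for x
    and j for y give i + j for the bracket, by induction on i + j. *)
Lemma gen_eigen_br D a b x y : derivation D ->
  gen_eigen D a x -> gen_eigen D b y -> gen_eigen D (a + b) (br x y).
Proof.
move=> Dd [i xi] [j yj]; exists (i + j)%N; move: xi yj.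
have [k] := ubnP (i + j); elim: k i j x y => // k IH i j x y.
case: i => [|i]; first by rewrite pact1 => _ -> _; rewrite lie0l linear0.
case: j => [|j]; first by rewrite pact1 => _ _ ->; rewrite lie0r linear0.
rewrite addSn addnS ltnS => ijk xi yj.
rewrite exprSr pactM pactXsubC Dd polyCD.
have -> : br (D x) y + br x (D y) - (a + b) *: br x y =
    br (D x - a *: x) y + br x (D y - b *: y).
  by rewrite lieDl lieDr !lieNl !lieNr lieZl lieZr scalerDl opprD addrACA.
rewrite linearD /= -polyCD.
have xi' : pact D (('X - a%:P) ^+ i) (D x - a *: x) = 0.
  by rewrite -pactXsubC -pactM -exprSr.
have yj' : pact D (('X - b%:P) ^+ j) (D y - b *: y) = 0.
  by rewrite -pactXsubC -pactM -exprSr.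
rewrite -{1}addnS IH ?addnS // add0r.
by rewrite -addSn IH ?addSn.
Qed.

End Lie.

(** * Engel's theorem relative to a subspace *)

Section Engel.
Variables (F : fieldType) (L : vectType F) (br : L -> L -> L).
Hypothesis br_lie : lie_bracket br.
Variable H : {vspace L}.
Hypotheses (H_sub : lie_subalg br H) (H_nil : lie_nilpotent br H).

Lemma foldr_subalg s y : {subset s <= H} -> y \in H -> foldr br y s \in H.
Proof.
move=> sH yH; elim: s sH => [|x s IH] sH //=; apply: H_sub.
  by apply: sH; rewrite mem_head.
by apply: IH => z zs; apply: sH; rewrite inE zs orbT.
Qed.

(** Fix y in H outside K and take the least k such that all k-fold brackets of elements of H with y
    lie in K; nilpotency provides one. Some (k - 1)-fold bracket lies outside K and serves as
    [e]. *)
Lemma nilpotent_next (K : {vspace L}) : (K <= H)%VS -> K != H ->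
  exists e, [/\ e \in H, e \notin K & {in H, forall h, br h e \in K}].
Proof.
move=> KH KneH; have [y yH yK] : exists2 y, y \in H & y \notin K.
  apply: contrapT => no; case/negP: KneH; rewrite eqEsubv KH.
  by apply/subvP => y yH; apply: contrapT => /negP yK; apply: no; exists y.
have [N HN] := H_nil.
pose ok k := `[< forall s, size s = k -> {subset s <= H} -> foldr br y s \in K >].
have exk : exists k, ok k.
  by exists N; apply/asboolP => s sN sH; rewrite HN ?mem0v.
have [[|k] /asboolP okk kmin] := ex_minnP exk.
  by have := okk [::] erefl; rewrite /= (negPf yK) => /(_ (fun=> ltac:(by []))).
have : ~~ ok k by apply: contraFN (ltnn k) => /kmin.
move=> /asboolPn/existsNP[s /not_implyP[sk /not_implyP[sH sK]]].
exists (foldr br y s); split; [exact: foldr_subalg|exact/negP|move=> h hH].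
apply: (okk (h :: s)); first by rewrite /= sk.
by move=> z; rewrite inE => /predU1P[->|/sH].
Qed.

(** A vector of C outside P that is sent into P is built for an ascending chain of ideals K of H,
    one dimension at a time. *)
Lemma engel (C P : set L) : is_subspace C -> is_subspace P ->
  (forall h x, h \in H -> C x -> C (br h x)) ->
  (forall h x, h \in H -> P x -> P (br h x)) ->
  (forall h x, h \in H -> C x -> exists M, P (iter M (br h) x)) ->
  (exists2 x, C x & ~ P x) ->
  exists x, [/\ C x, ~ P x & {in H, forall h, P (br h x)}].
Proof.
move=> Cs Ps CH PH CP [x0 Cx0 Px0].
suff /(_ (\dim H) (leqnn _))[K [KH _ dK [x [Cx Px Kx]]]] :
    forall k, (k <= \dim H)%N -> exists K : {vspace L},
    [/\ (K <= H)%VS, {in H & K, forall h a, br h a \in K}, \dim K = k &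
      exists x, [/\ C x, ~ P x & {in K, forall h, P (br h x)}]].
  exists x; split=> // h; suff -> : H = K by apply: Kx.
  by apply/eqP; rewrite eq_sym eqEdim KH dK leqnn.
elim=> [_|k IH kH].
  exists 0%VS; rewrite sub0v dimv0; split=> //.
    by move=> h a _; rewrite memv0 => /eqP ->; rewrite lie0r ?mem0v.
  exists x0; split=> // h; rewrite memv0 => /eqP ->.
  by rewrite lie0l //; case: Ps.
have [K [KH Kid dK [x [Cx Px Kx]]]] := IH (ltnW kH).
have KneH : K != H by apply: contraTneq kH => <-; rewrite dK ltnn.
have [e [eH eK He]] := nilpotent_next KH KneH.
(* The vectors of C that K sends into P are stable under [e], because [e,K] lies in K. The last
   iterate of [e] on [x] outside P then serves for K and [e] together. *)
pose X y := [/\ C y & {in K, forall a, P (br a y)}].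
have Xe y : X y -> X (br e y).
  move=> [Cy Ky]; split; first exact: CH.
  move=> a aK; rewrite (lie_leibniz br_lie); apply: subspaceD => //.
    by apply: Ky; rewrite lieC // memvN Kid.
  by apply: PH => //; apply: Ky.
have Xiter M : X (iter M (br e) x) by elim: M => //= M; apply: Xe.
have [M0 PM0] := CP e x eH Cx.
have exM : exists M, `[< P (iter M (br e) x) >] by exists M0; apply/asboolP.
have [[|M] /asboolP PM Mmin] := ex_minnP exM; first by [].
have PM' : ~ P (iter M (br e) x).
  by move=> /asboolP/Mmin; rewrite ltnn.
exists (K + <[e]>)%VS; split.
- by rewrite subv_add KH -memvE.
- move=> h _ hH /memv_addP[a aK [_ /vlineP[c ->] ->]].
  apply: (subvP (addvSl K <[e]>%VS)).
  rewrite lieDr // lieZr //.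
  by apply: memvD; [apply: Kid|apply/memvZ/He].
- by rewrite dimv_add_line // dK.
exists (iter M (br e) x); have [CM KM] := Xiter M; split=> //.
move=> _ /memv_addP[a aK [_ /vlineP[c ->] ->]].
rewrite lieDl // lieZl //; apply: subspaceD => //; first exact: KM.
exact: subspaceZ.
Qed.

End Engel.

(** * Nilpotency and traces *)

Section TraceNil.
Variables (F : numClosedFieldType) (L : vectType F).
Implicit Types f g : 'End(L).

Definition loc_nil f := forall x, exists M, iter M f x = 0.

Lemma pact_iter f M x : pact f 'X^M x = iter M f x.
Proof.
by elim: M x => [|M IH] x; rewrite ?pact1 // exprS pactM pactX IH.
Qed.

Lemma iter0 f M : iter M f 0 = 0.
Proof. by rewrite -pact_iter linear0. Qed.

Lemma iter_ge f x M N : (M <= N)%N -> iter M f x = 0 -> iter N f x = 0.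
Proof. by move=> MN fx; rewrite -(subnK MN) iterD fx iter0. Qed.

Lemma subspace_loc_nil f : is_subspace [set x | exists M, iter M f x = 0].
Proof.
split=> [|a x y [M fx] [N fy]]; first by exists 0%N.
exists (maxn M N); rewrite -pact_iter linearP /= !pact_iter.
by rewrite (iter_ge (leq_maxl _ _) fx) (iter_ge (leq_maxr _ _) fy) scaler0 addr0.
Qed.

Lemma lftr_loc_nil f : loc_nil f -> lftr f = 0.
Proof.
move=> fN; have [ts [trf _ tse]] := spectrum f.
have -> : f = pact f 'X by apply/lfunP => x; rewrite pactX.
rewrite trf big1_seq // => t /tse[x x0 fx].
have [M] := fN x; have -> : iter M f x = t ^+ M *: x.
  by elim: M => [|M IH]; rewrite ?scale1r //= IH linearZ /= fx scalerA exprSr.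
by move/eqP; rewrite scaler_eq0 (negPf x0) orbF expf_eq0 hornerX => /andP[_ /eqP].
Qed.

Lemma loc_nil_comp f g : (forall x, f (g x) = g (f x)) -> loc_nil f ->
  loc_nil (f \o g)%VF.
Proof.
move=> fg fN x; have [M fx] := fN x; exists M.
suff -> : iter M (f \o g)%VF x = iter M g (iter M f x).
  by rewrite fx iter0.
have fgi k y : f (iter k g y) = iter k g (f y).
  by elim: k => //= k IH; rewrite fg IH.
by elim: M {fx} => //= M IH; rewrite IH comp_lfunE -fgi fg.
Qed.

(** The trace is the sum of the non-negative |t|^2 over the eigenvalues t, so all of them vanish. *)
Lemma eigen_op_trace0 f p : eigen_op f Num.conj p ->
  lftr (pact f p \o f)%VF = 0 -> loc_nil f.
Proof.
move=> pP; have [ts [/(_ _ _ pP) trp tsN]] := eigen_op_trace f.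
have -> : (pact f p \o f)%VF = pact f (p * 'X).
  by apply/lfunP => x; rewrite comp_lfunE pactM pactX.
rewrite trp => sum0 x; have [|M fM] := tsN; last first.
  by exists M; rewrite -pact_iter.
move=> t tts; move/eqP: sum0; rewrite psumr_eq0 => [|s _]; last first.
  by rewrite mulrC mul_conjC_ge0.
by move=> /seq.allP/(_ t tts); rewrite mulrC mul_conjC_eq0 => /eqP.
Qed.

End TraceNil.

(** * Cartan subalgebras of simple Lie algebras *)

Section Simple.
Variables (F : numClosedFieldType) (L : vectType F) (br : L -> L -> L).
Hypotheses (br_lie : lie_bracket br) (L_simple : lie_simple br fullv).
Variable H : {vspace L}.
Hypothesis H_cartan : cartan br fullv H.
Local Notation ad := (ad br).
Implicit Types (x y z h : L) (D f g : 'End(L)) (p : {poly F}).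

Let adE := adE br_lie.

(** The bracket of generalized eigenvectors for a and b is one for a + b, where p(D) acts as phi(a)
    + phi(b); this is the Leibniz rule on such vectors, and they span. *)
Lemma eigen_op_derivation D phi p : derivation br D ->
  (forall a b, phi (a + b) = phi a + phi b) ->
  eigen_op D phi p -> derivation br (pact D p).
Proof.
move=> Dd phiD; rewrite /eigen_op; move: (pact D p) => E pP x y.
have subl y' : is_subspace [set x | E (br x y') = br (E x) y' + br x (E y')].
  split=> [|a u v Eu Ev] /=; first by rewrite linear0 !(lie0l br_lie) linear0 addr0.
  rewrite linearP /= !(lieDl br_lie) !(lieZl br_lie) linearP /= Eu Ev scalerDr.
  by rewrite addrACA.
have subr x' : is_subspace [set y | E (br x' y) = br (E x') y + br x' (E y)].
  split=> [|a u v Eu Ev] /=; first by rewrite linear0 !(lie0r br_lie) linear0 addr0.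
  rewrite linearP /= !(lieDr br_lie) !(lieZr br_lie) linearP /= Eu Ev scalerDr.
  by rewrite addrACA.
have span z := gen_eigen_span (f := D) (x := z) (subspaceT L) (fun _ => id) I.
apply: lspan_ind (subl y) _ (span x) => u [_ [a ua]] /=.
apply: lspan_ind (subr u) _ (span y) => v [_ [b vb]] /=.
rewrite (pP _ _ (gen_eigen_br br_lie Dd ua vb)) (pP _ _ ua) (pP _ _ vb).
by rewrite phiD scalerDl (lieZl br_lie) (lieZr br_lie).
Qed.

Lemma simple_ideal (I : set L) : is_subspace I ->
  (forall x y, I y -> I (br x y)) -> (exists2 x, I x & x != 0) -> forall x, I x.
Proof.
move=> Is Iid [x0 Ix0 x0n0]; have [U UI] := subspace_vspace Is.
have [_ _ /(_ U (subvf U))] := L_simple; case.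
- by move=> x y _ /UI Iy; apply/UI/Iid.
- by move=> U0; move/UI: Ix0; rewrite U0 memv0 (negPf x0n0).
- by move=> UT x; apply/UI; rewrite UT memvf.
Qed.

Lemma simple_not_abelian : exists x y, br x y != 0.
Proof. by have [_ [x [y [_ _ xy]]] _] := L_simple; exists x, y. Qed.

Lemma simple_derived x : lspan [set z | exists a b, z = br a b] x.
Proof.
apply: simple_ideal; first exact: lspan_subspace.
  by move=> a b _; apply: sub_lspan; exists a, b.
have [a [b ab]] := simple_not_abelian.
by exists (br a b) => //; apply: sub_lspan; exists a, b.
Qed.

(** As L is its own derived algebra, the brackets of any given length span L. *)
Lemma simple_not_nilpotent : ~ lie_nilpotent br fullv.
Proof.
move=> [N HN]; have [a [b]] := simple_not_abelian.
suff words k x : lspan [set z | exists s y, size s = k /\ z = foldr br y s] x.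
  suff -> : b = 0 by rewrite (lie0r br_lie) eqxx.
  have := words N b; apply: (@lspan_ind _ _ _ [set z | z = 0]).
    by split=> //= c u v -> ->; rewrite scaler0 addr0.
  by move=> _ [s [y [sN ->]]] /=; rewrite HN // ?memvf // => z; rewrite memvf.
elim: k x => [|k IH] x; first by apply: sub_lspan; exists [::], x.
set W := lspan _; have [W0 WD] : is_subspace W by apply: lspan_subspace.
have := simple_derived x; apply: (@lspan_ind _ _ _ W) => //.
move=> _ [u [v ->]]; have := IH v.
apply: (@lspan_ind _ _ _ [set v | W (br u v)]).
  split=> [|c v1 v2 Wv1 Wv2] /=; first by rewrite lie0r.
  by rewrite (lieDr br_lie) (lieZr br_lie); apply: WD.
move=> _ [s [y [sk ->]]]; apply: sub_lspan; exists (u :: s), y.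
by rewrite /= sk.
Qed.

(** * The Killing form and its non-degeneracy *)

Definition kil x y : F := lftr (ad x \o ad y)%VF.

Lemma kilC x y : kil x y = kil y x.
Proof. exact: lftr_comp. Qed.

Lemma ad_linear : linear ad.
Proof.
move=> a x y; apply/lfunP => z; rewrite add_lfunE scale_lfunE !adE.
by rewrite (lieDl br_lie) (lieZl br_lie).
Qed.

Lemma ad0 : ad 0 = 0.
Proof. by apply/lfunP => x; rewrite adE (lie0l br_lie) zero_lfunE. Qed.

Lemma ad_br D x : derivation br D ->
  ad (D x) = (D \o ad x)%VF - (ad x \o D)%VF.
Proof.
move=> Dd; apply/lfunP => y.
by rewrite add_lfunE opp_lfunE !comp_lfunE !adE Dd addrK.
Qed.

Lemma kil_linear x : linear (kil x : L -> F^o).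
Proof.
move=> a y z; rewrite /kil ad_linear comp_lfunDr -comp_lfunZr lftrD lftrZ.
by [].
Qed.

Lemma kilDr x y z : kil x (y + z) = kil x y + kil x z.
Proof. by have := kil_linear x 1 y z; rewrite !scale1r. Qed.

Lemma kilZr x a y : kil x (a *: y) = a * kil x y.
Proof.
have k0 : kil x 0 = 0.
  by have := kil_linear x (-1) 0 0; rewrite scaleN1r addNr scaleN1r addNr.
by have := kil_linear x a y 0; rewrite !addr0 k0 addr0.
Qed.

Lemma kilDl x y z : kil (x + y) z = kil x z + kil y z.
Proof. by rewrite ![kil _ z]kilC kilDr. Qed.

Lemma kilZl a x y : kil (a *: x) y = a * kil x y.
Proof. by rewrite ![kil _ y]kilC kilZr. Qed.

(* The trace of [D, ad x] o ad y, written cyclically. *)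
Lemma lftr_derivation D x y : derivation br D ->
  lftr (D \o ad (br x y))%VF = kil (D x) y.
Proof.
move=> Dd; have -> : br x y = ad x y by rewrite adE.
rewrite (ad_br _ (ad_derivation br_lie x)) /kil (ad_br _ Dd).
rewrite comp_lfunDr comp_lfunNr comp_lfunDl comp_lfunNl !lftrD !lftrN.
rewrite !comp_lfunA; congr (_ - _).
by rewrite (lftr_comp (D \o ad y)%VF (ad x)) comp_lfunA.
Qed.

Lemma kil_inv x y z : kil (br x y) z = kil x (br y z).
Proof.
rewrite [in RHS]/kil lftr_derivation ?adE //; exact: ad_derivation.
Qed.

Lemma iter_br h x M : iter M (ad h) x = foldr br x (nseq M h).
Proof. by elim: M => //= M ->; rewrite adE. Qed.

Let H_sub : lie_subalg br H. Proof. by case: H_cartan. Qed.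
Let H_nil : lie_nilpotent br H. Proof. by case: H_cartan. Qed.

Lemma cartan_norm x : {in H, forall h, br x h \in H} -> x \in H.
Proof. by case: H_cartan => _ _ _ norm; apply: norm; rewrite memvf. Qed.

Lemma cartan_nil h x : h \in H -> x \in H -> exists M, iter M (ad h) x = 0.
Proof.
have [N HN] := H_nil => hH xH; exists N; rewrite iter_br HN ?size_nseq //.
by move=> z /nseqP[-> _].
Qed.

Lemma subspace_vs (U : {vspace L}) : is_subspace [set` U].
Proof. by split=> [|a u v Uu Uv] /=; rewrite ?mem0v // memvD ?memvZ. Qed.

(** If C were not inside H, Engel's theorem modulo H would give a vector outside H that normalizes
    H. *)
Lemma cartan_engel (C : set L) : is_subspace C ->
  (forall h x, h \in H -> C x -> C (br h x)) ->
  (forall h x, h \in H -> C x -> exists M, iter M (ad h) x = 0) ->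
  forall x, C x -> x \in H.
Proof.
move=> Cs CH CN x Cx; apply: contrapT => xH.
have [|||||y [Cy yH Hy]] := @engel _ _ _ br_lie H H_sub H_nil C [set` H] Cs.
- exact: subspace_vs.
- by [].
- by move=> h z hH /= zH; apply: H_sub.
- move=> h z hH /(CN h z hH)[M zM]; exists M; rewrite (_ : iter M _ z = 0) /= ?mem0v //.
  by rewrite -zM; apply: eq_iter => w; rewrite adE.
- by exists x.
by apply: yH; apply: cartan_norm => h hH; rewrite (lieC br_lie) memvN; apply: Hy.
Qed.

(** The radical is an ideal, so if non-zero it is L and the form vanishes. With D the derivation
    conjugate to ad w, the trace of D ad [a,b] is kil(Da,b) = 0. Since w is a sum of brackets, tr(D
    ad w) = 0 and ad w is nilpotent. *)
Lemma kil_nondeg x : (forall y, kil x y = 0) -> x = 0.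
Proof.
move=> x_rad; apply/eqP; apply: contraT => x0; exfalso.
have {x x0 x_rad} kil0 : forall x y, kil x y = 0.
  apply: (@simple_ideal [set x | forall y, kil x y = 0]).
  - split=> [y|a u v u0 v0 y] /=; first by rewrite kilC -(scale0r 0) kilZr mul0r.
    by rewrite kilDl kilZl u0 v0 mulr0 addr0.
  - by move=> y z z0 w; rewrite (lieC br_lie) -scaleN1r kilZl kil_inv z0 mulr0.
  - by exists x.
have adN w : loc_nil (ad w).
  have [p pP] := eigen_op_exists (ad w) Num.conj.
  have Dd : derivation br (pact (ad w) p).
    by apply: eigen_op_derivation pP; [exact: ad_derivation|exact: rmorphD].
  apply: eigen_op_trace0 pP _; set D := pact _ _ in Dd *.
  have := simple_derived w.
  apply: (@lspan_ind _ _ _ [set u | lftr (D \o ad u)%VF = 0]).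
    split=> [|a u v u0 v0] /=.
      by rewrite ad0 comp_lfun0r lftr0.
    by rewrite ad_linear comp_lfunDr -comp_lfunZr lftrD lftrZ u0 v0 mulr0 addr0.
  by move=> _ [a [b ->]] /=; rewrite lftr_derivation.
(* With every ad w nilpotent, Engel's theorem gives L = H, which is nilpotent. *)
have LH : forall x, x \in H.
  by move=> x; apply: (@cartan_engel setT) => // h z _ _; apply: adN.
apply: simple_not_nilpotent; have [N HN] := H_nil; exists N => s y sN _ _.
by apply: HN => // z _.
Qed.

(** By non-degeneracy some y represents the functional x -> tr(D ad x). For E = D - ad y this gives
    kil(Ea,b) = tr(E ad [a,b]) = 0, so E = 0. *)
Lemma derivation_inner D : derivation br D -> exists y, forall x, D x = br y x.
Proof.
move=> Dd; have kl x : linear (kil x : L -> F^o) := kil_linear x.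
pose theta (x : L) : 'Hom(L, F^o) := linfun (kil x : L -> F^o).
have thE x y : theta x y = kil x y by exact: linfun_linear.
have thl : linear theta.
  move=> a x y; apply/lfunP => z.
  by rewrite add_lfunE scale_lfunE !thE kilDl kilZl.
have thinj : lker (linfun theta) == 0%VS.
  rewrite -subv0; apply/subvP => x; rewrite memv_ker linfun_linear // memv0.
  move=> /eqP th0; apply/eqP/kil_nondeg => y.
  by rewrite -thE th0 zero_lfunE.
have trl : linear (fun x => lftr (D \o ad x)%VF : F^o).
  by move=> a x y; rewrite ad_linear comp_lfunDr -comp_lfunZr lftrD lftrZ.
have : linfun (fun x => lftr (D \o ad x)%VF : F^o) \in limg (linfun theta).
  suff -> : limg (linfun theta) = fullv by rewrite memvf.
  apply/eqP; rewrite eqEdim subvf limg_dim_eq; last first.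
    by rewrite (eqP thinj) capv0.
  (* The dual space has dimension [dim L * 1], so the injective [theta] is onto. *)
  by rewrite !dimvf [X in (X <= _)%N](muln1 (dim L)) leqnn.
move=> /memv_imgP[y _ Dy]; exists y.
pose E := D - ad y.
have Ed : derivation br E.
  move=> a b; rewrite /E !add_lfunE !opp_lfunE Dd ad_derivation //.
  by rewrite (lieDl br_lie) (lieDr br_lie) (lieNl br_lie) (lieNr br_lie) opprD addrACA.
have trE x : lftr (E \o ad x)%VF = 0.
  rewrite /E comp_lfunDl comp_lfunNl lftrD lftrN; apply/eqP; rewrite subr_eq0.
  have /lfunP/(_ x) := Dy; rewrite !linfun_linear // => ->.
  by [].
move=> x; apply/eqP; rewrite -subr_eq0 -adE -opp_lfunE -add_lfunE -/E.
apply/eqP/kil_nondeg => z.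
by rewrite -lftr_derivation.
Qed.

(** * Jordan components inside the Cartan subalgebra *)

Lemma mem_cartan_gen0 x h : x \in H -> h \in H -> gen_eigen (ad x) 0 h.
Proof.
move=> xH hH; have [M hM] := cartan_nil xH hH; exists M.
by rewrite subr0 pact_iter.
Qed.

(** The derivation p(ad x) is inner, say ad s. By nilpotency H lies in the generalized eigenspace of
    ad x for 0, where p(ad x) is phi(0) = 0. So s centralizes H and therefore lies in H. *)
Lemma cartan_eigen_op x phi p : x \in H ->
  (forall a b, phi (a + b) = phi a + phi b) -> eigen_op (ad x) phi p ->
  exists s, [/\ s \in H, forall y, pact (ad x) p y = br s y &
    {in H, forall h, br s h = 0}].
Proof.
move=> xH phiD pP.
have phi0 : phi 0 = 0.
  by apply: (@addrI _ (phi 0)); rewrite -phiD !addr0.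
have [s sE] := derivation_inner (eigen_op_derivation (ad_derivation br_lie x) phiD pP).
have s0 : {in H, forall h, br s h = 0}.
  move=> h hH; rewrite -sE (pP 0) ?phi0 ?scale0r //.
  exact: mem_cartan_gen0.
exists s; split=> //; apply: cartan_norm => h hH.
by rewrite s0 ?mem0v.
Qed.

(** At this point H is only known to be nilpotent. The derivation conjugate to ad(x + y) is ad s
    with s centralizing H, so ad s commutes with the nilpotent ad x and ad y, and the trace of ad s
    ad(x + y) is 0. *)
Lemma loc_nil_cartanD x y : x \in H -> y \in H ->
  loc_nil (ad x) -> loc_nil (ad y) -> loc_nil (ad (x + y)).
Proof.
move=> xH yH xN yN.
have [p pP] := eigen_op_exists (ad (x + y)) Num.conj.
have [|s [sH sE s0]] := cartan_eigen_op _ (@rmorphD _ _ _) pP.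
  exact: memvD.
apply: eigen_op_trace0 pP _.
have -> : pact (ad (x + y)) p = ad s by apply/lfunP => z; rewrite sE adE.
suff sN z : z \in H -> loc_nil (ad z) -> lftr (ad s \o ad z)%VF = 0.
  rewrite -[x in ad (x + y)]scale1r ad_linear scale1r comp_lfunDr lftrD.
  by rewrite !sN // addr0.
move=> zH zN; rewrite lftr_comp; apply: lftr_loc_nil; apply: loc_nil_comp => // w.
rewrite !adE (lie_leibniz br_lie) (lieC br_lie z s) s0 //.
by rewrite oppr0 (lie0l br_lie) add0r.
Qed.

Lemma loc_nilZ a x : loc_nil (ad x) -> loc_nil (ad (a *: x)).
Proof.
move=> xN y; have [M yM] := xN y; exists M.
have -> : iter M (ad (a *: x)) y = a ^+ M *: iter M (ad x) y.
  elim: M {yM} => [|M IH]; first by rewrite scale1r.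
  by rewrite /= IH linearZ /= !adE (lieZl br_lie) scalerA exprSr.
by rewrite yM scaler0.
Qed.

(** On the generalized eigenspace for a, p(f) is the scalar a, and f - a is nilpotent there. *)
Lemma eigen_op_nilpart f p : eigen_op f id p -> loc_nil (f - pact f p).
Proof.
move=> pP x.
have span := gen_eigen_span (f := f) (x := x) (subspaceT L) (fun _ => id) I.
apply: lspan_ind (subspace_loc_nil (f - pact f p)) _ span.
move=> y [_ [a [M]]]; elim: M y => [|M IH] y.
  by rewrite pact1 => ->; exists 0%N.
rewrite exprSr pactM pactXsubC => yM; have [N yN] := IH _ yM; exists N.+1.
rewrite iterSr add_lfunE opp_lfunE (pP a) //.
by exists M.+1; rewrite exprSr pactM pactXsubC.
Qed.

(** For S = p(f), the kernel of (S - a)^M is f-stable, hence spanned by generalized eigenvectors z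
    of f. If z belongs to the eigenvalue b, then Sz = bz and (b - a)^M z = 0, so b = a or z = 0. *)
Lemma eigen_op_diag f p a y : eigen_op f id p ->
  gen_eigen (pact f p) a y -> pact f p y = a *: y.
Proof.
move=> pP [M yM]; set S := pact f p in yM *.
pose P := [set z | pact S (('X - a%:P) ^+ M) z = 0].
have Ps : is_subspace P.
  by apply: subspace_ker => c u v; rewrite linearP.
have Pf z : P z -> P (f z).
  rewrite /P /= -pact_comm => [->|w]; first by rewrite linear0.
  by rewrite -!(pactX f) pact_swap.
have : is_subspace [set z | S z - a *: z = 0].
  apply: subspace_ker => c u v; rewrite linearP scalerDr scalerBr opprD addrACA.
  by rewrite !scalerA mulrC.
move=> /lspan_ind/(_ _ (gen_eigen_span Ps Pf yM))/= span.
apply/eqP; rewrite -subr_eq0; apply/eqP/span => z [Pz [b zb]] /=.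
have Sz : S z = b *: z by apply: pP.
suff : (b - a) ^+ M *: z = 0.
  move/eqP; rewrite scaler_eq0 expf_eq0 => /orP[/andP[_ ba]|/eqP ->].
    by rewrite Sz -scalerBl (eqP ba) scale0r.
  by rewrite linear0 scaler0 subrr.
rewrite -Pz; elim: M {yM P Ps Pf span Pz} => [|M IH].
  by rewrite pact1 scale1r.
rewrite exprSr [in RHS]exprS pactM -IH linearZ /=.
by rewrite pactXsubC Sz -scalerBl scalerA.
Qed.

Definition common_eigen (fs : seq 'End(L)) : set L :=
  [set y | forall f, f \in fs -> exists a, f y = a *: y].

(** Simultaneous diagonalization: each joint eigenspace of [fs] is stable under the commuting [f],
    which splits it further. *)
Lemma common_eigen_span (fs : seq 'End(L)) x :
  (forall f a y, f \in fs -> gen_eigen f a y -> f y = a *: y) ->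
  {in fs &, forall f g, forall y, f (g y) = g (f y)} ->
  lspan (common_eigen fs) x.
Proof.
elim: fs x => [|f fs IH] x fd fc; first by apply: sub_lspan.
have : lspan (common_eigen fs) x.
  apply: IH => [g a y gfs|g h gfs hfs]; first by apply: fd; rewrite inE gfs orbT.
  by apply: fc; rewrite inE ?gfs ?hfs orbT.
apply: lspan_ind => [|y ye]; first exact: lspan_subspace.
have /choice[a aP] (g : 'End(L)) : exists b, g \in fs -> g y = b *: y.
  have [gfs|gfs] := boolP (g \in fs); last by exists 0.
  by have [b gb] := ye g gfs; exists b.
pose P := [set z | forall g, g \in fs -> g z = a g *: z].
have Ps : is_subspace P.
  split=> [g gfs|c u v Pu Pv g gfs]; first by rewrite linear0 scaler0.
  by rewrite linearP /= Pu // Pv // scalerDr !scalerA mulrC.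
have Pf z : P z -> P (f z).
  move=> Pz g gfs; rewrite fc ?mem_head // ?inE ?gfs ?orbT //.
  by rewrite Pz // linearZ.
have := gen_eigen_span Ps Pf aP; apply: lspan_ind; first exact: lspan_subspace.
move=> z [Pz [b zb]]; apply: sub_lspan => g; rewrite inE => /predU1P[->|gfs].
  by exists b; apply: fd; rewrite ?mem_head.
by exists (a g); apply: Pz.
Qed.

Lemma mem_vbasis_subspace (W : set L) h : is_subspace W ->
  (forall x, x \in (vbasis H : seq L) -> W x) -> h \in H -> W h.
Proof.
move=> Ws WX /coord_vbasis ->; have [W0 WD] := Ws.
elim/big_ind: _ => // [u v Wu Wv|i _]; first exact: subspaceD.
by apply: subspaceZ => //; apply/WX/mem_nth; rewrite size_tuple.
Qed.

(** [s] is the semisimple part of [h]. The condition [h \in H] stands under the existential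
    quantifier, so that the choice axiom yields a function on all of L. *)
Lemma cartan_jordan h : exists s, h \in H ->
  [/\ s \in H, loc_nil (ad (h - s)), {in H, forall k, br s k = 0} &
   forall a y, gen_eigen (ad s) a y -> ad s y = a *: y].
Proof.
have [hH|_] := boolP (h \in H); last by exists 0.
have [p pP] := eigen_op_exists (ad h) id.
have [s [sH sE s0]] := cartan_eigen_op hH (fun _ _ => erefl) pP.
have Es : pact (ad h) p = ad s by apply/lfunP => y; rewrite sE adE.
exists s => _; split=> //; last by rewrite -Es => a y; apply: eigen_op_diag.
suff -> : ad (h - s) = ad h - pact (ad h) p by apply: eigen_op_nilpart.
by rewrite Es addrC -scaleN1r ad_linear scaleN1r addrC.
Qed.

Lemma kil_loc_nil k t : loc_nil (ad k) -> br t k = 0 -> kil k t = 0.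
Proof.
move=> kN tk; apply/lftr_loc_nil/loc_nil_comp => // y.
by rewrite !adE (lie_leibniz br_lie) (lieC br_lie k) tk oppr0 (lie0l br_lie) add0r.
Qed.

(** Polarization: a nilpotent z has kil(z,z) = 0, and k + n is again nilpotent. *)
Lemma kil_loc_nil2 k n : k \in H -> n \in H -> loc_nil (ad k) ->
  loc_nil (ad n) -> kil k n = 0.
Proof.
move=> kH nH kN nN.
have sq x : loc_nil (ad x) -> kil x x = 0.
  by move=> xN; apply: kil_loc_nil => //; apply: lie_alt.
have := sq _ (loc_nil_cartanD kH nH kN nN).
rewrite kilDl !kilDr !sq // add0r addr0 (kilC n) -mulr2n.
by move/eqP; rewrite mulrn_eq0 => /eqP.
Qed.

(** The aim is kil(n,y) = 0 for all y. The centralizer [C] of the semisimple parts of a basis of H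
    turns out to lie in H, which settles y in [C]. The other common eigenvectors of these parts are
    handled by invariance of the form. *)
Lemma cartan_loc_nil n : n \in H -> loc_nil (ad n) -> n = 0.
Proof.
have /choice[s sP] := cartan_jordan.
have XH x : x \in (vbasis H : seq L) -> x \in H by apply: vbasis_mem.
pose X := (vbasis H : seq L); pose C := [set y | forall x, x \in X -> br (s x) y = 0].
(* The semisimple parts satisfy [Q], and [Q] is a linear condition; hence every element of H is the
   sum of one satisfying [Q] and a nilpotent one. *)
pose Q t := [/\ t \in H, forall y, C y -> br t y = 0 &
  forall k, k \in H -> loc_nil (ad k) -> kil k t = 0].
have Qs : is_subspace Q.
  split=> [|a u v [uH uC uk] [vH vC vk]].
    split=> [|y _|k _ _]; rewrite ?mem0v ?(lie0l br_lie) //.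
    by rewrite -(scale0r 0) kilZr mul0r.
  split=> [|y Cy|k kH kN]; first by rewrite memvD // memvZ.
    by rewrite (lieDl br_lie) (lieZl br_lie) uC // vC // scaler0 addr0.
  by rewrite kilDr kilZr uk // vk // mulr0 addr0.
have dec h : h \in H -> exists t k, [/\ h = t + k, Q t, k \in H & loc_nil (ad k)].
  apply: (@mem_vbasis_subspace [set h | exists t k,
    [/\ h = t + k, Q t, k \in H & loc_nil (ad k)]]).
    split=> [|a _ _ [t [k [-> Qt kH kN]]] [u [l [-> Qu lH lN]]]].
      exists 0, 0; split; rewrite ?addr0 ?mem0v //; first by case: Qs.
      by move=> y; exists 1%N; rewrite /= ad0 zero_lfunE.
    exists (a *: t + u), (a *: k + l); split.
    - by rewrite scalerDr addrACA.
    - by case: Qs => _; apply.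
    - by rewrite memvD // memvZ.
    - by apply: loc_nil_cartanD; rewrite ?memvZ //; apply: loc_nilZ.
  move=> x xX; have [sH sN s0 _] := sP x (XH x xX).
  exists (s x), (x - s x); split=> //; first by rewrite addrC subrK.
    split=> // [y|k kH kN]; first exact.
    by apply: kil_loc_nil => //; apply: s0.
  by rewrite memvB // XH.
have Cs : is_subspace C.
  split=> [x _|a u v Cu Cv x xX]; first by rewrite (lie0r br_lie).
  by rewrite (lieDr br_lie) (lieZr br_lie) Cu // Cv // scaler0 addr0.
have CH h y : h \in H -> C y -> C (br h y).
  move=> hH Cy x xX; have [_ _ s0 _] := sP x (XH x xX).
  by rewrite (lie_leibniz br_lie) s0 // Cy // (lie0l br_lie) (lie0r br_lie) addr0.
(* On [C] an element t + k of H acts as its nilpotent summand k, so Engel's theorem puts [C] into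
   H. *)
have {}CH : forall y, C y -> y \in H.
  apply: cartan_engel => // h y hH Cy.
  have [t [k [-> [tH tC _] kH kN]]] := dec h hH.
  have [M yM] := kN y; exists M; rewrite -yM.
  suff [] : iter M (ad (t + k)) y = iter M (ad k) y /\ C (iter M (ad k) y) by [].
  elim: M {yM} => //= M [-> CM]; split; last by rewrite adE; apply: CH.
  by rewrite !adE (lieDl br_lie) tC // add0r.
move=> nH nN; apply: kil_nondeg => y.
pose fs := [seq ad (s x) | x <- X].
have : lspan (common_eigen fs) y.
  apply: common_eigen_span =>
    [f a z /mapP[x xX ->]|f g /mapP[x xX ->] /mapP[z zX ->] w].
    by have [_ _ _] := sP x (XH x xX); apply.
  have [_ _ s0 _] := sP x (XH x xX); have [sH _ _ _] := sP z (XH z zX).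
  by rewrite !adE (lie_leibniz br_lie) s0 // (lie0l br_lie) add0r.
apply: (lspan_ind (W := [set y | kil n y = 0])).
  split=> [|a u v /= un vn]; first by rewrite /= -(scale0r 0) kilZr mul0r.
  by rewrite kilDr kilZr un vn mulr0 addr0.
move=> z ze /=; have [Cz|] := pselect (C z).
  have [t [k [-> [_ _ tk] kH kN]]] := dec z (CH z Cz).
  by rewrite kilDr tk // add0r kil_loc_nil2.
(* Some semisimple part s has an eigenvalue a <> 0 on z, and a kil(n,z) = kil([n,s],z) = 0. *)
move=> /existsNP[x /not_implyP[xX /eqP xz]].
have [a] := ze _ (map_f (fun x => ad (s x)) xX); rewrite adE => az.
have a0 : a != 0 by apply: contraNneq xz => a0; rewrite az a0 scale0r.
have [_ _ s0 _] := sP x (XH x xX).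
apply: (mulfI a0); rewrite mulr0 -kilZr -az -kil_inv (lieC br_lie) s0 // oppr0.
by rewrite kilC -(scale0r 0) kilZr mul0r.
Qed.

Lemma cartan_semisimple h : h \in H -> {in H, forall k, br h k = 0} /\
  forall a y, gen_eigen (ad h) a y -> ad h y = a *: y.
Proof.
move=> hH; have [s /(_ hH)[sH sN s0 sd]] := cartan_jordan h.
suff -> : h = s by [].
by apply/eqP; rewrite -subr_eq0; apply/eqP/cartan_loc_nil => //; rewrite memvB //.
Qed.

Lemma cartan_abelian : {in H &, forall h k, br h k = 0}.
Proof. by move=> h k hH kH; case: (cartan_semisimple hH) => + _; apply. Qed.

(** * Root decomposition of a simple Lie algebra *)

Definition wt (a : L -> F) : set L :=
  [set x | {in H, forall h, br h x = a h *: x}].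

Lemma wt_span x : lspan [set y | exists a, wt a y] x.
Proof.
have : lspan (common_eigen [seq ad h | h <- vbasis H]) x.
  apply: common_eigen_span =>
    [f a y /mapP[h hX ->]|f g /mapP[h hX ->] /mapP[k kX ->] y].
    by have [_] := cartan_semisimple (vbasis_mem hX); apply.
  rewrite !adE (lie_leibniz br_lie) (cartan_abelian (vbasis_mem hX) (vbasis_mem kX)).
  by rewrite (lie0l br_lie) add0r.
apply: lspan_ind => [|y ye]; first exact: lspan_subspace.
apply: sub_lspan; have /choice[a aP] h : exists a, h \in H -> br h y = a *: y.
  have [hH|_] := boolP (h \in H); last by exists 0.
  have [|k kX|a ha] :=
    @mem_vbasis_subspace [set h | exists a, br h y = a *: y] h _ _ hH.
  - split=> [|b u v [c uc] [d vd]]; first by exists 0; rewrite (lie0l br_lie) scale0r.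
    by exists (b * c + d); rewrite (lieDl br_lie) (lieZl br_lie) uc vd scalerA scalerDl.
  - by have [a] := ye _ (map_f ad kX); rewrite adE; exists a.
  by exists a.
by exists a.
Qed.

Lemma wt_br a b x y : wt a x -> wt b y -> wt (fun h => a h + b h) (br x y).
Proof.
move=> xa yb h hH; rewrite (lie_leibniz br_lie) (xa h hH) (yb h hH).
by rewrite (lieZl br_lie) (lieZr br_lie) scalerDl.
Qed.

Lemma wt0_cartan a x : wt a x -> {in H, forall h, a h = 0} -> x \in H.
Proof.
move=> xa a0; apply: cartan_norm => h hH.
by rewrite (lieC br_lie) xa // a0 // scale0r oppr0 mem0v.
Qed.

Definition root_vec : set L :=
  [set x | exists2 a, wt a x & exists2 h, h \in H & a h != 0].

Definition root_br : set L := [set z | exists a x y,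
  [/\ wt a x, wt (fun h => - a h) y, z = br x y & exists2 h, h \in H & a h != 0]].

Lemma root_br_cartan z : root_br z -> z \in H.
Proof.
move=> [a [x [y [xa ya -> _]]]]; apply: (wt0_cartan (wt_br xa ya)) => h _.
exact: subrr.
Qed.

(** [x] may be taken to be a weight vector, of weight b. Its bracket with a root vector of weight a
    has weight a + b: it is a root vector, or an element of [root_br] if the weight is 0. If b = 0
    then [x] lies in the abelian H. *)
Lemma root_ideal x y : lspan (root_vec `|` root_br) y ->
  lspan (root_vec `|` root_br) (br x y).
Proof.
set I := lspan _; have Is : is_subspace I by apply: lspan_subspace.
have [I0 ID] := Is.
apply: (lspan_ind (W := [set y | I (br x y)])).
  split=> [|a u v Iu Iv] /=; first by rewrite (lie0r br_lie).
  by rewrite (lieDr br_lie) (lieZr br_lie); apply: ID.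
move=> z zr; move: (wt_span x); apply: (lspan_ind (W := [set x | I (br x z)])).
  split=> [|a u v Iu Iv] /=; first by rewrite (lie0l br_lie).
  by rewrite (lieDl br_lie) (lieZl br_lie); apply: ID.
move=> u [b ub] /=; have [b0|] := pselect (forall h, h \in H -> b h = 0).
  have uH := wt0_cartan ub b0.
  case: zr => [[a za ane]|/root_br_cartan zH].
    by rewrite za //; apply: (subspaceZ _ Is); apply: sub_lspan; left; exists a.
  by rewrite cartan_abelian.
move=> /existsNP[k /not_implyP[kH /eqP bk]].
case: zr => [[a za ane]|/root_br_cartan zH]; last first.
  rewrite (lieC br_lie) ub // -scaleNr; apply: (subspaceZ _ Is); apply: sub_lspan.
  by left; exists b => //; exists k.
apply: sub_lspan; have [ab|] := pselect (forall h, h \in H -> b h + a h = 0).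
  right; exists b, u, z; split=> //; last by exists k.
  by move=> h hH; rewrite za // -(addKr (b h) (a h)) ab // addr0.
move=> /existsNP[l /not_implyP[lH /eqP abl]].
by left; exists (fun h => b h + a h); [apply: wt_br|exists l].
Qed.

Lemma root_vec_orth x h : lspan root_vec x -> h \in H -> kil x h = 0.
Proof.
move=> xr hH; move: xr; apply: (lspan_ind (W := [set x | kil x h = 0])).
  split=> [|b u v /= u0 v0]; first by rewrite /= -(scale0r 0) kilZl mul0r.
  by rewrite kilDl kilZl u0 v0 mulr0 addr0.
move=> y [a ya [k kH ak]]; apply: (mulfI ak).
by rewrite mulr0 -kilZl -(ya k kH) (lieC br_lie) -scaleN1r kilZl kil_inv
  cartan_abelian // -(scale0r 0) kilZr mul0r mulr0.
Qed.

(** By simplicity the ideal spanned by [root_vec] and [root_br] is L, and h = u + w accordingly.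
    Then u also lies in H. As a sum of root vectors it is orthogonal to H, and as an element of H it
    is orthogonal to the root vectors; so u = 0. *)
Lemma cartan_root_br h : h \in H -> lspan root_br h.
Proof.
move=> hH; have br_neq0 := simple_not_abelian.
have I1 : exists2 x, lspan (root_vec `|` root_br) x & x != 0.
  (* Without root vectors L would equal the abelian H. *)
  apply: contrapT => no; have LH x : x \in H.
    have := wt_span x; apply: (lspan_ind (W := [set` H])); first exact: subspace_vs.
    move=> y [a ya] /=; have [a0|] := pselect (forall h, h \in H -> a h = 0).
      exact: wt0_cartan ya a0.
    move=> /existsNP[k /not_implyP[kH /eqP ak]].
    have [->|y0] := eqVneq y 0; first exact: mem0v.
    by case: no; exists y => //; apply: sub_lspan; left; exists a => //; exists k.
  by have [x [y]] := br_neq0; rewrite cartan_abelian ?eqxx.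
have := simple_ideal (lspan_subspace _) root_ideal I1 h.
move=> /lspanU[u [w [huw Su Sw]]].
have wH : w \in H.
  have := Sw; apply: (lspan_ind (W := [set` H])); first exact: subspace_vs.
  exact: root_br_cartan.
have uH : u \in H by rewrite -(addrK w u) -huw memvB.
suff u0 : u = 0 by rewrite huw u0 add0r.
apply: kil_nondeg => y; have := wt_span y.
apply: (lspan_ind (W := [set y | kil u y = 0])).
  split=> [|a v z /= v0 z0]; first by rewrite /= -(scale0r 0) kilZr mul0r.
  by rewrite kilDr kilZr v0 z0 mulr0 addr0.
move=> v [b vb] /=; have [b0|] := pselect (forall h, h \in H -> b h = 0).
  exact: root_vec_orth Su (wt0_cartan vb b0).
move=> /existsNP[k /not_implyP[kH /eqP bk]].
apply: (mulfI bk); rewrite mulr0 -kilZr -(vb k kH) -kil_inv cartan_abelian //.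
by rewrite kilC -(scale0r 0) kilZr mul0r.
Qed.

End Simple.

Section CommonEigenvector.
Variables (F : numClosedFieldType) (L : vectType F).

(** Applying f - a to a generalized eigenvector until just before it vanishes gives an eigenvector
    of f in P. The eigenspace of f in P is stable under the other operators. *)
Lemma common_eigenvector_in (fs : seq 'End(L)) (P : set L) :
  {in fs &, forall f g : 'End(L), forall y, f (g y) = g (f y)} ->
  is_subspace P -> (forall f, f \in fs -> forall y, P y -> P (f y)) ->
  (exists2 x, P x & x != 0) ->
  exists y, [/\ P y, y != 0 & common_eigen fs y].
Proof.
elim: fs P => [|f fs IH] P fc Ps Pf [x Px x0]; first by exists x.
have [y [M [a [Py yM y0]]]] : exists y M a,
    [/\ P y, pact f (('X - a%:P) ^+ M) y = 0 & y != 0].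
  apply: contrapT => no; case/negP: x0; apply/eqP.
  have := gen_eigen_span Ps (Pf f (mem_head _ _)) Px.
  apply: (lspan_ind (W := [set z | z = 0])).
    by split=> //= c u v -> ->; rewrite scaler0 addr0.
  move=> z [Pz [a [M zM]]] /=; apply/eqP; apply: contrapT => /negP z0.
  by apply: no; exists z, M, a.
have [z [Pz z0 fz]] : exists z, [/\ P z, z != 0 & f z = a *: z].
  elim: M y Py yM y0 => [|M IHM] y Py; first by rewrite pact1 => ->; rewrite eqxx.
  rewrite exprSr pactM pactXsubC => yM y0.
  have [fy|fy0] := eqVneq (f y - a *: y) 0.
    by exists y; split=> //; apply/eqP; rewrite -subr_eq0 fy.
  apply: IHM yM fy0; apply: subspaceB => //; first by apply: Pf; rewrite ?mem_head.
  exact: subspaceZ.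
pose Q := [set w | P w /\ f w = a *: w].
have [||||w [[Pw fw] w0 wfs]] := IH Q.
- by move=> g h gfs hfs; apply: fc; rewrite inE ?gfs ?hfs orbT.
- have [P0 PD] := Ps; split=> [|c u v [Pu fu] [Pv fv]]; split=> //.
  + by rewrite linear0 scaler0.
  + exact: PD.
  + by rewrite linearP /= fu fv scalerDr !scalerA mulrC.
- move=> g gfs w [Pw fw]; split; first by apply: Pf; rewrite // inE gfs orbT.
  by rewrite fc ?mem_head // ?inE ?gfs ?orbT // fw linearZ.
- by exists z.
exists w; split=> // g; rewrite inE => /predU1P[->|/wfs //].
by exists a.
Qed.

End CommonEigenvector.

(** * A simple subalgebra as a Lie algebra of its own *)

Section SubLie.
Variables (F : numClosedFieldType) (g : vectType F) (br : g -> g -> g).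
Hypothesis br_lie : lie_bracket br.
Variables (L0 h0 : {vspace g}).
Hypotheses (L0_simple : lie_simple br L0) (h0_cartan : cartan br L0 h0).

Lemma weight_linear (f : subvs_of h0 -> F^o) x : x != 0 ->
  (forall h, br (vsval h) x = f h *: x) -> linear f.
Proof.
move=> x0 fx a u v; apply/eqP.
rewrite -subr_eq0; have : (f (a *: u + v) - (a * f u + f v)) *: x == 0.
  rewrite scalerBl scalerDl -scalerA -!fx linearP /= (lieDl br_lie) (lieZl br_lie).
  by rewrite subrr.
by rewrite scaler_eq0 (negPf x0) orbF.
Qed.

Local Notation S := (subvs_of L0).

(** The preceding results concern a whole space [fullv]; they are applied to [subvs_of L0] with this
    bracket. The projection changes nothing, as [L0] is closed under [br]. *)
Definition brS (u v : S) : S := vsproj L0 (br (vsval u) (vsval v)).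

Lemma vsval_brS u v : vsval (brS u v) = br (vsval u) (vsval v).
Proof.
by rewrite /brS vsprojK //; have [sub _ _] := L0_simple; apply: sub; apply: subvsP.
Qed.

Lemma brS_lie : lie_bracket brS.
Proof.
split=> [y a u v|x a u v|x|x y z]; apply: val_inj => /=;
  rewrite ?linearP /= !vsval_brS ?linearP /=.
- by rewrite (lieDl br_lie) (lieZl br_lie).
- by rewrite (lieDr br_lie) (lieZr br_lie).
- by rewrite (lie_alt br_lie).
- exact: lie_jacobi.
Qed.

Definition hS : {vspace S} := (linfun (vsval : S -> g) @^-1: h0)%VS.

Lemma mem_hS u : (u \in hS) = (vsval u \in h0).
Proof. by rewrite -memv_preim linfun_linear //; exact: linearP. Qed.

Lemma brS_simple : lie_simple brS fullv.
Proof.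
have [sub [x [y [xL yL xy0]]] simple] := L0_simple.
have iE u : linfun (vsval : S -> g) u = vsval u.
  by rewrite linfun_linear //; exact: linearP.
split; first by move=> u v _ _; rewrite memvf.
  exists (vsproj L0 x), (vsproj L0 y); rewrite !memvf; split=> //.
  apply: contraNneq xy0 => /(congr1 vsval).
  by rewrite vsval_brS !vsprojK // linear0 => ->.
move=> I _ Iid.
have [|u v uL /memv_imgP[w wI ->]|I0|IL] := simple (linfun (vsval : S -> g) @: I)%VS.
- by apply/subvP => _ /memv_imgP[w _ ->]; rewrite iE subvsP.
- rewrite iE -[u](vsprojK uL) -vsval_brS -iE memv_img // Iid ?memvf //.
- left; apply/eqP; rewrite -subv0; apply/subvP => w wI.
  have : linfun (vsval : S -> g) w \in 0%VS by rewrite -I0 memv_img.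
  rewrite !memv0 iE => /eqP w0; apply/eqP/val_inj.
  by rewrite [LHS]w0 [RHS](linear0 (vsval : S -> g)).
- right; apply/eqP; rewrite eqEsubv subvf; apply/subvP => w _.
  have : vsval w \in (linfun (vsval : S -> g) @: I)%VS by rewrite IL subvsP.
  by move=> /memv_imgP[v vI]; rewrite iE => /val_inj ->.
Qed.

Lemma brS_cartan : cartan brS fullv hS.
Proof.
have [hL sub [N HN] norm] := h0_cartan; split; first exact: subvf.
- by move=> u v; rewrite !mem_hS vsval_brS; apply: sub.
- exists N => s y sN sH; rewrite mem_hS => yH; apply: val_inj; rewrite linear0.
  rewrite -(HN [seq vsval u | u <- s] (vsval y)) ?size_map //.
    elim: s {sN sH} => //= u s <-; exact: vsval_brS.
  by move=> _ /mapP[u us ->]; rewrite -mem_hS; apply: sH.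
- move=> u _ uN; rewrite mem_hS; apply: norm; first exact: subvsP.
  move=> h hH; have hL' := subvP hL _ hH.
  rewrite -(vsprojK hL') -vsval_brS -mem_hS; apply: uN.
  by rewrite mem_hS vsprojK.
Qed.

Lemma cartan_abelian_in : {in h0 &, forall h k, br h k = 0}.
Proof.
have [hL _ _ _] := h0_cartan => h k hH kH.
have [hL' kL'] := (subvP hL _ hH, subvP hL _ kH).
rewrite -(vsprojK hL') -(vsprojK kL') -vsval_brS.
by rewrite (cartan_abelian brS_lie brS_simple brS_cartan) ?linear0 // mem_hS vsprojK.
Qed.

Lemma has_weight_vsval a u : wt brS hS a u -> vsval u != 0 ->
  exists2 b : dual h0, has_weight br b (vsval u) &
    forall h : subvs_of h0, b h = a (vsproj L0 (vsval h)).
Proof.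
have [hL _ _ _] := h0_cartan => ua u0.
pose f (h : subvs_of h0) : F^o := a (vsproj L0 (vsval h)).
have fu h : br (vsval h) (vsval u) = f h *: vsval u.
  have hL' := subvP hL _ (subvsP h).
  rewrite -{1}(vsprojK hL') -vsval_brS ua ?linearZ //.
  by rewrite mem_hS vsprojK // subvsP.
have fl := weight_linear u0 fu.
by exists (linfun f) => h; rewrite linfun_linear.
Qed.

Lemma has_weight_span x : x \in L0 ->
  lspan [set y | y \in L0 /\ exists a : dual h0, has_weight br a y] x.
Proof.
set W := lspan _; have Ws : is_subspace W by apply: lspan_subspace.
move=> xL; rewrite -(vsprojK xL).
have := wt_span brS_lie brS_simple brS_cartan (vsproj L0 x).
apply: (lspan_ind (W := [set u | W (vsval u)])).
  by split=> [|a u v Wu Wv] /=; rewrite ?linear0 ?linearP /=; case: Ws => // W0; apply.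
move=> u [a ua] /=; have [->|u0] := eqVneq (vsval u) 0; first by case: Ws.
have [b ub _] := has_weight_vsval ua u0.
by apply: sub_lspan; split; [exact: subvsP|exists b].
Qed.

Lemma cartan_root_br_in h : h \in h0 ->
  lspan [set z | exists (a : dual h0) x y, [/\ x \in L0, y \in L0,
    has_weight br a x, has_weight br (- a) y & a != 0 /\ z = br x y]] h.
Proof.
set W := lspan _; have Ws : is_subspace W by apply: lspan_subspace.
have [hL _ _ _] := h0_cartan => hH; have hL' := subvP hL _ hH.
have hHS : vsproj L0 h \in hS by rewrite mem_hS vsprojK.
have := cartan_root_br brS_lie brS_simple brS_cartan hHS; rewrite -{2}(vsprojK hL').
apply: (lspan_ind (W := [set u | W (vsval u)])).
  by split=> [|a u v Wu Wv] /=; rewrite ?linear0 ?linearP /=; case: Ws => // W0; apply.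
move=> _ [a [x [y [xa ya -> [k kH ak]]]]] /=; rewrite vsval_brS.
have [->|x0] := eqVneq (vsval x) 0; first by rewrite (lie0l br_lie); case: Ws.
have [->|y0] := eqVneq (vsval y) 0; first by rewrite (lie0r br_lie); case: Ws.
have [b xb bE] := has_weight_vsval xa x0.
have [c yc cE] := has_weight_vsval ya y0.
have cb : c = - b by apply/lfunP => l; rewrite opp_lfunE cE bE.
apply: sub_lspan; exists b, (vsval x), (vsval y).
split; rewrite ?subvsP -?cb //; split=> //; apply: contraNneq ak => b0.
rewrite mem_hS in kH; have := bE (vsproj h0 (vsval k)).
by rewrite b0 zero_lfunE vsprojK // vsvalK => <-.
Qed.

End SubLie.

(** * Weights of a Lie torus *)

Section Torus.
Variables (F : numClosedFieldType) (g : vectType F) (br : g -> g -> g).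
Hypothesis br_lie : lie_bracket br.
Variables (n : nat) (sigma : 'I_n -> 'End(g)) (m : 'I_n -> nat) (xi : 'I_n -> F).
Hypothesis sigma_aut : forall i, lie_aut br (sigma i).
Hypothesis xi_prim : forall i, (m i).-primitive_root (xi i).
Variable h0 : {vspace g}.
Hypothesis LT : lie_torus br sigma m xi h0.
Local Notation ZZ := 'rV[int]_n.
Local Notation gr := (gr sigma xi).

Let hL : (h0 <= gr 0)%VS. Proof. by case: (torus_cartan LT). Qed.

Lemma Gam0 : Gam m 0.
Proof. by move=> i; rewrite mxE dvdz0. Qed.

Lemma GamD r s : Gam m r -> Gam m s -> Gam m (r + s).
Proof. by move=> rG sG i; rewrite mxE rpredD. Qed.

Lemma GamN r : Gam m r -> Gam m (- r).
Proof. by move=> rG i; rewrite mxE rpredN. Qed.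

Let xi0 i : xi i != 0.
Proof.
apply/eqP => xi0; have := prim_expr_order (xi_prim i).
rewrite xi0 expr0n (gtn_eqF (prim_order_gt0 (xi_prim i))) => /eqP.
by rewrite eq_sym oner_eq0.
Qed.

Lemma gr_br k l x y : x \in gr k -> y \in gr l -> br x y \in gr (k + l).
Proof.
move=> /grP xk /grP yl; apply/grP => i; have [_ ->] := sigma_aut i.
rewrite xk yl (lieZl br_lie) (lieZr br_lie) scalerA mxE expfzDr //.
Qed.

Lemma gr_Gam k r : Gam m r -> gr (k + r) = gr k.
Proof.
move=> rG; suff E i : xi i ^ (k + r) ord0 i = xi i ^ k ord0 i.
  by apply/eqP; rewrite eqEsubv; apply/andP; split; apply/subvP => x /grP xP;
    apply/grP => i; rewrite xP E.
rewrite mxE expfzDr //; have /dvdzP[q ->] := rG i.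
by rewrite [q * _]mulrC -exprz_exp -exprnP (prim_expr_order (xi_prim i)) exp1rz mulr1.
Qed.

Lemma has_weight_br (a b : dual h0) x y : has_weight br a x ->
  has_weight br b y -> has_weight br (a + b) (br x y).
Proof.
move=> xa yb h; rewrite (lie_leibniz br_lie) xa yb (lieZl br_lie) (lieZr br_lie).
by rewrite add_lfunE scalerDl.
Qed.

(** For k in [Gam] the space is g_0, where the Cartan subalgebra acts diagonalizably. Otherwise it
    is U + W. Here U has weight 0, and the weight vectors in W span a submodule, which is non-zero
    and hence all of W. *)
Lemma gr_wt_span k x : x \in gr k ->
  lspan [set y | exists a : dual h0, gr_wt br sigma xi k a y] x.
Proof.
have [kG|kG] := pselect (Gam m k).
  have -> : gr k = gr 0 by rewrite -[k]add0r gr_Gam.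
  move=> xk; have := has_weight_span br_lie (torus_simple LT) (torus_cartan LT) xk.
  apply: lspan_ind => [|y [y0 [a ya]]]; first exact: lspan_subspace.
  apply: sub_lspan; exists a; split=> //.
  by rewrite -[k]add0r gr_Gam.
have [gk0|gk0] := eqVneq (gr k) 0%VS.
  by rewrite gk0 memv0 => /eqP ->; case: (lspan_subspace
    [set y | exists a : dual h0, gr_wt br sigma xi k a y]).
have [U [W [gkE _ U0 Wst Wirr]]] := torus_comp LT kG gk0.
set T := [set y | _]; have Ts : is_subspace (lspan T) by apply: lspan_subspace.
have [T0 TD] := Ts.
rewrite gkE => /memv_addP[u uU [w wW ->]]; apply: (subspaceD Ts).
  apply: sub_lspan; exists 0; split; first by rewrite gkE (subvP (addvSl U W)).
  by move=> h; rewrite zero_lfunE scale0r U0 // (subvP hL) // subvsP.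
case: Wirr => [W0|[_ [Ws _ Wn0 Wmin] _]].
  by move: wW; rewrite W0 memv0 => /eqP ->.
pose Q := [set y | y \in W /\ lspan T y].
have Wgr y : y \in W -> y \in gr k by move=> yW; rewrite gkE (subvP (addvSr U W)).
suff [Q0|QW] : Q = [set 0] \/ Q = [set` W]; last 2 first.
- have : [set` W] w by []; rewrite -QW; by case.
- apply: Wmin; first by move=> y [].
    split; first by split=> //; rewrite mem0v.
    by move=> a y z [yW yT] [zW zT]; split; [rewrite memvD // memvZ|apply: TD].
  (* The span is stable because g_0 is itself spanned by weight vectors. *)
  move=> z y zL [yW yT]; split; first exact: Wst.
  have := has_weight_span br_lie (torus_simple LT) (torus_cartan LT) zL.
  apply: (lspan_ind (W := [set x | lspan T (br x y)])).
    by split=> [|c u' v Tu Tv] /=; rewrite ?(lie0l br_lie) ?(lieDl br_lie)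
      ?(lieZl br_lie); [exact: T0|apply: TD].
  move=> {}z [{}zL [a za]] /=; move: yT.
  apply: (lspan_ind (W := [set y | lspan T (br z y)])).
    by split=> [|c u' v Tu Tv] /=; rewrite ?(lie0r br_lie) ?(lieDr br_lie)
      ?(lieZr br_lie); [exact: T0|apply: TD].
  move=> v [b [vk vb]] /=; apply: sub_lspan; exists (a + b).
  by split; [rewrite -[k]add0r gr_br|apply: has_weight_br].
(* The case [Q] = 0 is excluded by a common eigenvector in W of a basis of the abelian [h0]. *)
exfalso.
pose X : seq g := vbasis h0.
have [||||y [yW y0 ye]] := @common_eigenvector_in _ _ [seq ad br h | h <- X] [set` W].
- move=> f f' /mapP[h hX ->] /mapP[k' kX ->] y; rewrite !adE //.
  rewrite (lie_leibniz br_lie) (cartan_abelian_in br_lie (torus_simple LT)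
    (torus_cartan LT) (vbasis_mem hX) (vbasis_mem kX)).
  by rewrite (lie0l br_lie) add0r.
- exact: Ws.
- move=> f /mapP[h hX ->] y yW; rewrite adE //; apply: Wst => //.
  exact/(subvP hL)/vbasis_mem.
- apply: contrapT => no; case/negP: Wn0; apply/eqP/seteqP; split=> [y yW|y ->] /=.
    by apply: contrapT => /eqP y0; apply: no; exists y.
  exact: mem0v.
suff : Q y by rewrite Q0 => y00; rewrite y00 eqxx in y0.
split=> //; apply: sub_lspan.
have /choice[a aP] h : exists a, h \in h0 -> br h y = a *: y.
  have [hH|_] := boolP (h \in h0); last by exists 0.
  have [|k' kX|a' ha] :=
    @mem_vbasis_subspace _ _ h0 [set h | exists a, br h y = a *: y] h _ _ hH.
  - split=> [|b u' v [c uc] [d vd]]; first by exists 0; rewrite (lie0l br_lie) scale0r.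
    by exists (b * c + d); rewrite (lieDl br_lie) (lieZl br_lie) uc vd scalerA scalerDl.
  - by have [a'] := ye _ (map_f (ad br) kX); rewrite adE //; exists a'.
  by exists a'.
exists (linfun (a \o vsval : subvs_of h0 -> F^o)); split; first exact: Wgr.
have fy h : br (vsval h) y = (a \o vsval : subvs_of h0 -> F^o) h *: y.
  exact/aP/subvsP.
by move=> h; rewrite linfun_linear //; exact: (weight_linear br_lie y0 fy).
Qed.

End Torus.

(** * Weight vectors *)

Section SpanFinite.
Variables (F : fieldType) (V : lmodType F).

Lemma lspan_seq (s : seq V) v : lspan [set` s] v ->
  exists C : 'I_(size s) -> F, v = \sum_j C j *: s`_j.
Proof.
apply: (lspan_ind (W := [set v | exists C : 'I_(size s) -> F,
  v = \sum_j C j *: s`_j])).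
  split=> [|a _ _ [C ->] [D ->]].
    by exists (fun=> 0); rewrite big1 // => j _; rewrite scale0r.
  exists (fun j => a * C j + D j); rewrite scaler_sumr -big_split /=.
  by apply: eq_bigr => j _; rewrite scalerDl scalerA.
move=> w /= ws; have wi : (index w s < size s)%N by rewrite index_mem.
exists (fun j => (j == Ordinal wi)%:R); rewrite (bigD1 (Ordinal wi)) //=.
rewrite eqxx scale1r nth_index // big1 ?addr0 // => j ji.
by rewrite (negPf ji) scale0r.
Qed.

Definition free_fam d (u : 'I_d -> V) : Prop :=
  forall a : 'I_d -> F, \sum_i a i *: u i = 0 -> forall i, a i = 0.

Lemma fin_dim_free (W : set V) : fin_dim W -> exists N, forall d (u : 'I_d -> V),
  (forall i, W (u i)) -> free_fam u -> (d <= N)%N.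
Proof.
move=> [s Ws]; exists (size s) => d u Wu uf; rewrite leqNgt; apply/negP => ds.
have /choice[C uC] i := lspan_seq (Ws _ (Wu i)).
pose A := \matrix_(i < d, j < size s) C i j.
have : kermx A != 0.
  rewrite kermx_eq0 /row_free neq_ltn (leq_ltn_trans (rank_leq_col A)) //.
move=> /rowV0Pn[v /sub_kermxP vA]; apply/negP; rewrite negbK.
apply/eqP/rowP => i; rewrite mxE; move: i; apply: uf.
under eq_bigr => i _ do rewrite uC scaler_sumr.
rewrite exchange_big big1 //= => j _.
under eq_bigr => i _ do rewrite scalerA.
rewrite -scaler_suml; have /rowP/(_ j) := vA; rewrite !mxE.
under eq_bigr => i _ do rewrite mxE.
by move=> ->; rewrite scale0r.
Qed.

Lemma free_fam_dependent d (u : 'I_d -> V) : ~ free_fam u ->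
  exists a : 'I_d -> F, \sum_i a i *: u i = 0 /\ exists i, a i != 0.
Proof.
move=> /existsNP[a /not_implyP[a0 /existsNP[i /eqP ai]]].
by exists a; split=> //; exists i.
Qed.

Lemma free_fam_span d (u : 'I_d -> V) (W : set V) v : is_subspace W ->
  (forall i, W (u i)) -> free_fam u ->
  (forall w : 'I_d.+1 -> V, (forall i, W (w i)) -> ~ free_fam w) -> W v ->
  exists C : 'I_d -> F, v = \sum_i C i *: u i.
Proof.
move=> Ws Wu uf dmax Wv.
pose w i := if unlift ord0 i is Some j then u j else v.
have [i|a [wa [i ai]]] := @free_fam_dependent _ w (dmax w _).
  by rewrite /w; case: unliftP.
move: wa; rewrite big_ord_recl /w unlift_none.
under eq_bigr => j _ do rewrite liftK.
have [a0|a0] := eqVneq (a ord0) 0.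
  rewrite a0 scale0r add0r => /uf ua; case/eqP: ai.
  by case: (unliftP ord0 i) => [j|] ->.
move=> /eqP; rewrite addr_eq0 => /eqP va.
exists (fun j => - (a ord0)^-1 * a (lift ord0 j)).
rewrite -[v](scalerK a0) va scalerN -scaleNr scaler_sumr.
by apply: eq_bigr => j _; rewrite scalerA.
Qed.

(** Iterating y = YZy gives y = Y^M Z^M y, which vanishes. *)
Lemma iter_unit_nil (Y Z : V -> V) y M : Y 0 = 0 -> Z 0 = 0 ->
  (forall v, Z (Y v) = Y (Z v)) -> y = Y (Z y) -> iter M Z y = 0 -> y = 0.
Proof.
move=> Y0 Z0 ZY yY; elim: M => //= M IH yM; apply: IH; rewrite yY.
have -> : iter M Z (Y (Z y)) = Y (iter M Z (Z y)).
  by elim: M {yM} => //= M ->; rewrite ZY.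
by rewrite -iterSr /= yM.
Qed.

End SpanFinite.

(** * Weight components of the vectors of a stable subspace *)

Section WeightComponents.
Variables (F : fieldType) (V : lmodType F) (I : Type) (A : I -> V -> V).
Hypothesis A_lin : forall q, linear (A q).
Implicit Types (c : I -> F) (s : seq ((I -> F) * V)).

Definition wv c : set V := [set v | forall q, A q v = c q *: v].

Let A0 q : A q 0 = 0.
Proof. by have := A_lin q (-1) 0 0; rewrite !scaleN1r !addNr. Qed.
Let AD q u v : A q (u + v) = A q u + A q v.
Proof. by have := A_lin q 1 u v; rewrite !scale1r. Qed.
Let Asum q s : A q (\sum_(p <- s) p.2) = \sum_(p <- s) A q p.2.
Proof. by elim: s => [|p s IH]; rewrite ?big_nil ?A0 // !big_cons AD IH. Qed.

Lemma wv_subspace c : is_subspace (wv c).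
Proof.
split=> [q|a u v uc vc q]; first by rewrite A0 scaler0.
by rewrite A_lin uc vc scalerDr !scalerA mulrC.
Qed.

Lemma lspan_wv_sum v : lspan [set w | exists c, wv c w] v ->
  exists2 s, (forall p, p \in s -> wv p.1 p.2) & v = \sum_(p <- s) p.2.
Proof.
apply: (lspan_ind (W := [set v | exists2 s,
  (forall p, p \in s -> wv p.1 p.2) & v = \sum_(p <- s) p.2])).
  split=> [|a _ _ [s sw ->] [t tw ->]]; first by exists [::]; rewrite ?big_nil.
  exists ([seq (p.1, a *: p.2) | p <- s] ++ t).
    move=> p; rewrite mem_cat => /orP[/mapP[q qs ->]|]; last exact: tw.
    exact/(subspaceZ a (wv_subspace _))/sw.
  by rewrite big_cat big_map /= scaler_sumr.
by move=> w [c wc]; exists [:: (c, w)]; rewrite ?big_seq1 // => p /[!inE]/eqP->.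
Qed.

Variable N : set V.
Hypotheses (N_sub : is_subspace N) (N_stable : forall q v, N v -> N (A q v)).

(* A component is isolated by applying the products of the A q - c q. *)
Lemma wv_component c u s : wv c u ->
  (forall p, p \in s -> wv p.1 p.2 /\ p.1 <> c) ->
  N (u + \sum_(p <- s) p.2) -> N u.
Proof.
have [k] := ubnP (size s); elim: k s u => // k IH [|[d w] s] u sk uc sw.
  by rewrite big_nil addr0.
have [/= wd dc] := sw _ (mem_head _ _).
have [q qc] : exists q, d q <> c q.
  apply: contrapT => no; apply: dc; apply/funext => q; apply: contrapT => dcq.
  by apply: no; exists q.
have cd : c q - d q != 0 by rewrite subr_eq0; apply/eqP => cd; apply: qc.
rewrite big_cons => /= Nu; have Nu' : N ((c q - d q) *: u).
  apply: (IH [seq (p.1, (p.1 q - d q) *: p.2) | p <- s]).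
  - by rewrite size_map.
  - exact: (subspaceZ _ (wv_subspace c)).
  - move=> _ /mapP[p ps ->] /=; have [|pw pc] := sw p; first by rewrite inE ps orbT.
    by split=> //; apply: (subspaceZ _ (wv_subspace _)).
  - suff -> : (c q - d q) *: u +
          \sum_(p <- [seq (p.1, (p.1 q - d q) *: p.2) | p <- s]) p.2 =
        A q (u + (w + \sum_(p <- s) p.2)) - d q *: (u + (w + \sum_(p <- s) p.2)).
      by apply: subspaceB => //; [apply: N_stable|apply: subspaceZ].
    rewrite !AD !scalerDr Asum uc wd big_map /=.
    rewrite !opprD addrACA -scalerBl; congr (_ + _).
    rewrite addrACA subrr add0r scaler_sumr -sumrB; apply: eq_big_seq => p ps.
    have [|pw _] := sw p; first by rewrite inE ps orbT.
    by rewrite pw scalerBl.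
by rewrite -[u](scalerK cd); apply: subspaceZ.
Qed.

(** The terms of the same weight as the first one are added up; [wv_component] places their sum in
    N, and fewer terms remain. *)
Lemma wv_components u : N u -> lspan [set w | exists c, wv c w] u ->
  lspan [set w | N w /\ exists c, wv c w] u.
Proof.
move=> Nu /lspan_wv_sum[s sw us]; move: Nu; rewrite {u}us.
have [k] := ubnP (size s); elim: k s sw => // k IH s sw sk.
case: s sw sk => [|[c v] s] sw sk Ns.
  by rewrite big_nil; case: (lspan_subspace [set w | N w /\ exists c, wv c w]).
set s' := (c, v) :: s in sw sk Ns *.
rewrite (bigID (fun p => p.1 == c)) /= in Ns *.
set U := \sum_(p <- s' | _) p.2 in Ns *.
set t := [seq p <- s' | p.1 != c].
have Et : \sum_(p <- s' | p.1 != c) p.2 = \sum_(p <- t) p.2 by rewrite big_filter.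
rewrite Et in Ns *.
have Uc : wv c U.
  rewrite /U big_seq_cond; elim/big_ind: _ => [|x y|p /andP[ps /eqP <-]].
  - by case: (wv_subspace c).
  - exact: (subspaceD (wv_subspace c)).
  - exact: sw.
have tw p : p \in t -> wv p.1 p.2 /\ p.1 <> c.
  by rewrite mem_filter => /andP[/eqP pc ps]; split=> //; apply: sw.
have NU : N U := wv_component Uc tw Ns.
apply: (subspaceD (lspan_subspace _)); first by apply: sub_lspan; split=> //; exists c.
apply: IH => [p /tw[] //||].
  rewrite /t /= eqxx /= size_filter; apply: leq_ltn_trans (count_size _ _) _.
  by rewrite -ltnS.
by rewrite -[X in N X](addKr U) addrC; apply: subspaceB.
Qed.

End WeightComponents.

(** * Level zero modules *)

Section Module.
Variables (F : numClosedFieldType) (g : vectType F) (br : g -> g -> g).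
Variables (form : g -> g -> F).
Hypotheses (br_lie : lie_bracket br) (form_ok : invariant_form br form).
Variables (n : nat) (sigma : 'I_n -> 'End(g)) (m : 'I_n -> nat) (xi : 'I_n -> F).
Hypothesis sigma_aut : forall i, lie_aut br (sigma i).
Hypothesis xi_prim : forall i, (m i).-primitive_root (xi i).
Variable h0 : {vspace g}.
Hypothesis LT : lie_torus br sigma m xi h0.
Variables (c1 c2 : F) (V : lmodType F) (rho : toroidal n g -> V -> V).
Local Notation tw := (twisted sigma m xi).
Hypothesis V_mod : lie_module (tbr br form c1 c2) tw rho.
Hypothesis level0 : forall i v, rho (tK F g 0 i) v = 0.

Local Notation ZZ := 'rV[int]_n.
Local Notation Gam := (Gam m).
Local Notation gr := (gr sigma xi).
Local Notation X k y := (rho (tX k y)).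
Local Notation K r i := (rho (tK F g r i)).
Local Notation D r i := (rho (td F g r i)).
Implicit Types (k l r s : ZZ) (i j : 'I_n) (x y : g) (u v : V)
  (e : toroidal n g).

Let form_lin x : scalar (form x). Proof. exact: form_linr form_ok x. Qed.
Let form_symm x y : form x y = form y x. Proof. exact: form_sym form_ok x y. Qed.

(** * Commutation rules for the action *)

Lemma twisted_subspace : is_subspace tw.
Proof. exact: lspan_subspace. Qed.

Lemma twisted_X k y : y \in gr k -> tw (tX k y).
Proof. by move=> yk; apply: sub_lspan; left; left; exists k, y. Qed.

Lemma Zm_K r i : Gam r -> Zm m (tK F g r i).
Proof. by move=> rG; apply: sub_lspan; exists r => //; exists i. Qed.

Lemma twisted_K r i : Gam r -> tw (tK F g r i).
Proof. by move=> rG; apply: sub_lspan; left; right; apply: Zm_K. Qed.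

Lemma twisted_d r i : Gam r -> tw (td F g r i).
Proof. by move=> rG; apply: sub_lspan; right; exists r => //; exists i. Qed.

Lemma rho_linear e : tw e -> linear (rho e).
Proof. exact: mod_linr V_mod e. Qed.

Lemma rho0r e : tw e -> rho e 0 = 0.
Proof. by move=> /rho_linear/(_ (-1) 0 0); rewrite !scaleN1r !addNr. Qed.

Lemma rhoDr e u v : tw e -> rho e (u + v) = rho e u + rho e v.
Proof. by move=> /rho_linear/(_ 1 u v); rewrite !scale1r. Qed.

Lemma rhoZr e a v : tw e -> rho e (a *: v) = a *: rho e v.
Proof. by move=> et; have := rho_linear et a v 0; rewrite rho0r // !addr0. Qed.

Lemma rho_sumr (I : Type) (t : seq I) (P : pred I) (G : I -> V) e : tw e ->
  rho e (\sum_(i <- t | P i) G i) = \sum_(i <- t | P i) rho e (G i).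
Proof.
by move=> et; apply: (big_morph _ _ (rho0r et)) => u v; apply: rhoDr.
Qed.

Lemma rho0l v : rho 0 v = 0.
Proof.
have [t0 _] := twisted_subspace.
by have := mod_linl V_mod (-1) v t0 t0; rewrite scaler0 addr0 scaleN1r addNr.
Qed.

Lemma rhoZl a e v : tw e -> rho (a *: e) v = a *: rho e v.
Proof.
move=> et; have [t0 _] := twisted_subspace.
by have := mod_linl V_mod a v et t0; rewrite !addr0 rho0l addr0.
Qed.

Lemma rhoDl e (d : toroidal n g) v : tw e -> tw d -> rho (e + d) v = rho e v + rho d v.
Proof. by move=> et dt; have := mod_linl V_mod 1 v et dt; rewrite !scale1r. Qed.

Lemma rhoC e (d : toroidal n g) v : tw e -> tw d ->
  rho e (rho d v) = rho d (rho e v) + rho (tbr br form c1 c2 e d) v.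
Proof. by move=> et dt; rewrite (mod_br V_mod) // addrC subrK. Qed.

Lemma sumK_E k r v : Gam r ->
  rho (sumK g k r) v = \sum_i (k ord0 i)%:~R *: K r i v /\ tw (sumK g k r).
Proof.
move=> rG; rewrite /sumK; elim: (index_enum _) => [|i t [IH IHt]].
  by rewrite !big_nil rho0l; split=> //; case: twisted_subspace.
rewrite !big_cons; have [t0 tD] := twisted_subspace.
have Kt := twisted_K i rG; split; last exact: tD.
by rewrite (mod_linl V_mod) // IH.
Qed.

Lemma tX_linear k : linear (tX k : g -> toroidal n g).
Proof.
move=> a x y; congr (_, _, _); last 2 first.
- by rewrite /= scaler0 addr0.
- by rewrite /= scaler0 addr0.
apply: val_inj; apply/funext => l /=.
rewrite -[RHS]/(a *: mono k x l + mono k y l) !coef_mono /mono_fun.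
by case: ifP; rewrite ?scaler0 ?addr0.
Qed.

Lemma tX0 k : tX k 0 = 0 :> toroidal n g.
Proof. by have := tX_linear k (-1) 0 0; rewrite !scaleN1r !addNr. Qed.

Lemma XKC k y r i v : y \in gr k -> Gam r -> X k y (K r i v) = K r i (X k y v).
Proof.
move=> yk rG; rewrite rhoC; [|exact: twisted_X|exact: twisted_K].
by rewrite tbr_XK // rho0l addr0.
Qed.

Lemma KKC r i s j v : Gam r -> Gam s -> K r i (K s j v) = K s j (K r i v).
Proof.
move=> rG sG; rewrite rhoC; try exact: twisted_K.
by rewrite tbr_KK // rho0l addr0.
Qed.

Lemma DXC r i k y v : y \in gr k -> Gam r ->
  D r i (X k y v) = X k y (D r i v) + (k ord0 i)%:~R *: X (k + r) y v.
Proof.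
move=> yk rG; rewrite rhoC; [|exact: twisted_d|exact: twisted_X].
rewrite tbr_dX // /brdX rhoZl //; apply: twisted_X.
by rewrite (gr_Gam _ xi_prim).
Qed.

Lemma DKC r i s j v : Gam r -> Gam s ->
  D r i (K s j v) = K s j (D r i v) +
   ((s ord0 i)%:~R *: K (r + s) j v +
    (i == j)%:R *: \sum_p (r ord0 p)%:~R *: K (r + s) p v).
Proof.
move=> rG sG; rewrite rhoC; [|exact: twisted_d|exact: twisted_K].
have rsG := GamD rG sG; have [<- st] := sumK_E r v rsG.
have Kt := twisted_K j rsG.
rewrite tbr_dK // /brdK (mod_linl V_mod) // ?rhoZl //.
exact: (subspaceZ _ twisted_subspace).
Qed.

Lemma D0DC i r j v : Gam r ->
  D 0 i (D r j v) = D r j (D 0 i v) + (r ord0 i)%:~R *: D r j v.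
Proof.
move=> rG; rewrite rhoC; [|by apply: twisted_d; apply: Gam0|exact: twisted_d].
have dt := twisted_d j rG.
rewrite tbr_dd // /brdd /phi1 /phi2 !mxE !add0r.
have -> : sumK g (0 : ZZ) r = 0.
  by rewrite /sumK big1 // => p _; rewrite mxE scale0r.
by rewrite !scaler0 addr0 scale0r subr0 addr0 rhoZl.
Qed.

Lemma XXC l k x y v : x \in gr 0 -> y \in gr 0 -> Gam l -> Gam k ->
  X l x (X k y v) = X k y (X l x v) + (X (l + k) (br x y) v +
    form x y *: \sum_p (l ord0 p)%:~R *: K (l + k) p v).
Proof.
move=> x0 y0 lG kG; have lkG := GamD lG kG.
have grG r : Gam r -> gr r = gr 0 by move=> rG; rewrite -[r]add0r (gr_Gam _ xi_prim).
have [<- st] := sumK_E l v lkG.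
rewrite rhoC; try by apply: twisted_X; rewrite grG.
rewrite tbr_XX // /brXX rhoDl ?rhoZl //; last exact: (subspaceZ _ twisted_subspace).
by apply: twisted_X; rewrite grG // -[0]add0r (gr_br br_lie sigma_aut xi_prim).
Qed.

Lemma X0XC h k y v : h \in h0 -> y \in gr k ->
  X 0 h (X k y v) = X k y (X 0 h v) + X k (br h y) v.
Proof.
move=> hH yk; have h_gr : h \in gr 0.
  by have [hL _ _ _] := torus_cartan LT; apply: (subvP hL).
rewrite rhoC; try exact: twisted_X.
rewrite tbr_XX // /brXX; have -> : sumK g (0 : ZZ) (0 + k) = 0.
  by rewrite /sumK big1 // => p _; rewrite mxE scale0r.
by rewrite scaler0 addr0 add0r.
Qed.

(** * Stable subspaces and weights *)

Let h0_gr h : h \in h0 -> h \in gr 0.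
Proof. by have [hL _ _ _] := torus_cartan LT; apply: (subvP hL). Qed.

(** Stability is tested on spanning elements, and for the loop part on weight vectors, since these
    span each g_k. *)
Lemma twisted_stable (W : set V) : is_subspace W ->
  (forall (a : dual h0) k y v, gr_wt br sigma xi k a y -> W v -> W (X k y v)) ->
  (forall r i v, Gam r -> W v -> W (K r i v)) ->
  (forall r i v, Gam r -> W v -> W (D r i v)) ->
  stable tw rho W.
Proof.
move=> Ws WX WK WD e v te; move: v.
(* Membership is carried along because [rho] is linear in its first argument on the twisted algebra
   only. *)
suff [] : tw e /\ forall v, W v -> W (rho e v) by [].
move: te; apply: (lspan_ind (W := [set e | tw e /\ forall v, W v -> W (rho e v)])).
  split=> [|a u w [ut uW] [wt wW]]; first split.
  - by case: twisted_subspace.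
  - by move=> v _; rewrite rho0l; case: Ws.
  - split=> [|v Wv]; first by case: twisted_subspace => _; apply.
    by rewrite (mod_linl V_mod) //; case: Ws => _; apply; auto.
have KW e' : Zm m e' -> tw e' /\ forall v, W v -> W (rho e' v).
  apply: (lspan_ind (W := [set e | tw e /\ forall v, W v -> W (rho e v)])).
    split=> [|a u w [ut uW] [wt wW]]; first split.
    - by case: twisted_subspace.
    - by move=> v _; rewrite rho0l; case: Ws.
    - split=> [|v Wv]; first by case: twisted_subspace => _; apply.
      by rewrite (mod_linl V_mod) //; case: Ws => _; apply; auto.
  by move=> _ [r rG [i ->]]; split=> [|v]; [exact: twisted_K|exact: WK].
move=> _ [[[k [y yk ->]]|/KW //]|[r rG [i ->]]]; last first.
  by split=> [|v]; [exact: twisted_d|exact: WD].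
split=> [|v Wv]; first exact: twisted_X.
have := gr_wt_span br_lie sigma_aut xi_prim LT yk.
suff : is_subspace [set y | y \in gr k /\ W (X k y v)].
  move=> Ys /(lspan_ind Ys)[] // z [a za]; split; first by case: za.
  exact: WX za Wv.
split=> [|a y1 y2 [y1k Wy1] [y2k Wy2]]; split.
- exact: mem0v.
- by rewrite tX0 rho0l; case: Ws.
- by rewrite memvD ?memvZ.
- rewrite tX_linear (mod_linl V_mod); try exact: twisted_X.
  by case: Ws => _; apply.
Qed.

(** The K_i are left out since they act by zero at level zero. *)
Definition wop (q : subvs_of h0 + 'I_n) : V -> V :=
  match q with inl h => X 0 (vsval h) | inr i => D 0 i end.

Lemma wop_linear q : linear (wop q).
Proof.
case: q => [h|i] /=; apply: rho_linear.
  by apply: twisted_X; apply: h0_gr; apply: subvsP.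
by apply: twisted_d; apply: Gam0.
Qed.

Implicit Types c : subvs_of h0 + 'I_n -> F.

Definition wshift c (a : dual h0) k : subvs_of h0 + 'I_n -> F := fun q =>
  match q with inl h => c q + a h | inr i => c q + (k ord0 i)%:~R end.

Lemma wv_X c (a : dual h0) k y v : gr_wt br sigma xi k a y ->
  wv wop c v -> wv wop (wshift c a k) (X k y v).
Proof.
move=> [yk ya] vc [h|i] /=.
  rewrite X0XC ?subvsP // ya; have := vc (inl h) => /= ->.
  rewrite rhoZr; last exact: twisted_X.
  have -> : tX k (a h *: y) = a h *: tX k y :> toroidal n g.
    by have := tX_linear k (a h) y 0; rewrite tX0 !addr0.
  by rewrite rhoZl ?scalerDl //; apply: twisted_X.
rewrite DXC //; last exact: Gam0.
have := vc (inr i) => /= ->.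
by rewrite addr0 scalerDl rhoZr //; apply: twisted_X.
Qed.

Lemma wv_K c r j v : Gam r -> wv wop c v -> wv wop (wshift c 0 r) (K r j v).
Proof.
move=> rG vc [h|i] /=.
  rewrite XKC //; last by apply: h0_gr; apply: subvsP.
  have := vc (inl h) => /= ->.
  by rewrite zero_lfunE addr0 rhoZr //; apply: twisted_K.
rewrite DKC //; last exact: Gam0.
have := vc (inr i) => /= ->; rewrite add0r scalerDl rhoZr; last exact: twisted_K.
by rewrite big1 ?scaler0 ?addr0 // => p _; rewrite mxE scale0r.
Qed.

Lemma wv_D c r j v : Gam r -> wv wop c v -> wv wop (wshift c 0 r) (D r j v).
Proof.
move=> rG vc [h|i] /=.
  have := DXC j v (h0_gr (subvsP h)) rG; rewrite mxE scale0r addr0 => <-.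
  have := vc (inl h) => /= ->.
  by rewrite zero_lfunE addr0 rhoZr //; apply: twisted_d.
rewrite D0DC //.
have := vc (inr i) => /= ->; rewrite scalerDl rhoZr //; exact: twisted_d.
Qed.

(** * Irreducible modules of level zero *)

Section Irreducible.
Hypothesis V_irr : irreducible tw rho setT.

Lemma irreducible_all (W : set V) : is_subspace W ->
  (forall (a : dual h0) k y v, gr_wt br sigma xi k a y -> W v -> W (X k y v)) ->
  (forall r i v, Gam r -> W v -> W (K r i v)) ->
  (forall r i v, Gam r -> W v -> W (D r i v)) ->
  (exists2 v, W v & v != 0) -> forall v, W v.
Proof.
move=> Ws WX WK WD [v0 Wv0 v0n0] v; have [_ _ _ Vmin] := V_irr.
have [//|W0|-> //] := Vmin W _ Ws (twisted_stable Ws WX WK WD).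
by move: Wv0; rewrite W0 => /= v00; rewrite v00 eqxx in v0n0.
Qed.

(** Weight vectors are mapped to weight vectors by the spanning elements of the algebra, so their
    span is a non-zero submodule. *)
Lemma weight_span : (exists c v, wv wop c v /\ v != 0) ->
  forall v, lspan [set w | exists c, wv wop c w] v.
Proof.
move=> [c0 [v0 [v0c v0n0]]]; set S := [set w | _].
have Ss := lspan_subspace S; have [S0 SD] := Ss.
have Sst (f : V -> V) : linear f -> (forall w, S w -> S (f w)) ->
    forall v, lspan S v -> lspan S (f v).
  move=> fl fS v; apply: (lspan_ind (W := [set v | lspan S (f v)])) => [|w /fS].
    have f0 : f 0 = 0 by have := fl (-1) 0 0; rewrite !scaleN1r !addNr.
    by split=> [|a u w Su Sw] /=; rewrite ?f0 ?fl //; apply: SD.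
  exact: sub_lspan.
apply: irreducible_all => //.
- move=> a k y v yk; apply: (Sst (X k y)) => [|w [c wc]].
    by apply: rho_linear; apply: twisted_X; case: yk.
  by exists (wshift c a k); apply: wv_X.
- move=> r i v rG; apply: (Sst (K r i)) => [|w [c wc]].
    by apply: rho_linear; apply: twisted_K.
  by exists (wshift c 0 r); apply: wv_K.
- move=> r i v rG; apply: (Sst (D r i)) => [|w [c wc]].
    by apply: rho_linear; apply: twisted_d.
  by exists (wshift c 0 r); apply: wv_D.
by exists v0 => //; apply: sub_lspan; exists c0.
Qed.

(** The vectors killed by a power of z = t^p K_j form a submodule, so z is injective or locally
    nilpotent. *)
Lemma K_torsion p j : Gam p ->
  (exists2 v, (exists M, iter M (K p j) v = 0) & v != 0) ->
  forall v, exists M, iter M (K p j) v = 0.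
Proof.
move=> pG; have zt := twisted_K j pG.
have iterZ M a u v : iter M (K p j) (a *: u + v) =
    a *: iter M (K p j) u + iter M (K p j) v.
  by elim: M => //= M ->; rewrite rho_linear.
have iterA M u v : iter M (K p j) (u + v) = iter M (K p j) u + iter M (K p j) v.
  by elim: M => //= M ->; rewrite rhoDr.
have iterC M (f : V -> V) v : (forall w, f (K p j w) = K p j (f w)) ->
    iter M (K p j) (f v) = f (iter M (K p j) v).
  by move=> fz; elim: M => //= M ->; rewrite fz.
have iter0 M : iter M (K p j) 0 = 0 by elim: M => //= M ->; rewrite rho0r.
have iter_ge v M M' : (M <= M')%N -> iter M (K p j) v = 0 -> iter M' (K p j) v = 0.
  by move=> MM' vM; rewrite -(subnK MM') iterD vM iter0.
apply: (irreducible_all (W := [set v | exists M, iter M (K p j) v = 0])).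
- split=> [|a u v [M uM] [M' vM']]; first by exists 0%N.
  exists (maxn M M'); rewrite iterZ (iter_ge _ _ _ (leq_maxl _ _) uM).
  by rewrite (iter_ge _ _ _ (leq_maxr _ _) vM') scaler0 addr0.
- move=> a k y v [yk _] [M vM]; exists M.
  rewrite iterC => [|w]; last exact: XKC.
  by rewrite vM rho0r //; apply: twisted_X.
- move=> r i v rG [M vM]; exists M.
  rewrite iterC => [|w]; last exact: KKC.
  by rewrite vM rho0r //; apply: twisted_K.
- move=> r i v rG [M vM].
  (* [Z] is the commutator of t^r d_i with z. It commutes with z, so one additional power of z
     absorbs it. *)
  pose Z w := (p ord0 i)%:~R *: K (r + p) j w +
    (i == j)%:R *: \sum_q (r ord0 q)%:~R *: K (r + p) q w.
  have rpG := GamD rG pG.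
  have Z0 : Z 0 = 0.
    rewrite /Z rho0r; last exact: twisted_K.
    rewrite big1 ?scaler0 ?addr0 // => q _.
    by rewrite rho0r ?scaler0 //; apply: twisted_K.
  have Zz w : Z (K p j w) = K p j (Z w).
    rewrite /Z rhoDr // !rhoZr // rho_sumr // KKC //; congr (_ + _ *: _).
    by apply: eq_bigr => q _; rewrite rhoZr // KKC.
  exists M.+1; elim: M v vM => [|M IH] v.
    by move=> /= ->; rewrite !rho0r //; apply: twisted_d.
  rewrite iterSr => vM; have := IH _ vM; rewrite DKC // -/(Z v).
  by rewrite iterA -iterSr (iterC _ Z) // [iter M.+1 _ v]iterSr vM Z0 addr0.
Qed.

Lemma rho_suml (t : seq 'I_n) (G : 'I_n -> toroidal n g) v :
  (forall i, tw (G i)) ->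
  rho (\sum_(i <- t) G i) v = \sum_(i <- t) rho (G i) v /\ tw (\sum_(i <- t) G i).
Proof.
move=> Gt; elim: t => [|i t [IH IHt]].
  by rewrite !big_nil rho0l; split=> //; case: twisted_subspace.
by rewrite !big_cons rhoDl // IH; split=> //; apply: (subspaceD twisted_subspace).
Qed.

Lemma rho_htilde_emb (t : htilde n h0) v : rho (htilde_emb t) v =
  wop (inl t.1.1) v + \sum_i t.2 ord0 i *: wop (inr i) v.
Proof.
have Kt i : tw (t.1.2 ord0 i *: tK F g 0 i).
  by apply: (subspaceZ _ twisted_subspace); apply: twisted_K; apply: Gam0.
have Dt i : tw (t.2 ord0 i *: td F g 0 i).
  by apply: (subspaceZ _ twisted_subspace); apply: twisted_d; apply: Gam0.
have [Ks Kst] := rho_suml (index_enum _) v Kt.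
have [Ds Dst] := rho_suml (index_enum _) v Dt.
have Xt : tw (tX 0 (vsval t.1.1)).
  by apply: twisted_X; apply: h0_gr; apply: subvsP.
rewrite /htilde_emb rhoDl //; last exact: (subspaceD twisted_subspace).
rewrite rhoDl // Ks Ds [Z in _ + Z + _]big1 ?addr0 => [|i _]; last first.
  by rewrite rhoZl ?level0 ?scaler0 //; apply: twisted_K; apply: Gam0.
congr (_ + _); apply: eq_bigr => i _.
by rewrite rhoZl //; apply: twisted_d; apply: Gam0.
Qed.

Lemma weight_space_wv (lam : 'Hom(htilde n h0, F^o)) v :
  weight_space rho lam v -> exists c, wv wop c v.
Proof.
move=> vlam; exists (fun q => match q with inl h => lam (h, 0, 0)
  | inr i => lam (0, 0, delta_mx ord0 i) end) => -[h|i].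
  have := vlam (h, 0, 0); rewrite rho_htilde_emb /= big1 ?addr0 // => i _.
  by rewrite mxE scale0r.
have := vlam (0, 0, delta_mx ord0 i); rewrite rho_htilde_emb /= tX0 rho0l add0r.
rewrite (bigD1 i) //= mxE !eqxx scale1r big1 ?addr0 // => j ji.
by rewrite mxE (negPf ji) andbF scale0r.
Qed.

(** If the space is non-zero, [c] is linear on [h0] and comes from a linear form on the extended
    Cartan subalgebra, to which the finiteness assumption applies. *)
Lemma wv_fin_dim c :
  (forall lam : 'Hom(htilde n h0, F^o), fin_dim (weight_space rho lam)) ->
  fin_dim (wv wop c).
Proof.
move=> V_fin; have [[v [vc v0]]|no] := pselect (exists v, wv wop c v /\ v != 0);
  last first.
  exists [::] => v vc; have [->|v0] := eqVneq v 0; last by case: no; exists v.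
  by case: (lspan_subspace [set` [::] : seq V]).
have cl : linear (fun h => c (inl h) : F^o).
  move=> a h k; apply/eqP; rewrite -subr_eq0.
  have : (c (inl (a *: h + k)) - (a * c (inl h) + c (inl k))) *: v == 0.
    rewrite scalerBl scalerDl -scalerA -!vc /= linearP /=.
    rewrite tX_linear (mod_linl V_mod) ?scalerN -?opprD ?subrr ?eqxx //;
      by apply: twisted_X; apply: h0_gr; apply: subvsP.
  by rewrite scaler_eq0 (negPf v0) orbF.
pose l (t : htilde n h0) : F^o := c (inl t.1.1) + \sum_i t.2 ord0 i * c (inr i).
have ll : linear l.
  move=> a t t'; rewrite /l cl scalerDr addrACA; congr (_ + _).
  rewrite scaler_sumr -big_split; apply: eq_bigr => i _ /=.
  by rewrite !mxE mulrDl -mulrA.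
have [s sP] := V_fin (linfun l); exists s => w wc; apply: sP => t.
rewrite rho_htilde_emb wc linfun_linear // scalerDl scaler_suml.
by congr (_ + _); apply: eq_bigr => i _; rewrite wc scalerA.
Qed.

Variable Pi : seq (dual h0).

Definition top : set V := [set v | forall (a : dual h0) k y,
  Delta_en_pos br sigma xi Pi a -> gr_wt br sigma xi k a y -> X k y v = 0].

Lemma highest_top v : highest_space br sigma xi Pi rho v <-> top v.
Proof.
split=> [vh a k y aP yk|vt e].
  by apply: vh; apply: sub_lspan; exists a, k; exists y.
have : is_subspace [set e | tw e /\ rho e v = 0].
  split=> [|b u w [ut u0] [wt w0]].
    by split; [case: twisted_subspace|exact: rho0l].
  split; first by case: twisted_subspace => _; apply.
  by rewrite (mod_linl V_mod) // u0 w0 scaler0 addr0.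
move=> Es /(lspan_ind Es)[] // _ [a [k [y [aP yk] ->]]]; split; last exact: vt yk.
by apply: twisted_X; case: yk.
Qed.

Lemma top_subspace : is_subspace top.
Proof.
split=> [a k y _ [yk _]|b u v ut vt a k y aP yk].
  by rewrite rho0r //; apply: twisted_X.
rewrite rho_linear; last by apply: twisted_X; case: yk.
by rewrite (ut a) // (vt a) // scaler0 addr0.
Qed.

Lemma top_K r j v : Gam r -> top v -> top (K r j v).
Proof.
move=> rG vt a k y aP yk; have [ykg _] := yk.
by rewrite XKC // (vt a) // rho0r //; apply: twisted_K.
Qed.

Lemma top_D r j v : Gam r -> top v -> top (D r j v).
Proof.
move=> rG vt a k y aP yk; have [ykg ya] := yk.
have dt := twisted_d j rG.
have /eqP := DXC j v ykg rG; rewrite (vt a) // rho0r // eq_sym.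
rewrite (vt a _ _ aP (_ : gr_wt br sigma xi (k + r) a y)) ?scaler0 ?addr0 => [/eqP //|].
by split=> //; rewrite (gr_Gam _ xi_prim).
Qed.

Lemma top_wop q v : top v -> top (wop q v).
Proof.
case: q => [h|i] vt; last by apply: top_D => //; apply: Gam0.
move=> a k y aP yk; have [ykg ya] := yk.
have ht : tw (tX 0 (vsval h)) by apply: twisted_X; apply: h0_gr; apply: subvsP.
have /eqP := X0XC v (subvsP h) ykg; rewrite (vt a) // rho0r // eq_sym ya.
have -> : tX k (a h *: y) = a h *: tX k y :> toroidal n g.
  by have := tX_linear k (a h) y 0; rewrite tX0 !addr0.
rewrite rhoZl; last exact: twisted_X.
by rewrite (vt a k y aP yk) scaler0 addr0 => /eqP.
Qed.

(** * A root pair e, f whose bracket acts by a non-zero scalar *)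

Section RootPair.
Hypothesis V_fin :
  forall lam : 'Hom(htilde n h0, F^o), fin_dim (weight_space rho lam).
Variables (a : dual h0) (e f : g) (c : subvs_of h0 + 'I_n -> F) (w0 : V).
Hypotheses (e_gr : e \in gr 0) (e_wt : has_weight br a e).
Hypotheses (f_gr : f \in gr 0) (f_wt : has_weight br (- a) f).
Hypothesis a_pos : Delta_en_pos br sigma xi Pi a.
Hypothesis ef_h0 : br e f \in h0.
Hypotheses (w0_top : top w0) (w0_wt : wv wop c w0) (w0_neq0 : w0 != 0).
Local Notation lam := (c (inl (vsproj h0 (br e f)))).
Hypothesis lam_neq0 : lam != 0.

Let gr_G r : Gam r -> gr r = gr 0.
Proof. by move=> rG; rewrite -[r]add0r (gr_Gam _ xi_prim). Qed.

Let Xe_tw r : Gam r -> tw (tX r e).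
Proof. by move=> rG; apply: twisted_X; rewrite gr_G. Qed.

Let Xf_tw r : Gam r -> tw (tX r f).
Proof. by move=> rG; apply: twisted_X; rewrite gr_G. Qed.

Let ef_gr r : Gam r -> br e f \in gr r.
Proof. by move=> rG; rewrite gr_G //; apply: h0_gr. Qed.

(** The commutator of e t^l and f t^k as an operator. On highest weight vectors it is their product,
    because e t^l kills these. *)
Definition pair_op l k v : V :=
  X (l + k) (br e f) v + form e f *: \sum_p (l ord0 p)%:~R *: K (l + k) p v.

Lemma pair_opE l k v : Gam l -> Gam k -> top v ->
  X l e (X k f v) = pair_op l k v.
Proof.
move=> lG kG vt; rewrite XXC //.
by rewrite (vt a) ?rho0r ?add0r //; [exact: Xf_tw|split; rewrite ?gr_G].
Qed.

Lemma wshiftD r s b : wshift (wshift b 0 r) 0 s = wshift b 0 (r + s).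
Proof.
apply/funext => -[h|i] /=; first by rewrite zero_lfunE !addr0.
by rewrite !mxE rmorphD addrA.
Qed.

Lemma wshift0 b : wshift b 0 0 = b.
Proof. by apply/funext => -[h|i] /=; rewrite ?zero_lfunE ?mxE addr0. Qed.

(** The central term has degree 0 and vanishes at level zero; the eigenvalue of [e,f] in [h0] is not
    changed by degree shifts. *)
Lemma pair_opN l v : Gam l -> top v -> wv wop (wshift c 0 l) v ->
  X l e (X (- l) f v) = lam *: v.
Proof.
move=> lG vt vc; rewrite pair_opE //; last exact: GamN.
rewrite /pair_op subrr [Z in _ + _ *: Z]big1 => [|p _]; last first.
  by rewrite level0 scaler0.
rewrite scaler0 addr0; have := vc (inl (vsproj h0 (br e f))).
by rewrite /= vsprojK // zero_lfunE addr0.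
Qed.

Lemma wv_f k v : Gam k -> wv wop (wshift c 0 k) v ->
  wv wop (wshift c (- a) 0) (X (- k) f v).
Proof.
move=> kG vc; have -> : wshift c (- a) 0 = wshift (wshift c 0 k) (- a) (- k).
  apply/funext => -[h|i] /=; first by rewrite zero_lfunE addr0.
  by rewrite !mxE addr0 rmorphN addrK.
apply: wv_X vc; split=> //; rewrite gr_G //; exact: GamN.
Qed.

(** By [pair_opN] the operator f t^-k is injective on the highest weight vectors of weight c + k. It
    maps these spaces, for all k, into the single weight space of V for c - a. *)
Lemma top_weight_bound : exists N, forall k (d : nat) (u : 'I_d -> V), Gam k ->
  (forall q, top (u q) /\ wv wop (wshift c 0 k) (u q)) ->
  free_fam u -> (d <= N)%N.
Proof.
have [N NP] := fin_dim_free (wv_fin_dim (wshift c (- a) 0) V_fin).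
exists N => k d u kG uk uf; apply: (NP d (fun q => X (- k) f (u q))).
  by move=> q; have [_] := uk q; apply: wv_f.
move=> b /(congr1 (X k e)); rewrite rho0r ?rho_sumr; try exact: Xe_tw.
under eq_bigr => q _.
  have [ut uc] := uk q.
  rewrite rhoZr ?pair_opN //; last exact: Xe_tw.
  rewrite scalerA; over.
by move=> /uf b0 i; have /eqP := b0 i; rewrite mulf_eq0 (negPf lam_neq0) orbF => /eqP.
Qed.

(** The first commutator has degree 0 and vanishes at level zero. In the second, the sum of the p_q
    t^p K_q is zero by the relations of the centre. *)
Lemma DK_relations p i j v : Gam p ->
  D (- p) i (K p j v) = K p j (D (- p) i v) /\
  D (- p) i (K (p + p) j v) = K (p + p) j (D (- p) i v) +
    ((p + p) ord0 i)%:~R *: K p j v.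
Proof.
move=> pG; split.
  rewrite DKC //; last exact: GamN.
  rewrite addNr level0 scaler0 add0r [Z in _ + _ *: Z]big1 ?scaler0 ?addr0 //.
  by move=> q _; rewrite level0 scaler0.
rewrite DKC ?addKr; [|exact: GamN|exact: GamD].
suff -> : \sum_q ((- p) ord0 q)%:~R *: K p q v = 0 by rewrite scaler0 addr0.
have [Ep _] := sumK_E p v pG.
under eq_bigr => q _ do rewrite mxE rmorphN scaleNr.
by rewrite sumrN -Ep sumK_eq0 rho0l oppr0.
Qed.

(* On a weight space of maximal dimension in the direction of p, the operators
   z D and z^-2 Y, where z = t^p K_j, D = t^-p d_i and Y = t^2p K_j, would have
   the non-zero scalar 2 p_i as commutator, which contradicts the trace. *)
Lemma K_not_injective p j : Gam p -> ~ (forall v, K p j v = 0 -> v = 0).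
Proof.
move=> pG z_inj; have [i pi0] : exists i, p ord0 i != 0.
  apply: contrapT => no; case/negP: w0_neq0; apply/eqP/z_inj.
  suff -> : p = 0 by apply: level0.
  apply/rowP => i; rewrite mxE; apply/eqP; apply: contrapT => pi.
  by apply: no; exists i; apply/negP.
have ppG := GamD pG pG; have zt := twisted_K j pG.
have Yt := twisted_K j ppG; have dt := twisted_d i (GamN pG).
pose W k v := top v /\ wv wop (wshift c 0 k) v.
have Ws k : is_subspace (W k).
  have [T0 TD] := top_subspace; have [C0 CD] := wv_subspace wop_linear (wshift c 0 k).
  by split=> [//|b u v [ut uc] [vt vc]]; split; [apply: TD|apply: CD].
have WK k r v : Gam r -> W k v -> W (k + r) (K r j v).
  move=> rG [vt vc]; split; first exact: top_K.
  by rewrite -wshiftD; apply: wv_K.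
have WD k v : W k v -> W (k - p) (D (- p) i v).
  move=> [vt vc]; split; first by apply: top_D => //; apply: GamN.
  by rewrite -wshiftD; apply: wv_D => //; apply: GamN.
(* The dimension is maximized over all degree shifts in [Gam], which [top_weight_bound] permits. *)
pose ok (d : nat) := `[< exists k, Gam k /\ exists u : 'I_d -> V,
  (forall q, W k (u q)) /\ free_fam u >].
have ok1 : ok 1%N.
  apply/asboolP; exists 0; split; first exact: Gam0.
  exists (fun=> w0); split=> [_|b]; first by split; rewrite ?wshift0.
  rewrite big_ord1 => /eqP; rewrite scaler_eq0 (negPf w0_neq0) orbF => /eqP b0 q.
  by rewrite ord1.
have okx : exists d, ok d by exists 1%N.
have [N NP] := top_weight_bound.
have okN (d : nat) : ok d -> (d <= N)%N.
  by move=> /asboolP[k [kG [u [uW uf]]]]; exact: (NP k _ u).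
have [d /asboolP[k [kG [u [uW uf]]]] dmax] := ex_maxnP okx okN.
have d0 : (0 < d)%N by apply: dmax.
have maxf r (w : 'I_d.+1 -> V) : Gam r -> (forall q, W r (w q)) -> ~ free_fam w.
  move=> rG wW wf; suff /dmax : ok d.+1 by rewrite ltnn.
  by apply/asboolP; exists r; split=> //; exists w.
have kpG : Gam (k + (p + p)) by apply: GamD.
(* By injectivity the z^2 u_q are free, so by maximality they span the space at k + 2p. The matrix
   [B] expresses Y u_q through them, and [A] expresses z D u_q through the u_q. *)
pose zz q := K p j (K p j (u q)).
have zzW q : W (k + (p + p)) (zz q).
  by rewrite addrA; apply: (WK _ _ _ pG); apply: (WK _ _ _ pG).
have zzf : free_fam zz.
  move=> b bz; apply: uf; apply: (z_inj); apply: (z_inj); rewrite -[RHS]bz.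
  by rewrite !rho_sumr //; apply: eq_bigr => q _; rewrite !rhoZr.
have /choice[B BE] q := free_fam_span (Ws _) zzW zzf (fun w => maxf _ w kpG)
  (WK k _ _ ppG (uW q)).
have zDW q : W k (K p j (D (- p) i (u q))).
  by rewrite -[k](subrK p); apply: (WK _ _ _ pG); apply: (WD _ _ (uW q)).
have /choice[A AE] q := free_fam_span (Ws _) uW uf (fun w => maxf _ w kG) (zDW q).
pose Am := \matrix_(q, o) A q o; pose Bm := \matrix_(q, o) B q o.
have zD_zz q : K p j (D (- p) i (zz q)) = \sum_o A q o *: zz o.
  have [Dz _] := DK_relations i j (K p j (u q)) pG.
  have [Dz' _] := DK_relations i j (u q) pG.
  rewrite /zz Dz Dz' AE !rho_sumr //; apply: eq_bigr => o _; rewrite !rhoZr //.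
(* Both sides are z D Y u_q: once computed in the z^2 u_q directly, once after moving D past Y,
   which adds 2 p_i z^2 u_q. *)
have comm q : \sum_o ((Bm *m Am) q o) *: zz o =
    \sum_o ((Am *m Bm) q o) *: zz o + ((p + p) ord0 i)%:~R *: zz q.
  have E (C C' : 'I_d -> 'I_d -> F) (w : 'I_d -> V) :
      (forall o, w o = \sum_b C' o b *: zz b) ->
      \sum_o C q o *: w o =
      \sum_o ((\matrix_(q, o) C q o *m \matrix_(q, o) C' q o) q o) *: zz o.
    move=> wE; under eq_bigr => o _ do rewrite wE scaler_sumr.
    rewrite exchange_big; apply: eq_bigr => o _ /=.
    rewrite mxE scaler_suml; apply: eq_bigr => r _.
    by rewrite !mxE scalerA.
  rewrite -(E _ _ _ zD_zz) -(E _ _ _ BE).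
  have -> : \sum_o B q o *: K p j (D (- p) i (zz o)) =
      K p j (D (- p) i (K (p + p) j (u q))).
    by rewrite BE !rho_sumr //; apply: eq_bigr => o _; rewrite !rhoZr.
  have [_ ->] := DK_relations i j (u q) pG.
  rewrite rhoDr // rhoZr // KKC // AE rho_sumr //; congr (_ + _).
  by apply: eq_bigr => o _; rewrite rhoZr.
have BA : Bm *m Am - Am *m Bm = ((p + p) ord0 i)%:~R%:M.
  move: (Bm *m Am) (Am *m Bm) comm => M1 M2 M12.
  apply/matrixP => q o; apply/eqP; rewrite -subr_eq0; apply/eqP; move: o.
  apply: zzf; under eq_bigr => o _ do rewrite 3!mxE !scalerBl.
  rewrite !sumrB M12 [Z in Z - _ - _]addrC addrK (bigD1 q) //= eqxx.
  rewrite big1 ?addr0 ?subrr // => o oq.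
  by rewrite eq_sym (negPf oq) scale0r.
(* A commutator has trace 0, while the scalar matrix has trace 2 d p_i, which is non-zero. *)
have := congr1 mxtrace BA; rewrite linearB /= mxtrace_mulC subrr mxtrace_scalar.
move/eqP; rewrite eq_sym mulrn_eq0 (gtn_eqF d0) /= intr_eq0 mxE.
by rewrite -mulr2n mulrn_eq0 (negPf pi0).
Qed.

(** * Products of central elements *)

Definition Kprod (t : seq (ZZ * 'I_n)) v : V := foldr (fun o => K o.1 o.2) v t.
Definition Kdeg (t : seq (ZZ * 'I_n)) : ZZ := \sum_(o <- t) o.1.
Implicit Types t : seq (ZZ * 'I_n).

Lemma Kprod_commute t (T : V -> V) v : (forall o, o \in t -> Gam o.1) ->
  (forall r j w, Gam r -> T (K r j w) = K r j (T w)) ->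
  T (Kprod t v) = Kprod t (T v).
Proof.
move=> tG TK; elim: t tG => //= o t IH tG; rewrite TK ?IH // => [y yt|].
  by apply: tG; rewrite inE yt orbT.
by apply: tG; rewrite mem_head.
Qed.

Lemma Kprod_swap (s t : seq (ZZ * 'I_n)) v : (forall o, o \in s -> Gam o.1) ->
  (forall o, o \in t -> Gam o.1) -> Kprod s (Kprod t v) = Kprod t (Kprod s v).
Proof.
move=> sG tG; apply: Kprod_commute => // r j w rG.
by rewrite -Kprod_commute // => r' j' w' r'G; apply: KKC.
Qed.

Lemma pair_op_K l k r j v : Gam l -> Gam k -> Gam r ->
  K r j (pair_op l k v) = pair_op l k (K r j v).
Proof.
move=> lG kG rG; have rt := twisted_K j rG; have lkG := GamD lG kG.
rewrite /pair_op rhoDr // rhoZr // rho_sumr // XKC ?ef_gr //.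
congr (_ + _ *: _); apply: eq_bigr => p _; by rewrite rhoZr // KKC.
Qed.

Lemma pair_op0 l k : Gam l -> Gam k -> pair_op l k 0 = 0.
Proof.
move=> lG kG; have lkG := GamD lG kG.
rewrite /pair_op rho0r; last by apply: twisted_X; apply: ef_gr.
rewrite big1 ?scaler0 ?addr0 // => p _.
by rewrite rho0r ?scaler0 //; apply: twisted_K.
Qed.

Lemma Kprod0 t : (forall o, o \in t -> Gam o.1) -> Kprod t 0 = 0.
Proof.
move=> tG; elim: t tG => //= o t IH tG; rewrite IH ?rho0r // => [|y yt].
  by apply: twisted_K; apply: tG; rewrite mem_head.
by apply: tG; rewrite inE yt orbT.
Qed.

Lemma Kprod_top t : (forall o, o \in t -> Gam o.1) ->
  [/\ Gam (Kdeg t), top (Kprod t w0) & wv wop (wshift c 0 (Kdeg t)) (Kprod t w0)].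
Proof.
rewrite /Kdeg; elim: t => [_|o t IH tG].
  by rewrite big_nil wshift0; split=> //; apply: Gam0.
have [|tG' tt tc] := IH; first by move=> y yt; apply: tG; rewrite inE yt orbT.
have oG : Gam o.1 by apply: tG; rewrite mem_head.
rewrite big_cons; split; [exact: GamD|exact: top_K|].
by rewrite addrC -wshiftD; apply: wv_K.
Qed.

(* Were a product of dim V_{c - a} many t^r K_j non-zero on w0, a linear
   dependency would give y = Y (z y) for some partial product y <> 0, with z
   the next factor and Y commuting with z. *)
Lemma Kprod_vanish : (forall r j v, Gam r -> exists M, iter M (K r j) v = 0) ->
  exists N, forall t, (forall o, o \in t -> Gam o.1) -> size t = N ->
    Kprod t w0 = 0.
Proof.
move=> K_nil.
have [N NP] := fin_dim_free (wv_fin_dim (wshift c (- a) 0) V_fin).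
exists N => t tG tN; pose y q := Kprod (take q t) w0; pose P q := Kdeg (take q t).
have takeG q o : o \in take q t -> Gam o.1 by move=> /mem_take; apply: tG.
have yT q : [/\ Gam (P q), top (y q) & wv wop (wshift c 0 (P q)) (y q)].
  exact: Kprod_top (takeG q).
(* For all q the vector f t^(-P q) y_q lies in the one weight space for c - a, so these N + 1
   vectors are dependent. *)
have [|b [bu [q0 bq0]]] :=
    @free_fam_dependent _ _ _ (fun q : 'I_N.+1 => X (- P q) f (y q)).
  move=> /NP; rewrite ltnn => /(_ _)/implyP/= [q|//].
  by have [PG _ yc] := yT q; apply: wv_f.
(* [p] is the least index with a non-zero coefficient. *)
case: (@arg_minnP _ q0 (fun q => b q != 0) (fun q : 'I_N.+1 => val q) bq0).
move=> /= p bp pmin.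
have [PpG ypt ypc] := yT p.
have pairG q w : w = y q -> X (P p) e (X (- P q) f w) = pair_op (P p) (- P q) w.
  by move=> ->; have [PG yt _] := yT q; rewrite pair_opE //; apply: GamN.
(* Apply e t^(P p) to the dependency: the term of index p becomes a multiple of y_p by [lam], the
   others become values of [pair_op]. *)
have rel : (b p * lam) *: y p =
    - \sum_(q < N.+1 | q != p) b q *: pair_op (P p) (- P q) (y q).
  move: bu => /(congr1 (X (P p) e)); rewrite rho0r ?rho_sumr; try exact: Xe_tw.
  rewrite (bigD1 p) //= rhoZr; last exact: Xe_tw.
  rewrite pair_opN // scalerA => /eqP; rewrite addr_eq0 => /eqP ->.
  congr (- _); apply: eq_bigr => q _; rewrite rhoZr ?pairG //; exact: Xe_tw.
have blam : b p * lam != 0 by rewrite mulf_neq0.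
have tpG : forall o, o \in take p t -> Gam o.1 := takeG p.
have tdG o : o \in drop p t -> Gam o.1 by move=> /mem_drop; apply: tG.
suff yp0 : y p = 0.
  rewrite -[t](cat_take_drop p) /Kprod foldr_cat -!/(Kprod _ _) Kprod_swap //.
  by rewrite -/(y p) yp0 Kprod0.
have bq (q : 'I_N.+1) : q != p -> (q <= p)%N -> b q = 0.
  move=> qp q_le_p; apply/eqP; apply: contraT => /pmin p_le_q.
  by case/eqP: qp; apply/val_inj/eqP; rewrite eqn_leq q_le_p.
(* Without a next factor p = N is the last index, so all other coefficients vanish and y_p = 0 at
   once. *)
case Et : (drop p t) => [|z t'].
  apply: (scalerI blam); rewrite scaler0 rel big1 ?oppr0 // => q qp.
  rewrite bq ?scale0r //; have /eqP := congr1 size Et.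
  rewrite size_drop tN subn_eq0; apply: leq_trans.
  by rewrite -ltnS.
have zG : Gam z.1 by apply: tdG; rewrite Et mem_head.
have t'G (q : nat) o : o \in take q t' -> Gam o.1.
  by move=> /mem_take ot'; apply: tdG; rewrite Et inE ot' orbT.
have zt := twisted_K z.2 zG.
(* For q > p the product y_q contains z y_p and q - p - 1 further factors taken from [t'], which [Y]
   collects. The terms with q < p have coefficient 0. *)
pose Y v := - (b p * lam)^-1 *: \sum_(q < N.+1 | q != p)
  b q *: pair_op (P p) (- P q) (Kprod (take (q - p).-1 t') v).
have PN q : Gam (- P q) by apply: GamN; case: (yT q).
have [M yM] := K_nil z.1 z.2 (y p) zG.
apply: (@iter_unit_nil _ _ Y (K z.1 z.2) (y p) M _ _ _ _ yM).
- rewrite /Y big1 ?scaler0 // => q _.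
  by rewrite Kprod0 ?pair_op0 ?scaler0 //; apply: t'G.
- exact: rho0r.
- move=> v; rewrite /Y rhoZr // rho_sumr //; congr (_ *: _).
  apply: eq_bigr => q _; rewrite rhoZr // pair_op_K //; congr (_ *: pair_op _ _ _).
  rewrite (@Kprod_commute _ (K z.1 z.2)) // => [o|r j w rG]; first exact: t'G.
  exact: KKC.
rewrite /Y -[LHS](scalerK blam) rel scalerN -scaleNr; congr (_ *: _).
apply: eq_bigr => q qp; have [q_le_p|p_lt_q] := leqP q p.
  by rewrite bq // !scale0r.
congr (_ *: pair_op _ _ _); rewrite /y -{1}(subnKC (ltnW p_lt_q)) takeD Et.
rewrite -{1}(ltn_predK (_ : 0 < q - p)%N) ?subn_gt0 //=.
rewrite /Kprod foldr_cat /= -!/(Kprod _ _).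
rewrite -(@Kprod_commute _ (K z.1 z.2)) //; last by move=> *; apply: KKC.
rewrite Kprod_swap // => [|o]; last exact: t'G.
apply: (@Kprod_commute _ (K z.1 z.2)) => [o|r j w rG]; first exact: t'G.
exact: KKC.
Qed.

End RootPair.

(** Commutators of central elements with the algebra are again central, so the vectors killed by all
    t^r K_j form a submodule. *)
Lemma K_killed_all : (exists2 v, (forall r j, Gam r -> K r j v = 0) & v != 0) ->
  forall v r j, Gam r -> K r j v = 0.
Proof.
apply: irreducible_all.
- split=> [r j rG|b u v u0 v0 r j rG]; first by rewrite rho0r //; apply: twisted_K.
  rewrite rho_linear; last exact: twisted_K.
  by rewrite u0 // v0 // scaler0 addr0.
- move=> a k y v [yk _] v0 r j rG.
  by rewrite -XKC // v0 // rho0r //; apply: twisted_X.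
- by move=> s i v sG v0 r j rG; rewrite KKC // v0 // rho0r //; apply: twisted_K.
move=> s i v sG v0 r j rG; have st := twisted_d i sG.
have := DKC i j v sG rG; rewrite !v0 ?rho0r //; last exact: GamD.
rewrite scaler0 add0r big1 ?scaler0 ?addr0 => [<- //|q _].
by rewrite v0 ?scaler0 //; apply: GamD.
Qed.

(** * Existence of a root pair and triviality of the centre *)

Hypothesis Pi_base : root_base (Delta0 br sigma xi (h0 := h0)) Pi.

(** [h0] is spanned by brackets of opposite root vectors, so one of these brackets does not kill
    [w]. If its root is negative, e and f exchange their roles, at the cost of a sign. *)
Lemma exists_root_pair x w : x \in h0 -> X 0 x w != 0 ->
  exists (a : dual h0) (e f : g), [/\ e \in gr 0, f \in gr 0,
    has_weight br a e, has_weight br (- a) f &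
    Delta_en_pos br sigma xi Pi a /\ X 0 (br e f) w != 0].
Proof.
move=> xh0 xw; have [sub _ _] := torus_simple LT.
have [a [e [f [[e_gr f_gr ea fa] [a0 efw]]]]] : exists (a : dual h0) (e f : g),
    [/\ e \in gr 0, f \in gr 0, has_weight br a e & has_weight br (- a) f] /\
    (a != 0 /\ X 0 (br e f) w != 0).
  apply: contrapT => no; case/negP: xw; apply/eqP.
  have := cartan_root_br_in br_lie (torus_simple LT) (torus_cartan LT) xh0.
  have Ws : is_subspace [set z | z \in gr 0 /\ X 0 z w = 0].
    split=> [|b u v [ut u0] [vt v0]]; first by split; [exact: mem0v|rewrite tX0 rho0l].
    split; first by apply: memvD => //; apply: memvZ.
    rewrite tX_linear (mod_linl V_mod); try exact: twisted_X.
    by rewrite u0 v0 scaler0 addr0.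
  move=> /(lspan_ind Ws)[] // _ [a [e [f [e_gr f_gr ea fa [a0 ->]]]]].
  split; first exact: sub.
  apply/eqP; apply: contraT => efw; case: no.
  by exists a, e, f.
have neq0 (b : dual h0) y z : X 0 (br y z) w != 0 -> y != 0 /\ z != 0.
  move=> yz; split; apply: contraNneq yz => ->.
    by rewrite (lie0l br_lie) tX0 rho0l.
  by rewrite (lie0r br_lie) tX0 rho0l.
have [e0 f0] := neq0 a _ _ efw.
have aD : Delta0 br sigma xi a by split=> //; exists e.
have [_ _ Pi_pos] := Pi_base; have [a_pos|a_neg] := Pi_pos _ aD.
  by exists a, e, f; split=> //; split=> //; split=> //; left.
exists (- a), f, e; rewrite opprK; split=> //; split.
  by split=> //; left; split; rewrite ?oppr_eq0 //; exists f.
rewrite (lieC br_lie) -scaleN1r.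
have -> : tX 0 (-1 *: br e f) = -1 *: tX 0 (br e f) :> toroidal n g.
  by have := tX_linear 0 (-1) (br e f) 0; rewrite tX0 !addr0.
rewrite rhoZl; last by apply: twisted_X; apply: sub.
by rewrite scaleN1r oppr_eq0.
Qed.

(** The bracket has weight 0, hence normalizes the self-normalizing [h0]. *)
Lemma br_opposite_cartan (a : dual h0) (e f : g) : e \in gr 0 -> f \in gr 0 ->
  has_weight br a e -> has_weight br (- a) f -> br e f \in h0.
Proof.
move=> e_gr f_gr ea fa; have [sub _ _] := torus_simple LT.
have [_ _ _ norm] := torus_cartan LT; apply: norm; first exact: sub.
move=> h hh0; rewrite (lieC br_lie) -[h](vsprojK hh0).
have := has_weight_br br_lie ea fa (vsproj h0 h).
by rewrite subrr => ->; rewrite zero_lfunE scale0r oppr0 mem0v.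
Qed.

Theorem level_zero_center_trivial :
  (forall lam : 'Hom(htilde n h0, F^o), fin_dim (weight_space rho lam)) ->
  (exists c v, wv wop c v /\ v != 0) ->
  (exists2 x, x \in h0 & exists2 v, top v & X 0 x v != 0) ->
  forall v r j, Gam r -> K r j v = 0.
Proof.
move=> V_fin hw [x xh0 [u ut xu]].
(* The given highest weight vector is a sum of weight vectors of the same space, and [x] does not
   kill all of them. *)
have [w0 [c [wt wc xw]]] : exists w c, [/\ top w, wv wop c w & X 0 x w != 0].
  apply: contrapT => no; case/negP: xu; apply/eqP.
  have xt := twisted_X (h0_gr xh0).
  have := wv_components wop_linear top_subspace top_wop ut (weight_span hw u).
  have /lspan_ind : is_subspace [set w | X 0 x w = 0].
    exact: (subspace_ker (rho_linear xt)).
  apply=> w [wt [c wc]] /=; apply/eqP; apply: contraT => xw.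
  by case: no; exists w, c.
have [a [e [f [e_gr f_gr ea fa [a_pos efw]]]]] := exists_root_pair xh0 xw.
have ef_h0 := br_opposite_cartan e_gr f_gr ea fa.
have lam0 : c (inl (vsproj h0 (br e f))) != 0.
  apply: contraNneq efw => c0; have := wc (inl (vsproj h0 (br e f))).
  by rewrite /= vsprojK // c0 scale0r => ->.
have w0n0 : w0 != 0.
  apply: contraNneq xw => ->; rewrite rho0r //.
  exact: twisted_X (h0_gr xh0).
(* Injectivity being excluded, every t^r K_j is locally nilpotent. *)
have K_nil r j v : Gam r -> exists M, iter M (K r j) v = 0.
  move=> rG; apply: K_torsion => //; apply: contrapT => no.
  apply: (K_not_injective V_fin e_gr ea f_gr fa a_pos ef_h0 wt wc w0n0 lam0 rG
    (j := j)).
  move=> w rw; apply/eqP; apply: contraT => wn0.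
  by case: no; exists w => //; exists 1%N.
have [N NP] := Kprod_vanish V_fin e_gr ea f_gr fa a_pos ef_h0 wt wc lam0 K_nil.
(* At the least length for which all products kill [w0], some product with one factor less is
   non-zero on [w0]; its value is killed by all t^r K_j. *)
pose ok (k : nat) := `[< forall t : seq (ZZ * 'I_n),
  (forall o, o \in t -> Gam o.1) -> size t = k -> Kprod t w0 = 0 >].
have exk : exists k : nat, ok k by exists N; apply/asboolP.
have [[|k] /asboolP okk kmin] := ex_minnP exk.
  by have := okk [::] (fun _ => ltac:(by [])) erefl; move/eqP: w0n0.
have : ~~ ok k by apply: contraFN (ltnn k) => /kmin.
move=> /asboolPn/existsNP[t /not_implyP[tG /not_implyP[tk /eqP tw0]]].
apply: K_killed_all; exists (Kprod t w0) => // r j rG.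
apply: (okk ((r, j) :: t)); last by rewrite /= tk.
by move=> o; rewrite inE => /predU1P[->|/tG].
Qed.

End Irreducible.
End Module.

Theorem theorem4p1 (R : realType)
    (g : vectType R[i]) (br : g -> g -> g) (h : {vspace g})
    (form : g -> g -> R[i])
    (br_lie : lie_bracket br)
    (g_simple : lie_simple br fullv)
    (h_cartan : cartan br fullv h)
    (form_ok : invariant_form br form)
    (n : nat) (sigma : 'I_n -> 'End(g)) (m : 'I_n -> nat) (xi : 'I_n -> R[i])
    (sigma_aut : forall i, lie_aut br (sigma i))
    (sigma_comm : forall i j, (sigma i \o sigma j = sigma j \o sigma i)%VF)
    (sigma_order : forall i, end_order (sigma i) (m i))
    (xi_prim : forall i, (m i).-primitive_root (xi i))
    (h0 : {vspace g}) (h0_sub : (h0 <= h)%VS)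
    (LT_torus : lie_torus br sigma m xi h0)
    (Pi : seq (dual h0)) (Pi_base : root_base (Delta0 br sigma xi (h0 := h0)) Pi)
    (c1 c2 : R[i])
    (V : lmodType R[i]) (rho : toroidal n g -> V -> V)
    (V_mod : lie_module (tbr br form c1 c2) (twisted sigma m xi) rho)
    (V_irr : irreducible (twisted sigma m xi) rho setT)
    (V_hw : level_zero_highest_weight br sigma m xi Pi rho)
    (V_fin : forall lam : 'Hom(htilde n h0, R[i]^o),
       fin_dim (weight_space rho lam))
    (h0_nontriv : exists2 x, x \in h0 &
       exists2 v, highest_space br sigma xi Pi rho v & rho (tX 0 x) v != 0) :
  forall z v, Zm m z -> rho z v = 0.
Proof.
have [[v0 [v0n0 [lam v0lam] _ _ _]] level0] := V_hw.
have K0 : forall v r j, Gam m r -> rho (tK R[i] g r j) v = 0.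
  apply: (level_zero_center_trivial br_lie form_ok sigma_aut xi_prim LT_torus
    V_mod level0 V_irr Pi_base V_fin).
    by have [c v0c] := weight_space_wv LT_torus V_mod level0 v0lam; exists c, v0.
  have [x xh0 [v vh xv]] := h0_nontriv; exists x => //; exists v => //.
  exact/(highest_top V_mod).
(* This passes from the t^r K_j to their span; membership in the twisted algebra gives the linearity
   of [rho]. *)
have Ws : is_subspace [set z | twisted sigma m xi z /\ forall v, rho z v = 0].
  have [t0 tD] := twisted_subspace sigma m xi.
  split=> [|a u w [ut u0] [wt w0]]; first by split=> // v; apply: (rho0l V_mod).
  by split=> [|v]; [exact: tD|rewrite (mod_linl V_mod) // u0 w0 scaler0 addr0].
move=> z v /(lspan_ind Ws)[] // _ [r rG [j ->]].
by split=> [|w]; [exact: twisted_K|exact: K0].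
Qed.
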